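(* Let $f:\mathbb{C}\to\mathbb{C}$ be a nonconstant entire function and let $a\in\mathbb{C}$ with $a\neq 0$. Suppose that $f$ and $f'$ share their simple zeroes, and that every simple $a$-point of $f$ is a (not necessarily simple) $a$-point of $f'$, i.e. for every $z\in\mathbb{C}$, if $f(z)=a$ and $f'(z)\neq 0$, then $f'(z)=a$. Then $f\equiv f'$.
   Context: For $c\in\mathbb{C}$, a simple $c$-point of an entire function $f$ is a point where $f$ takes the value $c$ with multiplicity one, i.e. a point $z$ with $f(z)=c$ and $f'(z)\neq 0$; a $c$-point is a point where the value $c$ is taken (with any multiplicity). The functions $f$ and $f'$ share their simple zeroes if the points where $f$ has a zero of multiplicity one are exactly the points where $f'$ has a zero of multiplicity one, i.e. for every $z\in\mathbb{C}$, ($f(z)=0$ and $f'(z)\neq 0$) if and only if ($f'(z)=0$ and $f''(z)\neq 0$). *)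

(* Defs.v *)
From Stdlib Require Import Reals.
From Coquelicot Require Import Coquelicot.
Open Scope C_scope.

(* [ex_derive] is taken over [C_AbsRing], i.e. this is complex differentiability.
   [C_derive] is computed from real limits in the real direction, so it is the
   complex derivative only where that exists ([C_derive_correct]).  An entire
   function and its derivative are both entire, so below this is always so for
   [C_derive f] and [C_derive (C_derive f)]. *)
Definition entire (f : C -> C) : Prop := forall z : C, ex_derive f z.

Definition nonconstant (f : C -> C) : Prop :=
  ~ exists k : C, forall z : C, f z = k.

Definition c_point (f : C -> C) (c z : C) : Prop := f z = c.

(* For entire [f], multiplicity one means a nonvanishing first derivative. *)
Definition simple_c_point (f : C -> C) (c z : C) : Prop :=
  c_point f c z /\ C_derive f z <> RtoC 0%R.

Definition share_simple_zeroes (f g : C -> C) : Prop :=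
  forall z : C, simple_c_point f (RtoC 0%R) z <-> simple_c_point g (RtoC 0%R) z.

(* Main.v *)
Require Import Defs.
From Stdlib Require Import Reals Lra Lia Classical ClassicalEpsilon.
From Coquelicot Require Import Coquelicot.
Open Scope R_scope.

(** Sharing simple zeros forces [f] and [f'] to have none, so zeros of [f] have multiplicity at least
    [3], and after dividing by [a] the [1]-points are either simple with [f' = 1] or of multiplicity at
    least [3].  If [f <> f'], the conformal density
    [|f'| |f' - f|^g / (|f|^(A+g) |f - 1|^B)], times powers of [1 + |f|^p] and [1 + |f - 1|^p],
    vanishes at every zero of [f], [f - 1], [f'] and [f' - f], and is log-subharmonic elsewhere, the
    Laplacian coming only from the two correcting factors.  For suitable exponents the
    logarithm [u] of a power of it satisfies [Lap u >= c * min (exp (2 u)) (exp (2 (1 + g) u))],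
    because [|f'/f - 1| <= 1 + |f'/f|]; by the argument of the Ahlfors-Schwarz lemma no such [u]
    exists on the whole plane.  This replaces the second main theorem and the lemma on the logarithmic
    derivative in a Nevanlinna-theoretic proof. *)

(** * Complex differentiability *)

(** Simple [1]-points shape the density. There [f'] does not vanish, so the pole of [|f - 1|^(-B)]
    can only be cancelled by [f' - f], which is zero because both values are [1]. The factor
    [|f' - f|^g] must then be balanced at the zeros of [f] and for large [|f|]. Counting orders
    leads to [B < g], [B < 2/3], [3 (1 - A) > 1 + g] and [A + B > 1]; such [A] and [B] exist exactly
    when [1/2 < g < 1]. With [2 (1 - A)] in place of [3 (1 - A)], as double zeros of [f] would
    require, there would be none. Products of powers of moduli of holomorphic functions are
    log-harmonic and give a flat metric. The logarithms of [1 + |f|^p] and [1 + |f - 1|^p] are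
    strictly convex functions of [ln |f|] and [ln |f - 1|], and [p] is small enough not to use up
    the margin [A + B - 1]. As [f' - f] is controlled by [f] where [|f'| <= |f|] and by [f']
    elsewhere, the density has degree [1] or [1 + g] in [|f' / f|]; hence the two exponentials in
    the curvature inequality. *)

Definition cderiv (f : C -> C) (z d : C) : Prop :=
  forall eps : R, 0 < eps -> exists delta : R, 0 < delta /\
    forall h : C, Cmod h < delta -> Cmod (f (z + h) - f z - d * h)%C <= eps * Cmod h.

Definition ccont_at (f : C -> C) (z : C) : Prop :=
  forall eps : R, 0 < eps -> exists delta : R, 0 < delta /\
    forall w : C, Cmod (w - z)%C < delta -> Cmod (f w - f z)%C < eps.

Definition ccont (f : C -> C) : Prop := forall z : C, ccont_at f z.

Lemma is_derive_cderiv (f : C -> C) (z d : C) :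
  @is_derive C_AbsRing C_NormedModule f z d -> cderiv f z d.
Proof.
  intros [_ H] eps he.
  specialize (H z (fun P HP => HP) (mkposreal eps he)).
  destruct H as [dl Hd].
  exists dl. split. apply cond_pos.
  intros h hh.
  assert (E : (z + h - z)%C = h) by ring.
  specialize (Hd (z + h)%C).
  simpl in Hd.
  change (Cmod (z + h - z)%C < dl -> Cmod ((f (z + h) - f z) - (z + h - z) * d)%C <= eps * Cmod (z + h - z)%C) in Hd.
  rewrite E in Hd. specialize (Hd hh).
  replace (f (z + h) - f z - d * h)%C with ((f (z + h) - f z) - h * d)%C by ring.
  exact Hd.
Qed.

Lemma cderiv_is_derive (f : C -> C) (z d : C) :
  cderiv f z d -> @is_derive C_AbsRing C_NormedModule f z d.
Proof.
  intros H. split.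
  - apply is_linear_scal_l.
  - intros x Hx eps.
    rewrite <- (is_filter_lim_locally_unique _ _ Hx). clear x Hx.
    destruct (H eps (cond_pos eps)) as [dl [hdl Hd]].
    exists (mkposreal dl hdl). intros y' hy. set (y := (y' : C)). change (y' : C) with y in hy |- *.
    change (Cmod (y - z)%C < dl) in hy. clearbody y. clear y'.
    specialize (Hd (y - z)%C hy).
    replace (z + (y - z))%C with y in Hd by ring.
    change (Cmod ((f y - f z) - (y - z) * d)%C <= eps * Cmod (y - z)%C).
    replace ((f y - f z) - (y - z) * d)%C with (f y - f z - d * (y - z))%C by ring.
    exact Hd.
Qed.

Lemma C_derive_cderiv (f : C -> C) (z d : C) : cderiv f z d -> C_derive f z = d.
Proof. intros H. apply is_C_derive_unique, cderiv_is_derive, H. Qed.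

Lemma cderiv_unique (f : C -> C) (z d e : C) : cderiv f z d -> cderiv f z e -> d = e.
Proof.
  intros H1 H2. rewrite <- (C_derive_cderiv _ _ _ H1). now apply C_derive_cderiv.
Qed.

Lemma entire_cderiv (f : C -> C) (z : C) : entire f -> cderiv f z (C_derive f z).
Proof.
  intros H. destruct (H z) as [d Hd].
  rewrite (is_C_derive_unique _ _ _ Hd). now apply is_derive_cderiv.
Qed.

Lemma Cmod_minus_sym (a b : C) : Cmod (a - b)%C = Cmod (b - a)%C.
Proof. replace (a - b)%C with (- (b - a))%C by ring. apply Cmod_opp. Qed.

Lemma Cmod_sub_le (a b : C) : Cmod (a - b)%C <= Cmod a + Cmod b.
Proof.
  unfold Cminus. eapply Rle_trans. apply Cmod_triangle. rewrite Cmod_opp. lra.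
Qed.

Lemma Cmod_sub_ge (a b : C) : Cmod a - Cmod b <= Cmod (a - b)%C.
Proof.
  assert (H := Cmod_triangle (a - b) b).
  replace (a - b + b)%C with a in H by ring. lra.
Qed.

Lemma cderiv_ccont_at (f : C -> C) (z d : C) : cderiv f z d -> ccont_at f z.
Proof.
  intros H eps he. destruct (H 1 Rlt_0_1) as [dl [hdl Hd]].
  assert (Hc := Cmod_ge_0 d).
  assert (h2 : 0 < eps / (1 + Cmod d)) by (apply Rdiv_lt_0_compat; lra).
  exists (Rmin dl (eps / (1 + Cmod d))). split. now apply Rmin_pos.
  intros w hw.
  assert (h3 : Cmod (w - z)%C < dl) by (eapply Rlt_le_trans; [exact hw | apply Rmin_l]).
  assert (h4 : Cmod (w - z)%C < eps / (1 + Cmod d)) by (eapply Rlt_le_trans; [exact hw | apply Rmin_r]).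
  specialize (Hd _ h3). replace (z + (w - z))%C with w in Hd by ring.
  replace (f w - f z)%C with ((f w - f z - d * (w - z)) + d * (w - z))%C by ring.
  eapply Rle_lt_trans. apply Cmod_triangle. rewrite Cmod_mult.
  apply (Rmult_lt_compat_r (1 + Cmod d)) in h4; [|lra].
  unfold Rdiv in h4. rewrite Rmult_assoc, Rinv_l in h4 by lra. nra.
Qed.

Lemma cderiv_ext_loc (f g : C -> C) (z d : C) (r : R) :
  0 < r -> (forall w, Cmod (w - z)%C < r -> f w = g w) -> cderiv f z d -> cderiv g z d.
Proof.
  intros hr E H eps he. destruct (H eps he) as [dl [hdl Hd]].
  exists (Rmin dl r). split. now apply Rmin_pos.
  intros h hh.
  assert (h1 := Rlt_le_trans _ _ _ hh (Rmin_l _ _)).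
  assert (h2 := Rlt_le_trans _ _ _ hh (Rmin_r _ _)).
  rewrite <- !E. now apply Hd.
  replace (z - z)%C with (RtoC 0) by ring. now rewrite Cmod_0.
  now replace (z + h - z)%C with h by ring.
Qed.

Lemma cderiv_plus (f g : C -> C) (z d e : C) :
  cderiv f z d -> cderiv g z e -> cderiv (fun w => f w + g w)%C z (d + e)%C.
Proof.
  intros H1 H2 eps he.
  destruct (H1 (eps / 2) ltac:(lra)) as [d1 [p1 h1]].
  destruct (H2 (eps / 2) ltac:(lra)) as [d2 [p2 h2]].
  exists (Rmin d1 d2). split. now apply Rmin_pos.
  intros h hh.
  specialize (h1 h (Rlt_le_trans _ _ _ hh (Rmin_l _ _))).
  specialize (h2 h (Rlt_le_trans _ _ _ hh (Rmin_r _ _))).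
  replace (f (z + h) + g (z + h) - (f z + g z) - (d + e) * h)%C
    with ((f (z + h) - f z - d * h) + (g (z + h) - g z - e * h))%C by ring.
  eapply Rle_trans. apply Cmod_triangle. lra.
Qed.

Lemma cderiv_const (c z : C) : cderiv (fun _ => c) z (RtoC 0).
Proof.
  intros eps he. exists 1. split. lra. intros h _.
  replace (c - c - 0 * h)%C with (RtoC 0) by ring. rewrite Cmod_0.
  assert (H := Cmod_ge_0 h). nra.
Qed.

Lemma cderiv_scal (c : C) (f : C -> C) (z d : C) :
  cderiv f z d -> cderiv (fun w => c * f w)%C z (c * d)%C.
Proof.
  intros H eps he. assert (Hc := Cmod_ge_0 c).
  destruct (H (eps / (1 + Cmod c))) as [dl [p1 h1]].
  apply Rdiv_lt_0_compat; lra.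
  exists dl. split; [easy|]. intros h hh. specialize (h1 h hh).
  replace (c * f (z + h) - c * f z - c * d * h)%C
    with (c * (f (z + h) - f z - d * h))%C by ring.
  rewrite Cmod_mult.
  assert (Hh := Cmod_ge_0 h).
  apply Rle_trans with (Cmod c * (eps / (1 + Cmod c) * Cmod h)).
  now apply Rmult_le_compat_l.
  replace (Cmod c * (eps / (1 + Cmod c) * Cmod h))
    with ((Cmod c / (1 + Cmod c)) * (eps * Cmod h)) by (field; lra).
  rewrite <- (Rmult_1_l (eps * Cmod h)) at 2.
  apply Rmult_le_compat_r. nra.
  apply Rle_div_l; lra.
Qed.

Lemma cderiv_minus (f g : C -> C) (z d e : C) :
  cderiv f z d -> cderiv g z e -> cderiv (fun w => f w - g w)%C z (d - e)%C.
Proof.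
  intros H1 H2. assert (H3 := cderiv_plus _ _ _ _ _ H1 (cderiv_scal (- RtoC 1)%C _ _ _ H2)).
  replace (d - e)%C with (d + (- RtoC 1) * e)%C by ring.
  refine (cderiv_ext_loc _ _ _ _ 1 Rlt_0_1 _ H3).
  intros w _. ring.
Qed.

Lemma cderiv_shift (f : C -> C) (p z d : C) :
  cderiv f (p + z)%C d -> cderiv (fun w => f (p + w)%C) z d.
Proof.
  intros H eps he. destruct (H eps he) as [dl [p1 h1]].
  exists dl. split; [easy|]. intros h hh.
  rewrite Cplus_assoc. now apply h1.
Qed.

Lemma cderiv_id (z : C) : cderiv (fun w => w) z 1.
Proof.
  intros eps he. exists 1. split. lra. intros h _.
  replace (z + h - z - 1 * h)%C with (RtoC 0) by ring. rewrite Cmod_0.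
  assert (H := Cmod_ge_0 h). nra.
Qed.

Lemma ccont_at_const (c z : C) : ccont_at (fun _ => c) z.
Proof. apply (cderiv_ccont_at _ _ 0), cderiv_const. Qed.

Lemma ccont_at_minus (f g : C -> C) (z : C) :
  ccont_at f z -> ccont_at g z -> ccont_at (fun w => f w - g w)%C z.
Proof.
  intros Hf Hg eps he.
  destruct (Hf (eps / 2) ltac:(lra)) as [d1 [p1 h1]].
  destruct (Hg (eps / 2) ltac:(lra)) as [d2 [p2 h2]].
  exists (Rmin d1 d2). split. now apply Rmin_pos.
  intros w hw.
  specialize (h1 w (Rlt_le_trans _ _ _ hw (Rmin_l _ _))).
  specialize (h2 w (Rlt_le_trans _ _ _ hw (Rmin_r _ _))).
  replace (f w - g w - (f z - g z))%C with ((f w - f z) - (g w - g z))%C by ring.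
  eapply Rle_lt_trans. apply Cmod_sub_le. lra.
Qed.

Lemma ccont_minus (f g : C -> C) : ccont f -> ccont g -> ccont (fun z => f z - g z)%C.
Proof. intros Hf Hg z. now apply ccont_at_minus. Qed.

Lemma ccont_at_mult (f g : C -> C) (z : C) :
  ccont_at f z -> ccont_at g z -> ccont_at (fun w => f w * g w)%C z.
Proof.
  intros Hf Hg eps he.
  set (K := 1 + Cmod (f z) + Cmod (g z)).
  assert (k1 := Cmod_ge_0 (f z)). assert (k2 := Cmod_ge_0 (g z)).
  assert (hK : 1 <= K) by (unfold K; lra).
  assert (he' : 0 < Rmin 1 (eps / (2 * K))) by (apply Rmin_pos; [lra | apply Rdiv_lt_0_compat; lra]).
  destruct (Hf _ he') as [d1 [p1 h1]]. destruct (Hg _ he') as [d2 [p2 h2]].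
  exists (Rmin d1 d2). split. now apply Rmin_pos.
  intros w hw.
  specialize (h1 w (Rlt_le_trans _ _ _ hw (Rmin_l _ _))).
  specialize (h2 w (Rlt_le_trans _ _ _ hw (Rmin_r _ _))).
  assert (a1 := Rlt_le_trans _ _ _ h1 (Rmin_l _ _)).
  assert (a2 := Rlt_le_trans _ _ _ h1 (Rmin_r _ _)).
  assert (a3 := Rlt_le_trans _ _ _ h2 (Rmin_r _ _)).
  replace (f w * g w - f z * g z)%C
    with ((f w - f z) * (g w - g z) + ((f w - f z) * g z + f z * (g w - g z)))%C by ring.
  eapply Rle_lt_trans. apply Cmod_triangle.
  eapply Rle_lt_trans. apply Rplus_le_compat_l, Cmod_triangle.
  rewrite !Cmod_mult.
  set (x := Cmod (f w - f z)%C) in *. set (y := Cmod (g w - g z)%C) in *.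
  assert (hx : 0 <= x) by apply Cmod_ge_0. assert (hy : 0 <= y) by apply Cmod_ge_0.
  set (t := eps / (2 * K)) in *.
  assert (ht : t * (2 * K) = eps) by (unfold t; field; lra).
  unfold K in ht. nra.
Qed.

(** Compactness of the unit square through nested squares; [P s t r] speaks of the square with lower
    left corner [(s, t)] and side [r]. It serves both Goursat's theorem and the existence of maxima
    of upper semicontinuous functions. *)
Lemma quadrisection (P : R -> R -> R -> Prop) :
  (forall s t r, 0 < r -> P s t r ->
     P s t (r / 2) \/ P (s + r / 2) t (r / 2) \/
     P s (t + r / 2) (r / 2) \/ P (s + r / 2) (t + r / 2) (r / 2)) ->
  P 0 0 1 ->
  exists s t, 0 <= s <= 1 /\ 0 <= t <= 1 /\
    forall eps, 0 < eps -> exists s' t' r, 0 < r < eps /\ P s' t' r /\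
      s' <= s <= s' + r /\ t' <= t <= t' + r.
Proof.
  intros Hstep H0.
  set (Q := fun c : R * R * R => 0 < snd c /\ P (fst (fst c)) (snd (fst c)) (snd c)).
  assert (Hn : forall c : {c | Q c}, exists c' : {c | Q c},
    snd (proj1_sig c') = snd (proj1_sig c) / 2 /\
    fst (fst (proj1_sig c)) <= fst (fst (proj1_sig c')) /\
    fst (fst (proj1_sig c')) + snd (proj1_sig c') <= fst (fst (proj1_sig c)) + snd (proj1_sig c) /\
    snd (fst (proj1_sig c)) <= snd (fst (proj1_sig c')) /\
    snd (fst (proj1_sig c')) + snd (proj1_sig c') <= snd (fst (proj1_sig c)) + snd (proj1_sig c)).
  { intros [[[s t] r] [hr hP]]; simpl in *.
    assert (hr2 : 0 < r / 2) by lra.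
    destruct (Hstep s t r hr hP) as [h|[h|[h|h]]].
    - exists (exist Q (s, t, r / 2) (conj hr2 h)); simpl; lra.
    - exists (exist Q (s + r / 2, t, r / 2) (conj hr2 h)); simpl; lra.
    - exists (exist Q (s, t + r / 2, r / 2) (conj hr2 h)); simpl; lra.
    - exists (exist Q (s + r / 2, t + r / 2, r / 2) (conj hr2 h)); simpl; lra. }
  set (nxt := fun c => proj1_sig (constructive_indefinite_description _ (Hn c))).
  set (c0 := exist Q (0, 0, 1) (conj Rlt_0_1 H0)).
  set (c := fun n => Nat.iter n nxt c0).
  set (s := fun n => fst (fst (proj1_sig (c n)))).
  set (t := fun n => snd (fst (proj1_sig (c n)))).
  set (r := fun n => snd (proj1_sig (c n))).
  assert (Hc : forall n, r (S n) = r n / 2 /\ s n <= s (S n) /\ s (S n) + r (S n) <= s n + r n /\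
     t n <= t (S n) /\ t (S n) + r (S n) <= t n + r n).
  { intros n. exact (proj2_sig (constructive_indefinite_description _ (Hn (c n)))). }
  assert (HQ : forall n, 0 < r n /\ P (s n) (t n) (r n)) by (intros n; exact (proj2_sig (c n))).
  assert (Hr : forall n, r n = (/ 2) ^ n).
  { induction n. reflexivity. rewrite (proj1 (Hc n)), IHn. simpl. lra. }
  (* Each coordinate of the corners increases inside nested intervals of length [2^-n], so its
     supremum lies in all of them. *)
  assert (Hlim : forall u : nat -> R, u 0%nat = 0 ->
    (forall n, u n <= u (S n) /\ u (S n) + r (S n) <= u n + r n) ->
    exists l, 0 <= l <= 1 /\ forall n, u n <= l <= u n + r n).
  { intros u hu0 hu.
    assert (hk : forall n k, u n <= u (k + n)%nat /\ u (k + n)%nat + r (k + n)%nat <= u n + r n).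
    { intros n k; induction k. simpl; lra. simpl. destruct (hu (k + n)%nat). lra. }
    assert (hmn : forall m n, u m <= u n + r n).
    { intros m n. destruct (hk m n) as [h1 _]. destruct (hk n m) as [_ h2].
      rewrite Nat.add_comm in h1. assert (h3 := proj1 (HQ (m + n)%nat)). lra. }
    destruct (completeness (fun x => exists n, x = u n)) as [l [hl1 hl2]].
    - exists (u 0%nat + r 0%nat). intros x [n ->]. apply hmn.
    - exists (u 0%nat). now exists 0%nat.
    - exists l.
      assert (h : forall n, u n <= l <= u n + r n).
      { intros n. split. apply hl1. now exists n. apply hl2. intros x [m ->]. apply hmn. }
      split; [|exact h]. specialize (h 0%nat). rewrite hu0, Hr in h. simpl in h. lra. }
  destruct (Hlim s eq_refl) as [sl [hs1 hs2]].
  { intros n; destruct (Hc n); intuition. }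
  destruct (Hlim t eq_refl) as [tl [ht1 ht2]].
  { intros n; destruct (Hc n); intuition. }
  exists sl, tl. split; [easy|]. split; [easy|].
  intros eps he.
  destruct (pow_lt_1_zero (/ 2)) with (y := eps) as [N HN].
  rewrite Rabs_right; lra. easy.
  exists (s N), (t N), (r N). destruct (HQ N) as [h1 h2].
  specialize (HN N (le_n N)). rewrite <- Hr, Rabs_right in HN by lra.
  repeat split; try apply hs2; try apply ht2; easy.
Qed.

(** * Integrals along real parameters *)

(** Continuity is asked on the whole real line, so that every integral below exists whatever its
    bounds. *)
Definition pcont (g : R -> C) : Prop :=
  forall t, continuous (fun s => fst (g s)) t /\ continuous (fun s => snd (g s)) t.

Definition cint (g : R -> C) (a b : R) : C :=
  (RInt (fun s => fst (g s)) a b, RInt (fun s => snd (g s)) a b).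

Definition rderiv (g : R -> C) (t : R) (v : C) : Prop :=
  forall eps : R, 0 < eps -> exists delta : R, 0 < delta /\
    forall s : R, Rabs s < delta -> Cmod (g (t + s)%R - g t - s * v)%C <= eps * Rabs s.

Lemma Rabs_fst_le (z : C) : Rabs (fst z) <= Cmod z.
Proof. eapply Rle_trans; [apply Rmax_l | apply Rmax_Cmod]. Qed.

Lemma Rabs_snd_le (z : C) : Rabs (snd z) <= Cmod z.
Proof. eapply Rle_trans; [apply Rmax_r | apply Rmax_Cmod]. Qed.

Lemma Cmod_le_abs (x y : R) : Cmod (x, y) <= Rabs x + Rabs y.
Proof.
  replace ((x, y) : C) with (RtoC x + Ci * RtoC y)%C
    by (apply injective_projections; simpl; ring).
  eapply Rle_trans. apply Cmod_triangle.
  rewrite Cmod_mult, Cmod_Ci, !Cmod_R. lra.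
Qed.

Lemma pcont_ex_fst (g : R -> C) (a b : R) : pcont g -> ex_RInt (fun s => fst (g s)) a b.
Proof. intros H. apply (@ex_RInt_continuous R_CompleteNormedModule). intros z _. apply H. Qed.

Lemma pcont_ex_snd (g : R -> C) (a b : R) : pcont g -> ex_RInt (fun s => snd (g s)) a b.
Proof. intros H. apply (@ex_RInt_continuous R_CompleteNormedModule). intros z _. apply H. Qed.

Lemma pcont_plus (f g : R -> C) : pcont f -> pcont g -> pcont (fun t => f t + g t)%C.
Proof.
  intros Hf Hg t. split; simpl;
  apply (@continuous_plus R_UniformSpace R_AbsRing R_NormedModule); (apply Hf || apply Hg).
Qed.

Lemma pcont_opp (f : R -> C) : pcont f -> pcont (fun t => - f t)%C.
Proof.
  intros Hf t. split; simpl;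
  apply (@continuous_opp R_UniformSpace R_AbsRing R_NormedModule); apply Hf.
Qed.

Lemma pcont_minus (f g : R -> C) : pcont f -> pcont g -> pcont (fun t => f t - g t)%C.
Proof. intros Hf Hg. apply pcont_plus; [easy | now apply pcont_opp]. Qed.

Lemma pcont_mult (f g : R -> C) : pcont f -> pcont g -> pcont (fun t => f t * g t)%C.
Proof.
  intros Hf Hg t. destruct (Hf t), (Hg t). split; simpl.
  - apply (@continuous_minus R_UniformSpace R_AbsRing R_NormedModule);
    apply (@continuous_mult R_UniformSpace R_AbsRing); easy.
  - apply (@continuous_plus R_UniformSpace R_AbsRing R_NormedModule);
    apply (@continuous_mult R_UniformSpace R_AbsRing); easy.
Qed.

Lemma pcont_const (c : C) : pcont (fun _ => c).
Proof. intros t. split; apply continuous_const. Qed.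

Lemma pcont_eps (g : R -> C) :
  (forall t eps, 0 < eps -> exists delta, 0 < delta /\
    forall s, Rabs (s - t) < delta -> Cmod (g s - g t)%C < eps) -> pcont g.
Proof.
  intros H t. split; apply continuity_pt_filterlim; intros eps he;
  destruct (H t eps he) as [d [hd h]]; exists d; (split; [exact hd|]);
  intros s [_ hs]; specialize (h s hs).
  - eapply Rle_lt_trans; [|exact h]. apply (Rabs_fst_le (g s - g t)%C).
  - eapply Rle_lt_trans; [|exact h]. apply (Rabs_snd_le (g s - g t)%C).
Qed.

Lemma pcont_comp (f : C -> C) (g : R -> C) :
  (forall t, ccont_at f (g t)) -> pcont g -> pcont (fun t => f (g t)).
Proof.
  intros Hf Hg. apply pcont_eps. intros t eps he.
  destruct (Hf t eps he) as [d [hd h]].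
  destruct (Hg t) as [h1 h2].
  apply continuity_pt_filterlim in h1. apply continuity_pt_filterlim in h2.
  destruct (h1 (d / 2) ltac:(lra)) as [d1 [p1 q1]].
  destruct (h2 (d / 2) ltac:(lra)) as [d2 [p2 q2]].
  exists (Rmin d1 d2). split. now apply Rmin_pos.
  intros s hs.
  destruct (Req_dec t s) as [<-|hne].
  { replace (f (g t) - f (g t))%C with (RtoC 0) by ring. now rewrite Cmod_0. }
  apply h.
  assert (k1 := q1 s (conj (conj I hne) (Rlt_le_trans _ _ _ hs (Rmin_l _ _)))).
  assert (k2 := q2 s (conj (conj I hne) (Rlt_le_trans _ _ _ hs (Rmin_r _ _)))).
  simpl in k1, k2. unfold Rdist in k1, k2.
  assert (k3 := Cmod_le_abs (fst (g s - g t)%C) (snd (g s - g t)%C)).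
  rewrite <- surjective_pairing in k3. simpl in k3. unfold Rminus in k1, k2. lra.
Qed.

Lemma cint_Chasles (g : R -> C) (a b c : R) :
  pcont g -> (cint g a b + cint g b c)%C = cint g a c.
Proof.
  intros H. apply injective_projections; simpl.
  - apply (@RInt_Chasles R_CompleteNormedModule); now apply pcont_ex_fst.
  - apply (@RInt_Chasles R_CompleteNormedModule); now apply pcont_ex_snd.
Qed.

Lemma cint_point (g : R -> C) (a : R) : cint g a a = RtoC 0.
Proof. apply injective_projections; simpl; apply (@RInt_point R_CompleteNormedModule). Qed.

Lemma cint_ext (f g : R -> C) (a b : R) : (forall t, f t = g t) -> cint f a b = cint g a b.
Proof.
  intros E. apply injective_projections; simpl;
  apply (@RInt_ext R_CompleteNormedModule); intros t _; now rewrite E.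
Qed.

Lemma cint_plus (f g : R -> C) (a b : R) : pcont f -> pcont g ->
  cint (fun t => f t + g t)%C a b = (cint f a b + cint g a b)%C.
Proof.
  intros Hf Hg. apply injective_projections; simpl.
  - apply (@RInt_plus R_CompleteNormedModule); now apply pcont_ex_fst.
  - apply (@RInt_plus R_CompleteNormedModule); now apply pcont_ex_snd.
Qed.

Lemma cint_scal (c : C) (f : R -> C) (a b : R) : pcont f ->
  cint (fun t => c * f t)%C a b = (c * cint f a b)%C.
Proof.
  intros Hf.
  assert (h1 := pcont_ex_fst f a b Hf). assert (h2 := pcont_ex_snd f a b Hf).
  assert (S1 : forall k, ex_RInt (fun s => k * fst (f s)) a b)
    by (intros k; now apply (@ex_RInt_scal R_NormedModule)).
  assert (S2 : forall k, ex_RInt (fun s => k * snd (f s)) a b)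
    by (intros k; now apply (@ex_RInt_scal R_NormedModule)).
  assert (E1 : forall k, RInt (fun s => k * fst (f s)) a b = k * RInt (fun s => fst (f s)) a b)
    by (intros k; now apply (@RInt_scal R_CompleteNormedModule)).
  assert (E2 : forall k, RInt (fun s => k * snd (f s)) a b = k * RInt (fun s => snd (f s)) a b)
    by (intros k; now apply (@RInt_scal R_CompleteNormedModule)).
  apply injective_projections; simpl.
  - rewrite <- E1, <- E2. now apply (@RInt_minus R_CompleteNormedModule).
  - rewrite <- E1, <- E2. now apply (@RInt_plus R_CompleteNormedModule).
Qed.

Lemma cint_minus (f g : R -> C) (a b : R) : pcont f -> pcont g ->
  cint (fun t => f t - g t)%C a b = (cint f a b - cint g a b)%C.
Proof.
  intros Hf Hg.
  rewrite (cint_ext _ (fun t => f t + (- RtoC 1) * g t)%C) by (intros t; ring).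
  rewrite cint_plus; [|easy|apply pcont_mult; [apply pcont_const | easy]].
  rewrite cint_scal by easy. ring.
Qed.

Lemma cint_const (c : C) (a b : R) : cint (fun _ => c) a b = (RtoC (b - a) * c)%C.
Proof.
  apply injective_projections; simpl; rewrite (@RInt_const R_CompleteNormedModule);
  unfold scal; simpl; unfold mult; simpl; ring.
Qed.

(** The factor [2] comes from estimating real and imaginary parts separately; the arguments that use
    the bound tolerate any constant. *)
Lemma cint_bound (g : R -> C) (a b M : R) : pcont g ->
  (forall t, Rmin a b <= t <= Rmax a b -> Cmod (g t) <= M) ->
  Cmod (cint g a b) <= 2 * M * Rabs (b - a).
Proof.
  intros Hg H.
  assert (h1 : Rabs (RInt (fun s => fst (g s)) a b) <= Rabs (b - a) * M).
  { apply (@norm_RInt_le_const_abs R_NormedModule (fun s => fst (g s))).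
    - intros t ht. eapply Rle_trans; [apply Rabs_fst_le | now apply H].
    - apply (@RInt_correct R_CompleteNormedModule). now apply pcont_ex_fst. }
  assert (h2 : Rabs (RInt (fun s => snd (g s)) a b) <= Rabs (b - a) * M).
  { apply (@norm_RInt_le_const_abs R_NormedModule (fun s => snd (g s))).
    - intros t ht. eapply Rle_trans; [apply Rabs_snd_le | now apply H].
    - apply (@RInt_correct R_CompleteNormedModule). now apply pcont_ex_snd. }
  eapply Rle_trans. apply Cmod_le_abs. lra.
Qed.

Lemma rderiv_fst (g : R -> C) (t : R) (v : C) :
  rderiv g t v -> is_derive (fun s => fst (g s)) t (fst v).
Proof.
  intros H. apply is_derive_Reals. intros eps he.
  destruct (H (eps / 2) ltac:(lra)) as [d [hd h]].
  exists (mkposreal d hd). intros s hs0 hs. specialize (h s hs).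
  assert (hp := Rabs_pos_lt s hs0).
  assert (k := Rabs_fst_le (g (t + s)%R - g t - s * v)%C). simpl in k.
  replace ((fst (g (t + s)) - fst (g t)) / s - fst v)
    with ((fst (g (t + s)%R) + - fst (g t) + - (s * fst v - 0 * snd v)) / s) by (field; easy).
  unfold Rdiv. rewrite Rabs_mult, Rabs_inv.
  apply Rle_lt_trans with (eps / 2); [|lra].
  apply Rle_div_l; lra.
Qed.

Lemma rderiv_snd (g : R -> C) (t : R) (v : C) :
  rderiv g t v -> is_derive (fun s => snd (g s)) t (snd v).
Proof.
  intros H. apply is_derive_Reals. intros eps he.
  destruct (H (eps / 2) ltac:(lra)) as [d [hd h]].
  exists (mkposreal d hd). intros s hs0 hs. specialize (h s hs).
  assert (hp := Rabs_pos_lt s hs0).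
  assert (k := Rabs_snd_le (g (t + s)%R - g t - s * v)%C). simpl in k.
  replace ((snd (g (t + s)) - snd (g t)) / s - snd v)
    with ((snd (g (t + s)%R) + - snd (g t) + - (s * snd v + 0 * fst v)) / s) by (field; easy).
  unfold Rdiv. rewrite Rabs_mult, Rabs_inv.
  apply Rle_lt_trans with (eps / 2); [|lra].
  apply Rle_div_l; lra.
Qed.

Lemma rderiv_of_components (g : R -> C) (t : R) (v : C) :
  is_derive (fun s => fst (g s)) t (fst v) -> is_derive (fun s => snd (g s)) t (snd v) ->
  rderiv g t v.
Proof.
  intros H1 H2. apply is_derive_Reals in H1. apply is_derive_Reals in H2. intros eps he.
  destruct (H1 (eps / 2) ltac:(lra)) as [d1 h1].
  destruct (H2 (eps / 2) ltac:(lra)) as [d2 h2].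
  exists (Rmin d1 d2). split. apply Rmin_pos; apply cond_pos.
  intros s hs. destruct (Req_dec s 0) as [->|hs0].
  { replace (t + 0) with t by ring.
    replace (g t - g t - 0 * v)%C with (RtoC 0) by ring.
    rewrite Cmod_0, Rabs_R0. lra. }
  specialize (h1 s hs0 (Rlt_le_trans _ _ _ hs (Rmin_l _ _))).
  specialize (h2 s hs0 (Rlt_le_trans _ _ _ hs (Rmin_r _ _))).
  assert (hp := Rabs_pos_lt s hs0).
  set (e1 := (fst (g (t + s)) - fst (g t)) / s - fst v) in h1.
  set (e2 := (snd (g (t + s)) - snd (g t)) / s - snd v) in h2.
  replace (g (t + s)%R - g t - s * v)%C with (RtoC s * (e1, e2))%C.
  - rewrite Cmod_mult, Cmod_R, Rmult_comm.
    apply Rmult_le_compat_r; [lra|]. eapply Rle_trans; [apply Cmod_le_abs|]. lra.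
  - unfold e1, e2. apply injective_projections; simpl; field; easy.
Qed.

Lemma rderiv_comp (F : C -> C) (g : R -> C) (t : R) (d v : C) :
  cderiv F (g t) d -> rderiv g t v -> rderiv (fun s => F (g s)) t (d * v)%C.
Proof.
  intros HF Hg eps he.
  assert (hd := Cmod_ge_0 d). assert (hv := Cmod_ge_0 v).
  assert (he1 : 0 < eps / (2 * (1 + Cmod v))) by (apply Rdiv_lt_0_compat; lra).
  destruct (HF _ he1) as [d1 [p1 h1]].
  assert (he2 : 0 < Rmin 1 (eps / (2 * (1 + Cmod d)))).
  { apply Rmin_pos. lra. apply Rdiv_lt_0_compat; lra. }
  destruct (Hg _ he2) as [d2 [p2 h2]].
  assert (he3 : 0 < d1 / (1 + Cmod v)) by (apply Rdiv_lt_0_compat; lra).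
  exists (Rmin d2 (d1 / (1 + Cmod v))). split. now apply Rmin_pos.
  intros s hs.
  assert (hs1 := Rlt_le_trans _ _ _ hs (Rmin_l _ _)).
  assert (hs2 := Rlt_le_trans _ _ _ hs (Rmin_r _ _)).
  specialize (h2 s hs1).
  set (k := (g (t + s)%R - g t)%C) in *.
  assert (ha := Rabs_pos s).
  assert (k1 : Cmod (k - s * v)%C <= Rabs s).
  { eapply Rle_trans. exact h2. rewrite <- (Rmult_1_l (Rabs s)) at 2.
    apply Rmult_le_compat_r. easy. apply Rmin_l. }
  assert (k2 : Cmod (k - s * v)%C <= eps / (2 * (1 + Cmod d)) * Rabs s).
  { eapply Rle_trans. exact h2. apply Rmult_le_compat_r. easy. apply Rmin_r. }
  assert (k3 : Cmod k <= (1 + Cmod v) * Rabs s).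
  { replace k with ((k - s * v) + s * v)%C by ring.
    eapply Rle_trans. apply Cmod_triangle. rewrite Cmod_mult, Cmod_R. lra. }
  apply (Rmult_lt_compat_r (1 + Cmod v)) in hs2; [|lra].
  unfold Rdiv in hs2. rewrite Rmult_assoc, Rinv_l, Rmult_1_r in hs2 by lra.
  specialize (h1 k ltac:(lra)).
  replace (g t + k)%C with (g (t + s)%R) in h1 by (unfold k; ring).
  replace (F (g (t + s)%R) - F (g t) - s * (d * v))%C
    with ((F (g (t + s)%R) - F (g t) - d * k) + d * (k - s * v))%C by ring.
  eapply Rle_trans. apply Cmod_triangle. rewrite Cmod_mult.
  apply Rle_trans with (eps / (2 * (1 + Cmod v)) * ((1 + Cmod v) * Rabs s)
    + (1 + Cmod d) * (eps / (2 * (1 + Cmod d)) * Rabs s)).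
  - apply Rplus_le_compat.
    + eapply Rle_trans. exact h1. apply Rmult_le_compat_l; lra.
    + apply Rmult_le_compat; try apply Cmod_ge_0; lra.
  - right. field. split; lra.
Qed.

Lemma cint_FTC (G g : R -> C) (a b : R) :
  (forall t, rderiv G t (g t)) -> pcont g -> cint g a b = (G b - G a)%C.
Proof.
  intros H Hg. apply injective_projections; simpl; apply (@is_RInt_unique R_CompleteNormedModule).
  - apply (@is_RInt_derive R_CompleteNormedModule (fun s => fst (G s)) (fun s => fst (g s))).
    intros t _. now apply rderiv_fst. intros t _. apply Hg.
  - apply (@is_RInt_derive R_CompleteNormedModule (fun s => snd (G s)) (fun s => snd (g s))).
    intros t _. now apply rderiv_snd. intros t _. apply Hg.
Qed.

(** * Goursat's theorem *)

Definition hint (f : C -> C) (y a b : R) : C := cint (fun t => f (t, y)) a b.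
Definition vint (f : C -> C) (x a b : R) : C := cint (fun t => f (x, t)) a b.

(** The integral of [f dz] along the boundary, counterclockwise if [x1 < x2] and [y1 < y2]. The
    integrals are signed, so exchanging two abscissas or two ordinates changes the sign. *)
Definition rect_int (f : C -> C) (x1 y1 x2 y2 : R) : C :=
  (hint f y1 x1 x2 + Ci * vint f x2 y1 y2 - hint f y2 x1 x2 - Ci * vint f x1 y1 y2)%C.

Lemma pcont_hline (y : R) : pcont (fun t => (t, y)).
Proof. intros t; split; simpl. apply continuous_id. apply continuous_const. Qed.

Lemma pcont_vline (x : R) : pcont (fun t => (x, t)).
Proof. intros t; split; simpl. apply continuous_const. apply continuous_id. Qed.

Lemma pcont_hcomp (f : C -> C) (y : R) : ccont f -> pcont (fun t => f (t, y)).
Proof. intros H. apply (pcont_comp f (fun t => (t, y))); [intros; apply H | apply pcont_hline]. Qed.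

Lemma pcont_vcomp (f : C -> C) (x : R) : ccont f -> pcont (fun t => f (x, t)).
Proof. intros H. apply (pcont_comp f (fun t => (x, t))); [intros; apply H | apply pcont_vline]. Qed.

Lemma hint_Chasles (f : C -> C) (y a b c : R) :
  ccont f -> hint f y a c = (hint f y a b + hint f y b c)%C.
Proof. intros H. symmetry. apply cint_Chasles. now apply pcont_hcomp. Qed.

Lemma vint_Chasles (f : C -> C) (x a b c : R) :
  ccont f -> vint f x a c = (vint f x a b + vint f x b c)%C.
Proof. intros H. symmetry. apply cint_Chasles. now apply pcont_vcomp. Qed.

Lemma rect_int_split_x (f : C -> C) (x1 y1 x2 y2 x : R) : ccont f ->
  rect_int f x1 y1 x2 y2 = (rect_int f x1 y1 x y2 + rect_int f x y1 x2 y2)%C.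
Proof.
  intros H. unfold rect_int.
  rewrite (hint_Chasles f y1 x1 x x2), (hint_Chasles f y2 x1 x x2) by easy. ring.
Qed.

Lemma rect_int_split_y (f : C -> C) (x1 y1 x2 y2 y : R) : ccont f ->
  rect_int f x1 y1 x2 y2 = (rect_int f x1 y1 x2 y + rect_int f x1 y x2 y2)%C.
Proof.
  intros H. unfold rect_int.
  rewrite (vint_Chasles f x1 y1 y y2), (vint_Chasles f x2 y1 y y2) by easy. ring.
Qed.

Lemma rect_int_degenerate_x (f : C -> C) (x y1 y2 : R) : rect_int f x y1 x y2 = RtoC 0.
Proof. unfold rect_int, hint. rewrite !cint_point. ring. Qed.

Lemma rect_int_degenerate_y (f : C -> C) (x1 x2 y : R) : rect_int f x1 y x2 y = RtoC 0.
Proof. unfold rect_int, vint. rewrite !cint_point. ring. Qed.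

Lemma rect_int_swap_x (f : C -> C) (x1 y1 x2 y2 : R) : ccont f ->
  rect_int f x2 y1 x1 y2 = (- rect_int f x1 y1 x2 y2)%C.
Proof.
  intros H. assert (E := rect_int_split_x f x1 y1 x1 y2 x2 H).
  rewrite rect_int_degenerate_x in E.
  replace (rect_int f x2 y1 x1 y2) with
    ((rect_int f x1 y1 x2 y2 + rect_int f x2 y1 x1 y2) - rect_int f x1 y1 x2 y2)%C by ring.
  rewrite <- E. ring.
Qed.

Lemma rect_int_swap_y (f : C -> C) (x1 y1 x2 y2 : R) : ccont f ->
  rect_int f x1 y2 x2 y1 = (- rect_int f x1 y1 x2 y2)%C.
Proof.
  intros H. assert (E := rect_int_split_y f x1 y1 x2 y1 y2 H).
  rewrite rect_int_degenerate_y in E.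
  replace (rect_int f x1 y2 x2 y1) with
    ((rect_int f x1 y1 x2 y2 + rect_int f x1 y2 x2 y1) - rect_int f x1 y1 x2 y2)%C by ring.
  rewrite <- E. ring.
Qed.

Lemma rect_int_minus (f g : C -> C) (x1 y1 x2 y2 : R) : ccont f -> ccont g ->
  rect_int (fun z => f z - g z)%C x1 y1 x2 y2 =
  (rect_int f x1 y1 x2 y2 - rect_int g x1 y1 x2 y2)%C.
Proof.
  intros Hf Hg. unfold rect_int, hint, vint.
  rewrite !cint_minus by (apply pcont_hcomp || apply pcont_vcomp; easy). ring.
Qed.

Lemma rect_int_bound (f : C -> C) (x1 y1 x2 y2 M : R) : ccont f ->
  (forall x y, Rmin x1 x2 <= x <= Rmax x1 x2 -> Rmin y1 y2 <= y <= Rmax y1 y2 ->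
     Cmod (f (x, y)) <= M) ->
  Cmod (rect_int f x1 y1 x2 y2) <= 4 * M * (Rabs (x2 - x1) + Rabs (y2 - y1)).
Proof.
  intros Hf HM.
  assert (ex1 : Rmin x1 x2 <= x1 <= Rmax x1 x2) by (split; [apply Rmin_l | apply Rmax_l]).
  assert (ex2 : Rmin x1 x2 <= x2 <= Rmax x1 x2) by (split; [apply Rmin_r | apply Rmax_r]).
  assert (ey1 : Rmin y1 y2 <= y1 <= Rmax y1 y2) by (split; [apply Rmin_l | apply Rmax_l]).
  assert (ey2 : Rmin y1 y2 <= y2 <= Rmax y1 y2) by (split; [apply Rmin_r | apply Rmax_r]).
  assert (b1 : forall y, Rmin y1 y2 <= y <= Rmax y1 y2 ->
    Cmod (hint f y x1 x2) <= 2 * M * Rabs (x2 - x1)).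
  { intros y hy. apply cint_bound. now apply pcont_hcomp. intros t ht. now apply HM. }
  assert (b2 : forall x, Rmin x1 x2 <= x <= Rmax x1 x2 ->
    Cmod (Ci * vint f x y1 y2)%C <= 2 * M * Rabs (y2 - y1)).
  { intros x hx. rewrite Cmod_mult, Cmod_Ci, Rmult_1_l.
    apply cint_bound. now apply pcont_vcomp. intros t ht. now apply HM. }
  unfold rect_int.
  eapply Rle_trans. apply Cmod_sub_le.
  eapply Rle_trans. apply Rplus_le_compat_r, Cmod_sub_le.
  eapply Rle_trans. apply Rplus_le_compat_r, Rplus_le_compat_r, Cmod_triangle.
  assert (k1 := b1 y1 ey1). assert (k2 := b1 y2 ey2).
  assert (k3 := b2 x1 ex1). assert (k4 := b2 x2 ex2). lra.
Qed.

Lemma rderiv_hline (y t : R) : rderiv (fun s => (s, y)) t (RtoC 1).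
Proof.
  apply rderiv_of_components; simpl.
  apply (@is_derive_id R_AbsRing). apply (@is_derive_const R_AbsRing R_NormedModule).
Qed.

Lemma rderiv_vline (x t : R) : rderiv (fun s => (x, s)) t Ci.
Proof.
  apply rderiv_of_components; simpl.
  apply (@is_derive_const R_AbsRing R_NormedModule). apply (@is_derive_id R_AbsRing).
Qed.

Lemma rect_int_primitive (F f : C -> C) (x1 y1 x2 y2 : R) :
  ccont f -> (forall z, cderiv F z (f z)) -> rect_int f x1 y1 x2 y2 = RtoC 0.
Proof.
  intros Hf HF.
  assert (Eh : forall y a b, hint f y a b = (F (b, y) - F (a, y))%C).
  { intros y a b. apply (cint_FTC (fun t => F (t, y))); [|now apply pcont_hcomp].
    intros t. rewrite <- (Cmult_1_r (f _)).
    apply (rderiv_comp F (fun t => (t, y))). apply HF. apply rderiv_hline. }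
  assert (Ev : forall x a b, (Ci * vint f x a b)%C = (F (x, b) - F (x, a))%C).
  { intros x a b. unfold vint. rewrite <- cint_scal by now apply pcont_vcomp.
    apply (cint_FTC (fun t => F (x, t))).
    - intros t. rewrite Cmult_comm. apply (rderiv_comp F (fun t => (x, t))).
      apply HF. apply rderiv_vline.
    - apply pcont_mult. apply pcont_const. now apply pcont_vcomp. }
  unfold rect_int. rewrite !Eh, !Ev. ring.
Qed.

Lemma cderiv_quadratic (c d p z : C) :
  cderiv (fun w => c * w + / 2 * d * ((w - p) * (w - p)))%C z (c + d * (z - p))%C.
Proof.
  intros eps he. assert (hd := Cmod_ge_0 d).
  exists (eps / (1 + Cmod d)). split. apply Rdiv_lt_0_compat; lra.
  intros h hh.
  replace (c * (z + h) + / 2 * d * ((z + h - p) * (z + h - p)) -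
     (c * z + / 2 * d * ((z - p) * (z - p))) - (c + d * (z - p)) * h)%C
    with ((/ 2 * d * h) * h)%C by (field; intros E; apply RtoC_inj in E; lra).
  rewrite Cmod_mult. apply Rmult_le_compat_r. apply Cmod_ge_0.
  rewrite !Cmod_mult, Cmod_inv, Cmod_R, Rabs_right by (try lra; intros E; apply RtoC_inj in E; lra).
  apply (Rmult_lt_compat_r (1 + Cmod d)) in hh; [|lra].
  unfold Rdiv in hh. rewrite Rmult_assoc, Rinv_l, Rmult_1_r in hh by lra.
  assert (hp := Cmod_ge_0 h). nra.
Qed.

Lemma ccont_affine (c d p : C) : ccont (fun z => c + d * (z - p))%C.
Proof.
  intros z. apply (cderiv_ccont_at _ _ (0 + d * (1 - 0))%C).
  apply (cderiv_plus (fun _ => c)). apply cderiv_const.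
  apply (cderiv_scal d (fun z => z - p)%C).
  apply (cderiv_minus (fun z => z) (fun _ => p)). apply cderiv_id. apply cderiv_const.
Qed.

(** Bounds the distance, in one coordinate, from a point of a small rectangle to the limit point of
    the subdivision, for either sign of the side [b]. *)
Lemma between_affine (a b s t x : R) : 0 <= t ->
  Rmin (a + s * b) (a + (s + t) * b) <= x <= Rmax (a + s * b) (a + (s + t) * b) ->
  forall u, s <= u <= s + t -> Rabs (x - (a + u * b)) <= t * Rabs b.
Proof.
  intros ht hx u hu.
  assert (H : - (t * Rabs b) <= x - (a + u * b) <= t * Rabs b).
  { revert hx. unfold Rmin, Rmax, Rabs.
    destruct (Rle_dec _ _); destruct (Rcase_abs b); intros hx; nra. }
  now apply Rabs_le.
Qed.

(** If the integral has modulus [E > 0], quartering yields rectangles of scale [r] with integral at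
    least [E r^2]. Near their limit point [f] is affine up to [o(r)], affine functions have
    primitives, and the error integrates to [o(r^2)]. Differentiability is assumed on the rectangle
    alone, so the lemma applies next to a point where [f] is merely continuous. *)
Lemma goursat (f : C -> C) (x1 y1 w h : R) : ccont f ->
  (forall s t, 0 <= s <= 1 -> 0 <= t <= 1 -> exists d, cderiv f (x1 + s * w, y1 + t * h) d) ->
  rect_int f x1 y1 (x1 + w) (y1 + h) = RtoC 0.
Proof.
  intros Hf Hd. apply NNPP. intros Hne.
  set (J := fun s t r => rect_int f (x1 + s * w) (y1 + t * h)
              (x1 + (s + r) * w) (y1 + (t + r) * h)).
  set (E := Cmod (rect_int f x1 y1 (x1 + w) (y1 + h))).
  assert (hE : 0 < E) by now apply Cmod_gt_0.
  destruct (quadrisection (fun s t r => E * (r * r) <= Cmod (J s t r)))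
    as [s [t [hs [ht Hp]]]].
  - intros s t r hr HP. apply NNPP. intros HN.
    apply not_or_and in HN; destruct HN as [n1 HN].
    apply not_or_and in HN; destruct HN as [n2 HN].
    apply not_or_and in HN; destruct HN as [n3 n4].
    apply Rnot_le_lt in n1, n2, n3, n4.
    apply (Rle_not_lt _ _ HP).
    replace (J s t r) with ((J s t (r / 2)%R + J (s + r / 2)%R t (r / 2)%R) +
      (J s (t + r / 2)%R (r / 2)%R + J (s + r / 2)%R (t + r / 2)%R (r / 2)%R))%C.
    + eapply Rle_lt_trans. apply Cmod_triangle.
      eapply Rle_lt_trans. apply Rplus_le_compat; apply Cmod_triangle. lra.
    + unfold J.
      rewrite (rect_int_split_y f _ (y1 + t * h) _ (y1 + (t + r) * h) (y1 + (t + r / 2) * h)) by easy.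
      rewrite !(rect_int_split_x f (x1 + s * w) _ (x1 + (s + r) * w) _ (x1 + (s + r / 2) * w)) by easy.
      replace (s + r / 2 + r / 2) with (s + r) by lra.
      replace (t + r / 2 + r / 2) with (t + r) by lra. reflexivity.
  - unfold J, E. rewrite !Rplus_0_l, !Rmult_0_l, !Rplus_0_r, !Rmult_1_l, Rmult_1_r. apply Rle_refl.
  - destruct (Hd s t hs ht) as [d Hdp].
    set (p := (x1 + s * w, y1 + t * h) : C) in *.
    set (W := 1 + Rabs w + Rabs h).
    assert (hw := Rabs_pos w). assert (hh := Rabs_pos h).
    assert (hW : 0 < W) by (unfold W; lra).
    (* With this tolerance the error is at most [E / (8 W^2)] times [r W], and the sides add up to
       at most [r W], so [rect_int_bound] gives [E r^2 / 2]. *)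
    destruct (Hdp (E / (8 * (W * W)))) as [dl [hdl Hdl]].
    { apply Rdiv_lt_0_compat; nra. }
    destruct (Hp (dl / W)) as [s' [t' [r [hr [HP [hs' ht']]]]]].
    { now apply Rdiv_lt_0_compat. }
    set (g := (fun z => f p + d * (z - p))%C).
    assert (Eg : rect_int g (x1 + s' * w) (y1 + t' * h) (x1 + (s' + r) * w) (y1 + (t' + r) * h) = RtoC 0).
    { apply (rect_int_primitive (fun w => f p * w + / 2 * d * ((w - p) * (w - p)))%C).
      apply ccont_affine. intros z. apply cderiv_quadratic. }
    assert (EJ : J s' t' r = rect_int (fun z => f z - g z)%C (x1 + s' * w) (y1 + t' * h) (x1 + (s' + r) * w) (y1 + (t' + r) * h)).
    { rewrite rect_int_minus; [|easy|apply ccont_affine]. rewrite Eg. unfold J. ring. }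
    rewrite EJ in HP.
    assert (hrW : r * W < dl).
    { destruct hr as [_ hr]. apply (Rmult_lt_compat_r W) in hr; [|easy].
      unfold Rdiv in hr. rewrite Rmult_assoc, Rinv_l, Rmult_1_r in hr by lra. easy. }
    assert (HB := rect_int_bound (fun z => f z - g z)%C (x1 + s' * w) (y1 + t' * h)
      (x1 + (s' + r) * w) (y1 + (t' + r) * h) (E / (8 * (W * W)) * (r * W))).
    apply (Rle_not_lt _ _ HP). clear HP.
    eapply Rle_lt_trans. apply HB.
    + apply ccont_minus. easy. apply ccont_affine.
    + intros x y hx hy.
      assert (k1 := between_affine x1 w s' r x ltac:(lra) hx s hs').
      assert (k2 := between_affine y1 h t' r y ltac:(lra) hy t ht').
      set (k := ((x, y) - p)%C).
      assert (hk : Cmod k <= r * W).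
      { eapply Rle_trans. apply (Cmod_le_abs (x - (x1 + s * w)) (y - (y1 + t * h))).
        unfold W. nra. }
      specialize (Hdl k ltac:(lra)).
      replace (p + k)%C with ((x, y) : C) in Hdl
        by (unfold k; apply injective_projections; simpl; ring).
      unfold g. replace (f (x, y) - (f p + d * ((x, y) - p)))%C with (f (x, y) - f p - d * k)%C
        by (unfold k; ring).
      eapply Rle_trans. exact Hdl. apply Rmult_le_compat_l; [|easy].
      apply Rlt_le, Rdiv_lt_0_compat; nra.
    + replace (x1 + (s' + r) * w - (x1 + s' * w)) with (r * w) by ring.
      replace (y1 + (t' + r) * h - (y1 + t' * h)) with (r * h) by ring.
      rewrite !Rabs_mult, (Rabs_right r) by lra.
      apply Rle_lt_trans with (4 * (E / (8 * (W * W)) * (r * W)) * (r * W)).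
      * apply Rmult_le_compat_l; [|unfold W; nra].
        apply Rmult_le_pos. lra. apply Rmult_le_pos. apply Rlt_le, Rdiv_lt_0_compat; nra. nra.
      * replace (4 * (E / (8 * (W * W)) * (r * W)) * (r * W)) with (E * (r * r) / 2) by (field; lra).
        assert (0 < E * (r * r)) by (apply Rmult_lt_0_compat; nra). lra.
Qed.

(** Shrinking the rectangle towards the corner where [f] is only continuous. *)
Lemma goursat_corner (f : C -> C) (px py w h : R) : ccont f ->
  (forall z, z <> (px, py) -> exists d, cderiv f z d) ->
  rect_int f px py (px + w) (py + h) = RtoC 0.
Proof.
  intros Hf Hd.
  destruct (Req_dec w 0) as [->|hw]. { rewrite Rplus_0_r. apply rect_int_degenerate_x. }
  destruct (Req_dec h 0) as [->|hh]. { rewrite Rplus_0_r. apply rect_int_degenerate_y. }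
  assert (E : forall l, 0 < l < 1 -> rect_int f px py (px + w) (py + h) =
     rect_int f px py (px + l * w) (py + l * h)).
  { intros l hl.
    assert (E2 : rect_int f (px + l * w) py (px + w) (py + l * h) = RtoC 0).
    { replace (px + w) with ((px + l * w) + (1 - l) * w) by ring.
      apply goursat. easy. intros s t hs ht. apply Hd. intros E0.
      apply (f_equal fst) in E0; simpl in E0.
      assert (P : w * (l + s * (1 - l)) = 0) by lra.
      apply Rmult_integral in P. destruct P as [P|P]; [easy | nra]. }
    assert (E3 : rect_int f px (py + l * h) (px + w) (py + h) = RtoC 0).
    { replace (py + h) with ((py + l * h) + (1 - l) * h) by ring.
      apply goursat. easy. intros s t hs ht. apply Hd. intros E0.
      apply (f_equal snd) in E0; simpl in E0.
      assert (P : h * (l + t * (1 - l)) = 0) by lra.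
      apply Rmult_integral in P. destruct P as [P|P]; [easy | nra]. }
    rewrite (rect_int_split_y f _ _ _ _ (py + l * h)) by easy.
    rewrite (rect_int_split_x f _ _ _ (py + l * h) (px + l * w)) by easy.
    rewrite E2, E3. ring. }
  apply NNPP. intros Hne. apply Cmod_gt_0 in Hne.
  set (K := Cmod (rect_int f px py (px + w) (py + h))) in *.
  destruct (Hf (px, py) 1 Rlt_0_1) as [dl [hdl Hdl]].
  set (M := 1 + Cmod (f (px, py))).
  assert (hM : 0 < M). { unfold M. assert (H := Cmod_ge_0 (f (px, py))). lra. }
  set (W := 1 + Rabs w + Rabs h).
  assert (hw' := Rabs_pos w). assert (hh' := Rabs_pos h).
  assert (hW : 0 < W) by (unfold W; lra).
  (* The second bound keeps the small rectangle where [|f| <= M], the third makes its integral at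
     most [K / 2]. *)
  set (l := Rmin (/ 2) (Rmin (dl / (2 * W)) (K / (8 * M * W)))).
  assert (l0 : 0 < l).
  { unfold l. repeat apply Rmin_pos. lra. apply Rdiv_lt_0_compat; lra.
    apply Rdiv_lt_0_compat. easy. apply Rmult_lt_0_compat; lra. }
  assert (l1 : l <= / 2) by apply Rmin_l.
  assert (l2 : l <= dl / (2 * W)) by (eapply Rle_trans; [apply Rmin_r | apply Rmin_l]).
  assert (l3 : l <= K / (8 * M * W)) by (eapply Rle_trans; [apply Rmin_r | apply Rmin_r]).
  apply Rle_div_r in l2; [|lra]. apply Rle_div_r in l3; [|nra].
  assert (HB := rect_int_bound f px py (px + l * w) (py + l * h) M Hf).
  rewrite <- (E l ltac:(lra)) in HB. fold K in HB.
  replace (px + l * w - px) with (l * w) in HB by ring.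
  replace (py + l * h - py) with (l * h) in HB by ring.
  rewrite !Rabs_mult, (Rabs_right l) in HB by lra.
  refine (Rle_not_lt _ _ (HB _) _); [|].
  2: apply Rle_lt_trans with (4 * M * (l * W)); [unfold W; nra|]; nra.
  - intros x y hx hy.
    assert (k1 := between_affine px w 0 l x ltac:(lra)).
    assert (k2 := between_affine py h 0 l y ltac:(lra)).
    rewrite !Rmult_0_l, !Rplus_0_r, !Rplus_0_l in k1, k2.
    specialize (k1 hx 0 ltac:(lra)). specialize (k2 hy 0 ltac:(lra)).
    rewrite !Rmult_0_l, !Rplus_0_r in k1, k2.
    specialize (Hdl (x, y)).
    replace (f (x, y)) with ((f (x, y) - f (px, py)) + f (px, py))%C by ring.
    eapply Rle_trans. apply Cmod_triangle. unfold M.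
    apply Rplus_le_compat_r, Rlt_le, Hdl.
    eapply Rle_lt_trans. apply (Cmod_le_abs (x - px) (y - py)).
    apply Rle_lt_trans with (l * W); [unfold W; nra | lra].
Qed.

(** The lines through [p] cut the rectangle into four that have a corner at [p], and sign changes
    bring this corner to the first position. With signed integrals this holds wherever [p] lies,
    inside or outside. *)
Lemma goursat_punctured (f : C -> C) (p : C) (x1 y1 x2 y2 : R) : ccont f ->
  (forall z, z <> p -> exists d, cderiv f z d) -> rect_int f x1 y1 x2 y2 = RtoC 0.
Proof.
  destruct p as [px py]. intros Hf Hd.
  assert (E : forall x y, rect_int f px py x y = RtoC 0).
  { intros x y. replace x with (px + (x - px)) by ring. replace y with (py + (y - py)) by ring.
    now apply goursat_corner. }
  rewrite (rect_int_split_x f x1 y1 x2 y2 px Hf).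
  rewrite !(rect_int_split_y f _ y1 _ y2 py Hf).
  rewrite (rect_int_swap_x f px y1 x1 py Hf), (rect_int_swap_y f px py x1 y1 Hf).
  rewrite (rect_int_swap_x f px py x1 y2 Hf), (rect_int_swap_y f px py x2 y1 Hf).
  rewrite !E. ring.
Qed.

(** The exceptional point is meant for difference quotients, which are continuous at their base
    point but not yet known to be differentiable there. The primitive integrates from the origin
    along a horizontal and then a vertical segment. *)
Lemma primitive_exists (f : C -> C) (p : C) : ccont f ->
  (forall z, z <> p -> exists d, cderiv f z d) ->
  exists F, forall z, cderiv F z (f z).
Proof.
  intros Hf Hd.
  exists (fun z => hint f 0 0 (fst z) + Ci * vint f (fst z) 0 (snd z))%C.
  intros [x y] eps he.
  destruct (Hf (x, y) (eps / 4) ltac:(lra)) as [dl [hdl Hdl]].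
  exists (dl / 2). split. lra. intros [h k] hh.
  set (c := f (x, y)).
  (* Goursat's theorem on the rectangle between heights [0] and [y] moves the horizontal part of the
     increment from height [0] up to height [y], where [f] is close to [c]. *)
  assert (E : (hint f 0 0 (x + h) + Ci * vint f (x + h) 0 (y + k) -
    (hint f 0 0 x + Ci * vint f x 0 y) - c * (h, k))%C =
    (cint (fun t => f (t, y) - c) x (x + h) + Ci * cint (fun t => f ((x + h)%R, t) - c) y (y + k))%C).
  { assert (Z := goursat_punctured f p x 0 (x + h) y Hf Hd). unfold rect_int in Z.
    rewrite !cint_minus, !cint_const by
      (apply pcont_hcomp || apply pcont_vcomp || apply pcont_const; easy).
    fold (hint f y x (x + h)) (vint f (x + h) y (y + k)).
    rewrite (hint_Chasles f 0 0 x (x + h)), (vint_Chasles f (x + h) 0 y (y + k)) by easy.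
    replace (x + h - x) with h by ring. replace (y + k - y) with k by ring.
    replace ((h, k) : C) with (RtoC h + Ci * RtoC k)%C
      by (apply injective_projections; simpl; ring).
    replace (hint f y x (x + h)) with (hint f 0 x (x + h) + Ci * vint f (x + h) 0 y -
      Ci * vint f x 0 y - (hint f 0 x (x + h) + Ci * vint f (x + h) 0 y - hint f y x (x + h) -
       Ci * vint f x 0 y))%C by ring.
    rewrite Z. ring. }
  simpl fst; simpl snd. rewrite E. clear E.
  assert (h1 := Rabs_fst_le (h, k)). assert (h2 := Rabs_snd_le (h, k)). simpl in h1, h2.
  assert (A1 : forall t, Rmin x (x + h) <= t <= Rmax x (x + h) -> Rabs (t - x) <= Rabs h).
  { intros t. unfold Rmin, Rmax, Rabs. destruct (Rle_dec _ _); destruct (Rcase_abs h);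
    destruct (Rcase_abs _); lra. }
  assert (A2 : forall t, Rmin y (y + k) <= t <= Rmax y (y + k) -> Rabs (t - y) <= Rabs k).
  { intros t. unfold Rmin, Rmax, Rabs. destruct (Rle_dec _ _); destruct (Rcase_abs k);
    destruct (Rcase_abs _); lra. }
  assert (B1 := cint_bound (fun t => f (t, y) - c)%C x (x + h) (eps / 4)).
  assert (B2 := cint_bound (fun t => f ((x + h)%R, t) - c)%C y (y + k) (eps / 4)).
  replace (x + h - x) with h in B1 by ring. replace (y + k - y) with k in B2 by ring.
  eapply Rle_trans. apply Cmod_triangle. rewrite Cmod_mult, Cmod_Ci, Rmult_1_l.
  eapply Rle_trans. apply Rplus_le_compat; [apply B1 | apply B2].
  - apply pcont_minus; [now apply pcont_hcomp | apply pcont_const].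
  - intros t ht. apply Rlt_le, Hdl.
    eapply Rle_lt_trans. apply (Cmod_le_abs (t - x) (y - y)).
    specialize (A1 t ht). rewrite Rminus_diag, Rabs_R0. lra.
  - apply pcont_minus; [now apply pcont_vcomp | apply pcont_const].
  - intros t ht. apply Rlt_le, Hdl.
    eapply Rle_lt_trans. apply (Cmod_le_abs (x + h - x) (t - y)).
    specialize (A2 t ht). replace (x + h - x) with h by ring. lra.
  - nra.
Qed.

(** * Taylor coefficients *)

Lemma Cmod_minus_gt_0 (a b : C) : a <> b -> 0 < Cmod (a - b)%C.
Proof. intros H. now apply Cmod_gt_0, Cminus_eq_contra. Qed.

(** The difference quotient with its singularity at [p] filled in; [d] will be the derivative of [f]
    at [p]. *)
Definition slope (f : C -> C) (d p z : C) : C :=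
  if Ceq_dec z p then d else ((f z - f p) / (z - p))%C.

Lemma slope_eq (f : C -> C) (d p z : C) : (slope f d p z * (z - p))%C = (f z - f p)%C.
Proof.
  unfold slope. destruct (Ceq_dec z p) as [->|hz]. ring.
  field. now apply Cminus_eq_contra.
Qed.

Lemma slope_ccont_at_base (f : C -> C) (d p : C) : cderiv f p d -> ccont_at (slope f d p) p.
Proof.
  intros H eps he. destruct (H (eps / 2) ltac:(lra)) as [dl [hdl Hdl]].
  exists dl. split; [easy|]. intros w hw.
  unfold slope at 2. destruct (Ceq_dec p p) as [_|n]; [|easy].
  destruct (Ceq_dec w p) as [->|hwp].
  { unfold slope. destruct (Ceq_dec p p) as [_|n]; [|easy].
    replace (d - d)%C with (RtoC 0) by ring. now rewrite Cmod_0. }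
  assert (hp := Cmod_minus_gt_0 _ _ hwp).
  specialize (Hdl _ hw). replace (p + (w - p))%C with w in Hdl by ring.
  replace (slope f d p w - d)%C with ((f w - f p - d * (w - p)) / (w - p))%C.
  - rewrite Cmod_div by now apply Cminus_eq_contra.
    apply Rle_lt_trans with (eps / 2); [|lra]. apply Rle_div_l; lra.
  - rewrite <- (slope_eq f d p w). field. now apply Cminus_eq_contra.
Qed.

Lemma slope_cderiv (f : C -> C) (d p z e : C) : z <> p -> cderiv f z e ->
  cderiv (slope f d p) z ((e - slope f d p z) / (z - p))%C.
Proof.
  intros hz H eps he.
  set (u := (z - p)%C). assert (hu : 0 < Cmod u) by now apply Cmod_minus_gt_0.
  assert (hu0 : u <> RtoC 0) by now apply Cmod_gt_0.
  set (s := slope f d p z).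
  set (K := 1 + Cmod (e - s)%C). assert (hK : 0 < K) by (unfold K; assert (Hx := Cmod_ge_0 (e - s)%C); lra).
  destruct (H (eps * Cmod u / 4)) as [dl [hdl Hdl]]. { assert (0 < eps * Cmod u) by nra. lra. }
  assert (hB : 0 < eps * (Cmod u * Cmod u) / (4 * K)).
  { apply Rdiv_lt_0_compat; [|lra]. apply Rmult_lt_0_compat; nra. }
  exists (Rmin dl (Rmin (Cmod u / 2) (eps * (Cmod u * Cmod u) / (4 * K)))). split.
  { repeat apply Rmin_pos; lra. }
  intros h hh.
  assert (h1 := Rlt_le_trans _ _ _ hh (Rmin_l _ _)).
  assert (h2 := Rlt_le_trans _ _ _ hh (Rle_trans _ _ _ (Rmin_r _ _) (Rmin_l _ _))).
  assert (h3 := Rlt_le_trans _ _ _ hh (Rle_trans _ _ _ (Rmin_r _ _) (Rmin_r _ _))).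
  specialize (Hdl h h1).
  assert (huh : Cmod u / 2 <= Cmod (u + h)%C).
  { assert (Hx := Cmod_sub_ge u (- h)%C). rewrite Cmod_opp in Hx.
    replace (u - - h)%C with (u + h)%C in Hx by ring. lra. }
  assert (huh0 : (u + h)%C <> RtoC 0) by (apply Cmod_gt_0; lra).
  assert (E1 := slope_eq f d p (z + h)%C). assert (E2 := slope_eq f d p z). fold s u in E2.
  replace (z + h - p)%C with (u + h)%C in E1 by (unfold u; ring).
  set (er := (f (z + h) - f z - e * h)%C) in *.
  (* An exact formula for the error: the first term is the error of [f] itself, the second is
     quadratic in [h] and comes from moving the denominator [u] to [u + h]. *)
  replace (slope f d p (z + h) - s - (e - s) / u * h)%C
    with (er / (u + h) - (e - s) * h * h / (u * (u + h)))%C.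
  - eapply Rle_trans. apply Cmod_sub_le.
    rewrite !Cmod_div by (try apply Cmult_neq_0; easy).
    rewrite !Cmod_mult.
    assert (hh0 := Cmod_ge_0 h).
    assert (hks : Cmod (e - s)%C <= K) by (unfold K; lra).
    assert (hes := Cmod_ge_0 (e - s)%C).
    replace (eps * Cmod h) with (eps / 2 * Cmod h + eps / 2 * Cmod h) by lra.
    apply Rplus_le_compat.
    + apply Rle_div_l. lra. eapply Rle_trans. exact Hdl.
      assert (0 <= eps * Cmod h) by nra. nra.
    + apply Rle_div_l. nra.
      apply Rmult_lt_compat_r with (r := 4 * K) in h3; [|lra].
      unfold Rdiv in h3. rewrite Rmult_assoc, Rinv_l, Rmult_1_r in h3 by lra.
      apply Rle_trans with (K * Cmod h * Cmod h).
      { apply Rmult_le_compat_r; [easy|]. now apply Rmult_le_compat_r. }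
      apply Rle_trans with (eps / 4 * (Cmod u * Cmod u) * Cmod h).
      { apply Rmult_le_compat_r; [easy|]. lra. }
      assert (0 <= eps * Cmod h * Cmod u) by (apply Rmult_le_pos; nra).
      nra.
  - assert (Ef : (er = slope f d p (z + h) * (u + h) - s * u - e * h)%C).
    { unfold er. rewrite E1, E2. ring. }
    rewrite Ef. field. split; easy.
Qed.

(** * Averages over circles and Cauchy coefficients *)

Definition circ (r t : R) : C := (r * cos t, r * sin t).

(** The reciprocal of [circ r t], written out so that its continuity and its powers reduce to real
    trigonometry. *)
Definition icirc (r t : R) : C := (cos t / r, - sin t / r).

Lemma circ_icirc (r t : R) : r <> 0 -> (circ r t * icirc r t)%C = RtoC 1.
Proof.
  intros hr. unfold circ, icirc. assert (H := sin2_cos2 t). unfold Rsqr in H.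
  apply injective_projections; simpl; field_simplify; try easy; nra.
Qed.

Lemma Cmod_circ (r t : R) : 0 <= r -> Cmod (circ r t) = r.
Proof.
  intros hr. unfold circ, Cmod; simpl.
  assert (H := sin2_cos2 t). unfold Rsqr in H.
  replace (r * cos t * (r * cos t * 1) + r * sin t * (r * sin t * 1)) with (r * r) by nra.
  now apply sqrt_square.
Qed.

Lemma Cmod_icirc (r t : R) : 0 < r -> Cmod (icirc r t) = / r.
Proof.
  intros hr. assert (H := f_equal Cmod (circ_icirc r t ltac:(lra))).
  rewrite Cmod_mult, Cmod_circ, Cmod_1 in H by lra.
  apply Rmult_eq_reg_l with r; [|lra]. rewrite H. field. lra.
Qed.

Lemma pcont_rderiv (g : R -> C) : (forall t, exists v, rderiv g t v) -> pcont g.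
Proof.
  intros H t. destruct (H t) as [v Hv]. split.
  - apply (@ex_derive_continuous R_AbsRing R_NormedModule).
    exists (fst v). exact (rderiv_fst _ _ _ Hv).
  - apply (@ex_derive_continuous R_AbsRing R_NormedModule).
    exists (snd v). exact (rderiv_snd _ _ _ Hv).
Qed.

Lemma rderiv_circ (r t : R) : rderiv (circ r) t (circ r t * Ci)%C.
Proof. apply rderiv_of_components; unfold circ; simpl; auto_derive; try easy; ring. Qed.

Lemma pcont_circ (r : R) : pcont (circ r).
Proof. apply pcont_rderiv. intros t. eexists. apply rderiv_circ. Qed.

Lemma pcont_icirc (r : R) : r <> 0 -> pcont (icirc r).
Proof.
  intros hr. apply pcont_rderiv. intros t. exists (- sin t / r, - cos t / r).
  apply rderiv_of_components; unfold icirc; simpl; auto_derive; try easy; field; easy.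
Qed.

Lemma pcont_pow (g : R -> C) (n : nat) : pcont g -> pcont (fun t => g t ^ n)%C.
Proof.
  intros H. induction n; simpl. apply pcont_const. now apply (pcont_mult g (fun t => (g t ^ n)%C)).
Qed.

Lemma icirc_pow (r t : R) (n : nat) : r <> 0 ->
  (icirc r t ^ n)%C = (RtoC (/ r ^ n)%R * (cos (INR n * t), (- sin (INR n * t))%R))%C.
Proof.
  intros hr. induction n.
  - simpl. rewrite Rmult_0_l, cos_0, sin_0.
    apply injective_projections; simpl; field.
  - rewrite Cpow_S, IHn, S_INR.
    replace ((INR n + 1) * t) with (INR n * t + t) by ring.
    rewrite cos_plus, sin_plus. unfold icirc.
    assert (hn := pow_nonzero r n hr).
    apply injective_projections; simpl; field; easy.
Qed.

Lemma cint_icirc_pow (r : R) (n : nat) : r <> 0 -> (0 < n)%nat ->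
  cint (fun t => icirc r t ^ n)%C 0 (2 * PI) = RtoC 0.
Proof.
  intros hr hn. assert (hN : INR n <> 0) by (apply not_0_INR; lia).
  rewrite (cint_ext _ (fun t => RtoC (/ r ^ n)%R * (cos (INR n * t), (- sin (INR n * t))%R))%C)
    by (intros t; now apply icirc_pow).
  assert (D : forall t, rderiv (fun t => (sin (INR n * t) / INR n, cos (INR n * t) / INR n)) t
     (cos (INR n * t), - sin (INR n * t))).
  { intros t. apply rderiv_of_components; simpl; auto_derive; try easy; field; easy. }
  assert (P : pcont (fun t => (cos (INR n * t), - sin (INR n * t)))).
  { intros t; split; simpl; apply (@ex_derive_continuous R_AbsRing R_NormedModule); auto_derive; easy. }
  rewrite cint_scal by easy.
  rewrite (cint_FTC _ _ _ _ D P).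
  replace (INR n * (2 * PI)) with (0 + 2 * INR n * PI) by ring.
  rewrite sin_period, cos_period, !Rmult_0_r. ring.
Qed.

Definition cavg (g : R -> C) : C := (RtoC (/ (2 * PI)) * cint g 0 (2 * PI))%C.

Lemma cavg_minus (f g : R -> C) : pcont f -> pcont g ->
  cavg (fun t => f t - g t)%C = (cavg f - cavg g)%C.
Proof. intros Hf Hg. unfold cavg. rewrite cint_minus by easy. ring. Qed.

Lemma cavg_scal (c : C) (f : R -> C) : pcont f -> cavg (fun t => c * f t)%C = (c * cavg f)%C.
Proof. intros Hf. unfold cavg. rewrite cint_scal by easy. ring. Qed.

Lemma cavg_ext (f g : R -> C) : (forall t, f t = g t) -> cavg f = cavg g.
Proof. intros E. unfold cavg. now rewrite (cint_ext f g). Qed.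

Lemma cavg_const (c : C) : cavg (fun _ => c) = c.
Proof.
  unfold cavg. rewrite cint_const, Cmult_assoc, <- RtoC_mult.
  assert (H := PI_RGT_0). replace (/ (2 * PI) * (2 * PI - 0)) with 1 by (field; lra). ring.
Qed.

Lemma cavg_bound (g : R -> C) (M : R) : pcont g ->
  (forall t, 0 <= t <= 2 * PI -> Cmod (g t) <= M) -> Cmod (cavg g) <= 2 * M.
Proof.
  intros Hg H. assert (hpi := PI_RGT_0).
  assert (hi : 0 < / (2 * PI)) by (apply Rinv_0_lt_compat; lra).
  assert (B := cint_bound g 0 (2 * PI) M Hg).
  unfold cavg. rewrite Cmod_mult, Cmod_R, Rabs_right by lra.
  rewrite Rminus_0_r, (Rabs_right (2 * PI)) in B by lra.
  rewrite Rmin_left, Rmax_right in B by lra. specialize (B H).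
  apply Rle_trans with (/ (2 * PI) * (2 * M * (2 * PI))).
  - apply Rmult_le_compat_l; lra.
  - right. field. lra.
Qed.

Lemma pcont_bounded (g : R -> C) (a b : R) : pcont g -> a <= b ->
  exists M, forall t, a <= t <= b -> Cmod (g t) <= M.
Proof.
  intros Hg hab.
  assert (B : forall u : R -> R, (forall t, continuous u t) ->
    exists M, forall t, a <= t <= b -> Rabs (u t) <= M).
  { intros u Hu.
    destruct (continuity_ab_maj (fun t => Rabs (u t)) a b hab) as [x [Hx _]].
    - intros c _. apply (continuity_pt_comp u Rabs).
      apply continuity_pt_filterlim, Hu. apply Rcontinuity_abs.
    - now exists (Rabs (u x)). }
  destruct (B (fun t => fst (g t))) as [M1 H1]. intros; apply Hg.
  destruct (B (fun t => snd (g t))) as [M2 H2]. intros; apply Hg.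
  exists (M1 + M2). intros t ht. rewrite (surjective_pairing (g t)).
  eapply Rle_trans. apply Cmod_le_abs.
  apply Rplus_le_compat; auto.
Qed.

Lemma is_series_C_eps (a : nat -> C) (l : C) :
  (forall eps, 0 < eps -> exists N, forall n, (N <= n)%nat ->
     Cmod (sum_n (G := C_AbelianMonoid) a n - l)%C < eps) ->
  is_series (V := C_NormedModule) a l.
Proof.
  intros H. apply (filterlim_locally_ball_norm (K := C_AbsRing) (U := C_NormedModule)).
  intros eps. destruct (H eps (cond_pos eps)) as [N HN].
  exists N. intros n hn. exact (HN n hn).
Qed.

Lemma C_eps_is_series (a : nat -> C) (l : C) :
  is_series (V := C_NormedModule) a l ->
  forall eps, 0 < eps -> exists N, forall n, (N <= n)%nat ->
     Cmod (sum_n (G := C_AbelianMonoid) a n - l)%C < eps.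
Proof.
  intros H eps he.
  apply (filterlim_locally_ball_norm (K := C_AbsRing) (U := C_NormedModule)) with (eps := mkposreal eps he) in H.
  destruct H as [N HN]. exists N. intros n hn. exact (HN n hn).
Qed.

(** Cauchy's integral for the coefficient: the average of [f z / z^n] over [|z| = r], with [icirc]
    in the role of [1 / z]. *)
Definition taylor_coeff (f : C -> C) (r : R) (n : nat) : C :=
  cavg (fun t => f (circ r t) * icirc r t ^ n)%C.

Lemma pcont_circ_comp (f : C -> C) (r : R) : ccont f -> pcont (fun t => f (circ r t)).
Proof. intros H. apply (pcont_comp f (circ r)). intros; apply H. apply pcont_circ. Qed.

Lemma taylor_coeff_bound (f : C -> C) (r : R) : ccont f -> 0 < r ->
  exists M, forall n, Cmod (taylor_coeff f r n) <= M / r ^ n.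
Proof.
  intros Hf hr. assert (hpi := PI_RGT_0).
  destruct (pcont_bounded (fun t => f (circ r t)) 0 (2 * PI)) as [M HM].
  now apply pcont_circ_comp. lra.
  exists (2 * M). intros n.
  replace (2 * M / r ^ n) with (2 * (M / r ^ n)) by (unfold Rdiv; ring).
  apply cavg_bound.
  - apply pcont_mult. now apply pcont_circ_comp. apply pcont_pow, pcont_icirc; lra.
  - intros t ht. rewrite Cmod_mult, Cmod_pow, Cmod_icirc by easy.
    rewrite pow_inv. apply Rmult_le_compat_r. apply Rlt_le, Rinv_0_lt_compat, pow_lt, hr.
    now apply HM.
Qed.

(** [z / (z - p) = sum_(k <= n) (p / z) ^ k + (p / z) ^ (n + 1) * z / (z - p)] on the circle, and
    [(f z - f p) / (z - p)] has a primitive, so it integrates to [0]. *)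
Lemma taylor_remainder (f f1 : C -> C) (r : R) (p : C) (n : nat) :
  (forall z, cderiv f z (f1 z)) -> 0 < r -> Cmod p < r ->
  (sum_n (G := C_AbelianMonoid) (fun k => taylor_coeff f r k * p ^ k) n - f p)%C =
  (- cavg (fun t => slope f (f1 p) p (circ r t) * circ r t * (p * icirc r t) ^ (S n)))%C.
Proof.
  intros Hf hr hp.
  assert (cf : ccont f) by (intros z; eapply cderiv_ccont_at, Hf).
  set (q := slope f (f1 p) p).
  assert (cq : ccont q).
  { intros z. destruct (Ceq_dec z p) as [->|hz].
    - now apply slope_ccont_at_base.
    - eapply cderiv_ccont_at, slope_cderiv; [easy | apply Hf]. }
  assert (p1 : pcont (fun t => f (circ r t))) by now apply pcont_circ_comp.
  assert (p2 : pcont (fun t => q (circ r t))) by now apply pcont_circ_comp.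
  assert (p3 : pcont (icirc r)) by (apply pcont_icirc; lra).
  assert (p4 : forall k, pcont (fun t => icirc r t ^ k)%C) by (intros; now apply pcont_pow).
  assert (p5 : pcont (fun t => q (circ r t) * circ r t)%C).
  { apply pcont_mult. easy. apply pcont_circ. }
  assert (p6 : forall k, pcont (fun t => (p * icirc r t) ^ k)%C).
  { intros k. apply (pcont_pow (fun t => p * icirc r t)%C).
    apply (pcont_mult (fun _ => p)). apply pcont_const. easy. }
  assert (E0 : cavg (fun t => q (circ r t) * circ r t)%C = RtoC 0).
  { destruct (primitive_exists q p cq) as [Q HQ].
    { intros z hz. eexists. apply slope_cderiv. easy. apply Hf. }
    assert (HI : cint (fun t => q (circ r t) * (circ r t * Ci))%C 0 (2 * PI) = RtoC 0).
    { rewrite (cint_FTC (fun t => Q (circ r t))).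
      - unfold circ. rewrite sin_2PI, cos_2PI, sin_0, cos_0. ring.
      - intros t. apply (rderiv_comp Q (circ r)). apply HQ. apply rderiv_circ.
      - apply pcont_mult. easy. apply pcont_mult. apply pcont_circ. apply pcont_const. }
    unfold cavg.
    rewrite (cint_ext _ (fun t => (- Ci) * (q (circ r t) * (circ r t * Ci)))%C).
    - rewrite cint_scal, HI. ring.
      apply pcont_mult. easy. apply pcont_mult. apply pcont_circ. apply pcont_const.
    - intros t. assert (Hi : (Ci * Ci = - RtoC 1)%C) by (apply injective_projections; simpl; ring).
      replace (- Ci * (q (circ r t) * (circ r t * Ci)))%C
        with (- (Ci * Ci) * (q (circ r t) * circ r t))%C by ring. rewrite Hi. ring. }
  (* With [w = p / z] one has [q z w^(k+1) = q p w^k] and [q (z - p) = f z - f p]; raising the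
     exponent by one therefore splits off exactly one term of the series. *)
  assert (Estep : forall k, cavg (fun t => q (circ r t) * circ r t * (p * icirc r t) ^ (S k))%C =
     (cavg (fun t => q (circ r t) * circ r t * (p * icirc r t) ^ k) -
      (taylor_coeff f r k * p ^ k - f p * cavg (fun t => (p * icirc r t) ^ k)))%C).
  { intros k.
    assert (X : cavg (fun t => (f (circ r t) - f p) * (p * icirc r t) ^ k)%C =
      (taylor_coeff f r k * p ^ k - f p * cavg (fun t => (p * icirc r t) ^ k))%C).
    { rewrite (cavg_ext _ (fun t => p ^ k * (f (circ r t) * icirc r t ^ k) - f p * (p * icirc r t) ^ k)%C).
      - rewrite cavg_minus, !cavg_scal. unfold taylor_coeff. ring.
        apply p6. now apply pcont_mult.
        apply (pcont_mult (fun _ => (p ^ k)%C)). apply pcont_const. now apply pcont_mult.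
        apply (pcont_mult (fun _ => f p)). apply pcont_const. apply p6.
      - intros t. rewrite Cpow_mult_l. ring. }
    rewrite <- X, <- cavg_minus.
    - apply cavg_ext. intros t. rewrite <- (slope_eq f (f1 p) p (circ r t)). fold q.
      rewrite Cpow_S.
      assert (Hc := circ_icirc r t ltac:(lra)).
      replace (q (circ r t) * circ r t * (p * icirc r t * (p * icirc r t) ^ k))%C
        with (q (circ r t) * p * (p * icirc r t) ^ k * (circ r t * icirc r t))%C by ring.
      rewrite Hc. ring.
    - now apply pcont_mult.
    - apply pcont_mult; [|apply p6]. apply pcont_minus. easy. apply pcont_const. }
  (* Positive powers of [1 / z] have average [0], so the term with [f p] contributes only at
     [k = 0]. *)
  assert (Z : forall k, cavg (fun t => (p * icirc r t) ^ (S k))%C = RtoC 0).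
  { intros k. rewrite (cavg_ext _ (fun t => p ^ S k * icirc r t ^ S k)%C)
      by (intros; apply Cpow_mult_l).
    rewrite cavg_scal by easy. unfold cavg.
    rewrite (cint_icirc_pow r (S k)) by (lra || lia). ring. }
  induction n.
  - rewrite sum_O, Estep.
    rewrite (cavg_ext (fun t => q (circ r t) * circ r t * (p * icirc r t) ^ 0)%C
      (fun t => q (circ r t) * circ r t)%C) by (intros t; simpl; ring).
    rewrite (cavg_ext (fun t => (p * icirc r t) ^ 0)%C (fun _ => RtoC 1)) by reflexivity.
    rewrite E0, cavg_const. ring.
  - rewrite sum_Sn, Estep, Z.
    change (plus ?x ?y) with (x + y)%C.
    replace (cavg (fun t => q (circ r t) * circ r t * (p * icirc r t) ^ S n)%C)
      with (- (sum_n (G := C_AbelianMonoid) (fun k => taylor_coeff f r k * p ^ k)%C n - f p))%C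
      by (rewrite IHn; ring). ring.
Qed.

Lemma is_series_taylor (f f1 : C -> C) (r : R) (p : C) :
  (forall z, cderiv f z (f1 z)) -> 0 < r -> Cmod p < r ->
  is_series (V := C_NormedModule) (fun k => taylor_coeff f r k * p ^ k)%C (f p).
Proof.
  intros Hf hr hp. assert (hpi := PI_RGT_0).
  assert (cq : ccont (slope f (f1 p) p)).
  { intros z. destruct (Ceq_dec z p) as [->|hz].
    - now apply slope_ccont_at_base.
    - eapply cderiv_ccont_at, slope_cderiv; [easy | apply Hf]. }
  assert (p5 : pcont (fun t => slope f (f1 p) p (circ r t) * circ r t)%C).
  { apply pcont_mult. now apply pcont_circ_comp. apply pcont_circ. }
  destruct (pcont_bounded _ 0 (2 * PI) p5) as [M HM]. lra.
  assert (hM : 0 <= M) by (eapply Rle_trans; [apply Cmod_ge_0 | apply (HM 0); lra]).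
  set (x := Cmod p / r).
  assert (hx : 0 <= x < 1).
  { unfold x. split. apply Rdiv_le_0_compat. apply Cmod_ge_0. easy. apply Rlt_div_l; lra. }
  apply is_series_C_eps. intros eps he.
  destruct (pow_lt_1_zero x) with (y := eps / (2 * M + 1)) as [N HN].
  { rewrite Rabs_right; lra. }
  { apply Rdiv_lt_0_compat; lra. }
  exists N. intros n hn.
  rewrite (taylor_remainder f f1 r p n Hf hr hp), Cmod_opp.
  specialize (HN (S n) ltac:(lia)).
  rewrite Rabs_right in HN by (apply Rle_ge, pow_le; lra).
  apply Rlt_div_r in HN; [|lra].
  assert (hxn : 0 <= x ^ S n) by (apply pow_le; lra).
  eapply Rle_lt_trans. apply (cavg_bound _ (M * x ^ S n)).
  - apply pcont_mult. easy. apply (pcont_pow (fun t => p * icirc r t)%C).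
    apply (pcont_mult (fun _ => p)). apply pcont_const. apply pcont_icirc; lra.
  - intros t ht. rewrite Cmod_mult, Cmod_pow, (Cmod_mult p), Cmod_icirc by easy.
    apply Rmult_le_compat_r. easy. now apply HM.
  - nra.
Qed.

(** * Power series and the order of zeros *)

Notation Cseries := (is_series (K := C_AbsRing) (V := C_NormedModule)).

Lemma Cseries_scal (c : C) (a : nat -> C) (l : C) :
  Cseries a l -> Cseries (fun n => c * a n)%C (c * l)%C.
Proof. apply (@is_series_scal C_AbsRing C_NormedModule). Qed.

Lemma Cseries_minus (a b : nat -> C) (la lb : C) :
  Cseries a la -> Cseries b lb -> Cseries (fun n => a n - b n)%C (la - lb)%C.
Proof. apply (@is_series_minus C_AbsRing C_NormedModule). Qed.

Lemma Cseries_ext (a b : nat -> C) (l : C) :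
  (forall n, a n = b n) -> Cseries a l -> Cseries b l.
Proof. apply (@is_series_ext C_AbsRing C_NormedModule). Qed.

Lemma Cseries_unique (a : nat -> C) (l1 l2 : C) : Cseries a l1 -> Cseries a l2 -> l1 = l2.
Proof.
  intros H1 H2. apply NNPP. intros hne. assert (h := Cmod_minus_gt_0 _ _ hne).
  destruct (C_eps_is_series _ _ H1 (Cmod (l1 - l2)%C / 2) ltac:(lra)) as [N1 h1].
  destruct (C_eps_is_series _ _ H2 (Cmod (l1 - l2)%C / 2) ltac:(lra)) as [N2 h2].
  specialize (h1 (N1 + N2)%nat ltac:(lia)). specialize (h2 (N1 + N2)%nat ltac:(lia)).
  set (s := sum_n _ _) in *.
  assert (k := Cmod_sub_le (s - l2)%C (s - l1)%C).
  replace (s - l2 - (s - l1))%C with (l1 - l2)%C in k by ring. lra.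
Qed.

Lemma Cseries_tail (a : nat -> C) (l : C) :
  Cseries (fun n => a (S n)) l -> Cseries a (l + a 0%nat)%C.
Proof.
  intros H. apply (@is_series_decr_1 C_AbsRing C_NormedModule).
  change (Cseries (fun k => a (S k)) ((l + a 0%nat) + - a 0%nat)%C).
  replace ((l + a 0%nat) + - a 0%nat)%C with l by ring. exact H.
Qed.

Lemma Cseries_head (a : nat -> C) (l : C) :
  Cseries a l -> Cseries (fun n => a (S n)) (l - a 0%nat)%C.
Proof.
  intros H. apply (@is_series_incr_1 C_AbsRing C_NormedModule).
  change (Cseries a ((l - a 0%nat) + a 0%nat)%C).
  replace ((l - a 0%nat) + a 0%nat)%C with l by ring. exact H.
Qed.

Lemma Cseries_geom_ex (a : nat -> C) (K x : R) : 0 <= x < 1 ->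
  (forall n, Cmod (a n) <= K * x ^ n) -> exists l, Cseries a l.
Proof.
  intros hx H.
  apply (@ex_series_le C_AbsRing C_CompleteNormedModule a (fun n => K * x ^ n)).
  - exact H.
  - apply (@ex_series_scal R_AbsRing R_NormedModule K (fun n => x ^ n)). exists (/ (1 - x)). apply is_series_geom.
    rewrite Rabs_right; lra.
Qed.

Lemma Cseries_geom_bound (a : nat -> C) (l : C) (K x : R) : 0 <= x < 1 ->
  (forall n, Cmod (a n) <= K * x ^ n) -> Cseries a l -> Cmod l <= K / (1 - x).
Proof.
  intros hx H Hl.
  assert (hK : 0 <= K). { assert (h := H 0%nat). assert (h' := Cmod_ge_0 (a 0%nat)). simpl in h. lra. }
  assert (P : forall n, Cmod (sum_n (G := C_AbelianMonoid) a n) <= K * (1 - x ^ S n) / (1 - x)).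
  { induction n.
    - rewrite sum_O. eapply Rle_trans. apply H. right. simpl. field. lra.
    - rewrite sum_Sn. eapply Rle_trans. apply Cmod_triangle.
      eapply Rle_trans. apply Rplus_le_compat. exact IHn. apply H.
      right. simpl. field. lra. }
  apply Rnot_lt_le. intros hlt.
  destruct (C_eps_is_series _ _ Hl (Cmod l - K / (1 - x)) ltac:(lra)) as [N hN].
  specialize (hN N (le_n N)). specialize (P N).
  assert (K * (1 - x ^ S N) / (1 - x) <= K / (1 - x)).
  { apply Rmult_le_compat_r. apply Rlt_le, Rinv_0_lt_compat; lra.
    assert (0 <= x ^ S N) by (apply pow_le; lra). nra. }
  rewrite Cmod_minus_sym in hN.
  assert (k := Cmod_sub_ge l (sum_n (G := C_AbelianMonoid) a N)). lra.
Qed.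

(** The Cauchy bound on the coefficients belongs to the definition because differentiating the sum
    rests on termwise geometric estimates. *)
Definition power_series_on (b : nat -> C) (r : R) (f : C -> C) : Prop :=
  0 < r /\ (exists M, forall n, Cmod (b n) <= M / r ^ n) /\
  forall z, Cmod z < r -> Cseries (fun n => b n * z ^ n)%C (f z).

Lemma entire_power_series (f : C -> C) (r : R) : entire f -> 0 < r ->
  exists b, power_series_on b r f.
Proof.
  intros hf hr. exists (taylor_coeff f r). repeat split; auto.
  - apply taylor_coeff_bound; auto. intros z. eapply cderiv_ccont_at, entire_cderiv, hf.
  - intros z hz. apply (is_series_taylor f (C_derive f)); auto.
    intros w. now apply entire_cderiv.
Qed.

(** The error satisfies [d_(n+1) = (z + h) d_n + n z^(n-1) h^2]. The crude bound [n <= 2^n] turns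
    [rho] into [2 rho]; the two terms then add up to a purely geometric bound without a polynomial
    factor in [n]. *)
Lemma pow_second_difference (z h : C) (rho : R) (n : nat) : 0 < rho ->
  Cmod z + Cmod h <= rho ->
  Cmod ((z + h) ^ n - z ^ n - INR n * z ^ (pred n) * h)%C <=
  Cmod h * Cmod h * ((2 * rho) ^ n / (rho * rho)).
Proof.
  intros hrho hzh. assert (hh := Cmod_ge_0 h). assert (hz := Cmod_ge_0 z).
  induction n.
  - simpl. replace (1 - 1 - 0 * 1 * h)%C with (RtoC 0) by ring. rewrite Cmod_0.
    apply Rmult_le_pos; [nra|]. apply Rmult_le_pos. lra. apply Rlt_le, Rinv_0_lt_compat; nra.
  - set (d := ((z + h) ^ n - z ^ n - INR n * z ^ (pred n) * h)%C) in *.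
    replace ((z + h) ^ S n - z ^ S n - INR (S n) * z ^ (pred (S n)) * h)%C
      with ((z + h) * d + INR n * z ^ (pred n) * h * h)%C.
    + assert (hP : 0 < (2 * rho) ^ n) by (apply pow_lt; lra).
      eapply Rle_trans. apply Cmod_triangle. rewrite !Cmod_mult, Cmod_R, Cmod_pow.
      rewrite Rabs_right by (apply Rle_ge, pos_INR).
      assert (B : INR n * Cmod z ^ pred n <= (2 * rho) ^ n / rho).
      { destruct n as [|n].
        - simpl. rewrite Rmult_0_l. apply Rmult_le_pos. lra. apply Rlt_le, Rinv_0_lt_compat; easy.
        - simpl pred.
          assert (E1 : INR (S n) <= 2 ^ S n).
          { clear. induction n. simpl; lra. rewrite S_INR. simpl in *. 
            assert (1 <= 2 ^ n) by (apply pow_R1_Rle; lra). lra. }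
          replace ((2 * rho) ^ S n / rho) with (2 ^ S n * rho ^ n)
            by (rewrite Rpow_mult_distr; simpl; field; lra).
          apply Rmult_le_compat; auto. apply pos_INR. now apply pow_le.
          apply pow_incr. lra. }
      apply Rle_trans with (rho * (Cmod h * Cmod h * ((2 * rho) ^ n / (rho * rho))) +
         (2 * rho) ^ n / rho * (Cmod h * Cmod h)).
      * apply Rplus_le_compat.
        -- apply Rmult_le_compat; try apply Cmod_ge_0; auto.
           eapply Rle_trans. apply Cmod_triangle. lra.
        -- rewrite Rmult_assoc. apply Rmult_le_compat_r. nra. exact B.
      * right. simpl. field. lra.
    + unfold d. rewrite S_INR, RtoC_plus. simpl pred.
      destruct n as [|n]; [simpl; ring|]. simpl pred. rewrite !Cpow_S. ring.
Qed.

Definition derived_coeff (b : nat -> C) (n : nat) : C := (INR (S n) * b (S n))%C.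

Lemma derived_coeff_bound (b : nat -> C) (r M : R) : 0 < r ->
  (forall n, Cmod (b n) <= M / r ^ n) ->
  forall n, Cmod (derived_coeff b n) <= (2 * M / r) / (r / 2) ^ n.
Proof.
  intros hr H n. unfold derived_coeff.
  rewrite Cmod_mult, Cmod_R, Rabs_right by (apply Rle_ge, pos_INR).
  assert (hM : 0 <= M).
  { assert (h := H 0%nat). assert (h' := Cmod_ge_0 (b 0%nat)). simpl in h. lra. }
  assert (E1 : INR (S n) <= 2 * 2 ^ n).
  { clear. induction n. simpl; lra. rewrite S_INR. simpl in *.
    assert (1 <= 2 ^ n) by (apply pow_R1_Rle; lra). lra. }
  assert (hrn := pow_lt r n hr).
  apply Rle_trans with ((2 * 2 ^ n) * (M / r ^ S n)).
  - apply Rmult_le_compat; auto. apply pos_INR. apply Cmod_ge_0.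
  - right. unfold Rdiv at 4. rewrite Rpow_mult_distr, pow_inv. simpl.
    assert (2 ^ n <> 0) by (apply pow_nonzero; lra). field. repeat split; lra.
Qed.

(** The second-order errors of the terms are summed with [rho = r / 3]: the ratio is
    [2 rho / r = 2/3], and [|z| < r / 4], [|h| < r / 12] keep [|z| + |h|] below [rho]. The loss of
    radius is harmless, because an entire function can be expanded around any point with any
    radius. *)
Lemma power_series_sum_deriv (b : nat -> C) (r : R) (f : C -> C) (z : C) :
  power_series_on b r f -> Cmod z < r / 4 ->
  exists d, Cseries (fun n => derived_coeff b n * z ^ n)%C d /\ cderiv f z d.
Proof.
  intros [hr [[M HM] Hs]] hz. assert (hz0 := Cmod_ge_0 z).
  assert (HD := derived_coeff_bound b r M hr HM).
  assert (hM : 0 <= M).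
  { assert (h := HM 0%nat). assert (h' := Cmod_ge_0 (b 0%nat)). simpl in h. lra. }
  destruct (Cseries_geom_ex (fun n => derived_coeff b n * z ^ n)%C (2 * M / r) (Cmod z / (r / 2)))
    as [d Hd].
  { split. apply Rdiv_le_0_compat; lra. apply Rlt_div_l; lra. }
  { intros n. rewrite Cmod_mult, Cmod_pow. unfold Rdiv at 2.
    rewrite Rpow_mult_distr, pow_inv.
    replace (2 * M / r * (Cmod z ^ n * / (r / 2) ^ n)) with (2 * M / r / (r / 2) ^ n * Cmod z ^ n)
      by (unfold Rdiv; ring).
    apply Rmult_le_compat_r. now apply pow_le. apply HD. }
  exists d. split; [exact Hd|].
  (* [27 = 9 / (1 - 2/3)], where [9] comes from [rho^2 = r^2 / 9]. *)
  set (K := 27 * M / (r * r)).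
  assert (hK : 0 <= K). { unfold K. apply Rdiv_le_0_compat; nra. }
  assert (hq : forall h, Cmod h < r / 12 ->
    Cmod (f (z + h) - f z - d * h)%C <= K * (Cmod h * Cmod h)).
  { intros h hh. assert (hh0 := Cmod_ge_0 h).
    assert (S1 := Hs (z + h)%C ltac:(eapply Rle_lt_trans; [apply Cmod_triangle | lra])).
    assert (S2 := Hs z ltac:(lra)).
    (* At [n = 0] the convention [pred 0 = 0] does no harm, since the factor [INR 0] vanishes. *)
    assert (S3 : Cseries (fun n => b n * (INR n * z ^ (pred n)))%C (d + b 0%nat * (INR 0 * z ^ 0))%C).
    { apply (Cseries_tail (fun n => b n * (INR n * z ^ (pred n)))%C).
      revert Hd. apply Cseries_ext. intros n. unfold derived_coeff. simpl pred. ring. }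
    assert (S4 := Cseries_minus _ _ _ _ (Cseries_minus _ _ _ _ S1 S2) (Cseries_scal h _ _ S3)).
    replace (f (z + h) - f z - h * (d + b 0%nat * (INR 0 * z ^ 0)))%C
      with (f (z + h) - f z - d * h)%C in S4 by (simpl; ring).
    replace (K * (Cmod h * Cmod h)) with ((9 * M / (r * r) * (Cmod h * Cmod h)) / (1 - 2 / 3))
      by (unfold K; field; lra).
    refine (Cseries_geom_bound _ _ _ (2 / 3) ltac:(lra) _ S4).
    intros n.
    replace (b n * (z + h) ^ n - b n * z ^ n - h * (b n * (INR n * z ^ pred n)))%C
      with (b n * ((z + h) ^ n - z ^ n - INR n * z ^ pred n * h))%C by ring.
    rewrite Cmod_mult.
    assert (B := pow_second_difference z h (r / 3) n ltac:(lra) ltac:(lra)).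
    assert (hrn := pow_lt r n hr).
    apply Rle_trans with (M / r ^ n * (Cmod h * Cmod h * ((2 * (r / 3)) ^ n / (r / 3 * (r / 3))))).
    - apply Rmult_le_compat; try apply Cmod_ge_0; auto.
    - right. replace (2 * (r / 3)) with (2 / 3 * r) by field.
      rewrite (Rpow_mult_distr (2 / 3) r). field. lra. }
  intros eps he.
  exists (Rmin (r / 12) (eps / (1 + K))). split.
  { apply Rmin_pos. lra. apply Rdiv_lt_0_compat; lra. }
  intros h hh. assert (hh0 := Cmod_ge_0 h).
  assert (h1 := Rlt_le_trans _ _ _ hh (Rmin_l _ _)).
  assert (h2 := Rlt_le_trans _ _ _ hh (Rmin_r _ _)).
  apply Rlt_div_r in h2; [|lra].
  eapply Rle_trans. now apply hq. nra.
Qed.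

Lemma power_series_cderiv (b : nat -> C) (r : R) (f f1 : C -> C) :
  power_series_on b r f -> (forall z, Cmod z < r / 4 -> cderiv f z (f1 z)) ->
  power_series_on (derived_coeff b) (r / 4) f1.
Proof.
  intros H Hd. assert (H' := H). destruct H' as [hr [[M HM] _]].
  assert (hM : 0 <= M).
  { assert (h := HM 0%nat). assert (h' := Cmod_ge_0 (b 0%nat)). simpl in h. lra. }
  repeat split. lra.
  - exists (2 * M / r). intros n. eapply Rle_trans. now apply (derived_coeff_bound b r M).
    apply Rmult_le_compat_l. apply Rdiv_le_0_compat; lra.
    apply Rinv_le_contravar. apply pow_lt; lra. apply pow_incr; lra.
  - intros z hz. destruct (power_series_sum_deriv b r f z H hz) as [d [h1 h2]].
    now rewrite (cderiv_unique _ _ _ _ (Hd z hz) h2).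
Qed.

Lemma entire_shift (f : C -> C) (p : C) : entire f -> entire (fun z => f (p + z)%C).
Proof.
  intros H z. exists (C_derive f (p + z)%C). apply cderiv_is_derive, cderiv_shift.
  now apply entire_cderiv.
Qed.

(** Around [p] the derivative is again the sum of a power series, hence differentiable at the
    centre. *)
Lemma entire_derive (f : C -> C) : entire f -> entire (C_derive f).
Proof.
  intros H p.
  destruct (entire_power_series _ 1 (entire_shift f p H) Rlt_0_1) as [b Hb].
  assert (Hd := power_series_cderiv b 1 _ (fun z => C_derive f (p + z)%C) Hb
    (fun z _ => cderiv_shift f p z _ (entire_cderiv f _ H))).
  destruct (power_series_sum_deriv _ _ _ 0 Hd) as [d [_ h]].
  { rewrite Cmod_0. lra. }
  exists d. apply cderiv_is_derive.
  intros eps he. destruct (h eps he) as [dl [hdl Hdl]]. exists dl. split; [easy|].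
  intros k hk. specialize (Hdl k hk).
  replace (p + (0 + k))%C with (p + k)%C in Hdl by ring.
  replace (p + 0)%C with p in Hdl by ring. exact Hdl.
Qed.

Lemma power_series_at_0 (b : nat -> C) (r : R) (f : C -> C) : power_series_on b r f -> f 0 = b 0%nat.
Proof.
  intros [hr [_ H]]. specialize (H 0 ltac:(rewrite Cmod_0; lra)).
  apply (Cseries_unique _ _ _ H).
  apply (Cseries_ext (fun n => match n with 0%nat => b 0%nat | S _ => RtoC 0 end)).
  - intros [|n]. simpl; ring. rewrite Cpow_S. ring.
  - replace (b 0%nat) with (RtoC 0 + b 0%nat)%C at 1 by ring.
    apply (Cseries_tail (fun n => match n with 0%nat => b 0%nat | S _ => RtoC 0 end)).
    apply is_series_C_eps. intros eps he. exists 0%nat. intros n _.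
    replace (sum_n (G := C_AbelianMonoid) (fun _ => RtoC 0) n) with (RtoC 0).
    + replace (0 - 0)%C with (RtoC 0) by ring. now rewrite Cmod_0.
    + induction n. now rewrite sum_O. rewrite sum_Sn, <- IHn. change (RtoC 0 = 0 + 0)%C. ring.
Qed.

Lemma power_series_ccont (b : nat -> C) (r : R) (f : C -> C) : power_series_on b r f -> ccont_at f 0.
Proof.
  intros H. destruct (power_series_sum_deriv b r f 0 H) as [d [_ h]].
  rewrite Cmod_0. destruct H; lra. now apply (cderiv_ccont_at _ _ d).
Qed.

Lemma power_series_div (b : nat -> C) (r : R) (f : C -> C) :
  power_series_on b r f -> b 0%nat = 0 ->
  exists g, power_series_on (fun n => b (S n)) r g /\ forall z, Cmod z < r -> f z = (z * g z)%C.
Proof.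
  intros H h0. assert (H' := H). destruct H' as [hr [[M HM] Hs]].
  (* The value at [0] is the limit of the quotient, so that the shifted series represents the
     quotient there as well. *)
  exists (fun z => if Ceq_dec z 0 then b 1%nat else (f z / z)%C). split.
  - repeat split; auto.
    + exists (M / r). intros n. eapply Rle_trans. apply HM. right. simpl. field.
      assert (hrn := pow_lt r n hr). lra.
    + intros z hz. destruct (Ceq_dec z 0) as [->|hz0].
      * enough (T : Cseries (fun n => b (S n) * 0 ^ n)%C (RtoC 0 + b 1%nat * 0 ^ 0)%C).
        { replace (RtoC 0 + b 1%nat * 0 ^ 0)%C with (b 1%nat) in T by (simpl; ring). exact T. }
        apply (Cseries_tail (fun n => b (S n) * 0 ^ n)%C).
        enough (T : Cseries (fun n => b (S (S n)) * 0 ^ S n)%C (0 * (f 0 - b 0%nat * 0 ^ 0))%C).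
        { replace (0 * (f 0 - b 0%nat * 0 ^ 0))%C with (RtoC 0) in T by ring. exact T. }
        apply (Cseries_ext (fun n => 0 * (b (S n) * 0 ^ S n))%C).
        { intros n. rewrite !Cpow_S. ring. }
        apply Cseries_scal. apply (Cseries_head (fun n => b n * 0 ^ n)%C). now apply Hs.
      * replace (f z / z)%C with (/ z * (f z - b 0%nat * z ^ 0))%C
          by (rewrite h0; field; easy).
        apply (Cseries_ext (fun n => / z * (b (S n) * z ^ S n))%C).
        { intros n. rewrite !Cpow_S. field. easy. }
        apply Cseries_scal. apply (Cseries_head (fun n => b n * z ^ n)%C). now apply Hs.
  - intros z hz. destruct (Ceq_dec z 0) as [->|hz0].
    + rewrite (power_series_at_0 b r f H), h0. ring.
    + field. easy.
Qed.

Lemma power_series_factor (m : nat) (b : nat -> C) (r : R) (f : C -> C) :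
  power_series_on b r f -> (forall k, (k < m)%nat -> b k = 0) ->
  exists g, ccont_at g 0 /\ g 0 = b m /\ forall z, Cmod z < r -> f z = (z ^ m * g z)%C.
Proof.
  revert b f. induction m; intros b f H Hb.
  - exists f. split. now apply (power_series_ccont b r). split. now apply (power_series_at_0 b r).
    intros z _. simpl. ring.
  - destruct (power_series_div b r f H) as [g [Hg Eg]]. apply Hb. lia.
    destruct (IHm (fun n => b (S n)) g Hg) as [k [k1 [k2 k3]]].
    { intros k hk. apply Hb. lia. }
    exists k. split; [easy|]. split; [easy|].
    intros z hz. rewrite Eg, k3, Cpow_S by easy. ring.
Qed.

(** Gives the exact orders of [f - f p] and of [f'] at [p], with continuous cofactors that do not
    vanish at [p]; all order counting below uses this form. The expansion is taken on a disc
    containing a point [z1] with [f z1 <> f p], so some coefficient beyond the constant one is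
    nonzero; this replaces the identity theorem. *)
Lemma entire_local_order (f : C -> C) (p : C) : entire f -> nonconstant f ->
  exists m r g k, 0 < r /\ ccont_at g p /\ g p <> 0 /\ ccont_at k p /\ k p <> 0 /\
   (forall z, Cmod (z - p)%C < r -> f z = (f p + (z - p) ^ (S m) * g z)%C) /\
   (forall z, Cmod (z - p)%C < r -> C_derive f z = ((z - p) ^ m * k z)%C).
Proof.
  intros hf hnc.
  assert (Hex : exists z1, f z1 <> f p).
  { apply NNPP. intros hn. apply hnc. exists (f p). intros z. apply NNPP. intros hz.
    apply hn. now exists z. }
  destruct Hex as [z1 hz1].
  set (R0 := Cmod (z1 - p)%C + 1).
  assert (hR : 0 < R0) by (unfold R0; assert (h := Cmod_ge_0 (z1 - p)%C); lra).
  destruct (entire_power_series _ R0 (entire_shift f p hf) hR) as [b Hb].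
  assert (Hb0 := power_series_at_0 _ _ _ Hb). simpl in Hb0.
  replace (p + 0)%C with p in Hb0 by ring.
  assert (Hm : exists m, b (S m) <> 0 /\ forall k, (k < m)%nat -> b (S k) = 0).
  { assert (He : exists m, b (S m) <> 0).
    { apply NNPP. intros hn. apply hz1.
      destruct Hb as [_ [_ Hs]]. assert (S1 := Hs (z1 - p)%C ltac:(unfold R0; lra)).
      replace (p + (z1 - p))%C with z1 in S1 by ring.
      assert (S2 := Hs 0 ltac:(rewrite Cmod_0; lra)).
      replace (p + 0)%C with p in S2 by ring.
      apply (Cseries_unique _ _ _ S1). revert S2. apply Cseries_ext.
      intros [|n]. simpl; ring.
      replace (b (S n)) with (RtoC 0). ring. symmetry. apply NNPP. intros hx. apply hn. now exists n. }
    destruct He as [m0 hm0]. revert hm0.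
    induction m0 as [m0 IH] using (well_founded_induction Wf_nat.lt_wf). intros hm0.
    destruct (classic (forall k, (k < m0)%nat -> b (S k) = 0)) as [h|h].
    - now exists m0.
    - apply not_all_ex_not in h. destruct h as [k hk].
      apply imply_to_and in hk. destruct hk as [h1 h2]. exact (IH k h1 h2). }
  destruct Hm as [m [hm1 hm2]].
  set (b0 := fun n : nat => match n with 0%nat => RtoC 0 | S _ => b n end).
  assert (Hb' : power_series_on b0 R0 (fun z => f (p + z)%C - f p)%C).
  { destruct Hb as [_ [[M HM] Hs]].
    assert (hM : 0 <= M).
    { assert (h := HM 0%nat). assert (h' := Cmod_ge_0 (b 0%nat)). simpl in h. lra. }
    split; [easy|]. split.
    - exists M. intros [|n]; [|apply HM]. unfold b0. rewrite Cmod_0. simpl. lra.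
    - intros z hz. assert (S1 := Cseries_head _ _ (Hs z hz)).
      replace (f (p + z)%C - f p)%C with ((f (p + z)%C - b 0%nat * z ^ 0) + b0 0%nat * z ^ 0)%C
        by (unfold b0; rewrite <- Hb0; simpl; ring).
      apply (Cseries_tail (fun n => b0 n * z ^ n)%C). exact S1. }
  destruct (power_series_factor (S m) b0 R0 _ Hb') as [g [g1 [g2 g3]]].
  { intros [|k] hk. easy. apply hm2. lia. }
  assert (Hd := power_series_cderiv b R0 _ (fun z => C_derive f (p + z)%C) Hb
    (fun z _ => cderiv_shift f p z _ (entire_cderiv f _ hf))).
  destruct (power_series_factor m (derived_coeff b) (R0 / 4) _ Hd) as [k [k1 [k2 k3]]].
  { intros k hk. unfold derived_coeff. rewrite hm2 by easy. ring. }
  assert (Hshift : forall u, ccont_at u 0 -> ccont_at (fun z => u (z - p)%C) p).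
  { intros u hu eps he. destruct (hu eps he) as [d [hd h]]. exists d. split; [easy|].
    intros w hw. replace (p - p)%C with (RtoC 0) by ring. apply h.
    now replace (w - p - 0)%C with (w - p)%C by ring. }
  exists m, (R0 / 4), (fun z => g (z - p)%C), (fun z => k (z - p)%C).
  replace (p - p)%C with (RtoC 0) by ring.
  split. lra. split. now apply Hshift. split. rewrite g2. exact hm1.
  split. now apply Hshift. split.
  { rewrite k2. unfold derived_coeff. apply Cmult_neq_0; [|easy].
    intros E. apply RtoC_inj in E. now apply (not_0_INR (S m)). }
  split.
  - intros z hz. assert (E := g3 (z - p)%C ltac:(lra)).
    replace (p + (z - p))%C with z in E by ring. rewrite <- E. ring.
  - intros z hz. assert (E := k3 (z - p)%C hz).
    now replace (p + (z - p))%C with z in E by ring.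
Qed.

(** * Laplacians *)

(** The first derivative exists near [0], the second only at [0]: this is stable under sums and
    composition and suffices for the second derivative test. *)
Definition twice_deriv (phi : R -> R) (d1 d2 : R) : Prop :=
  exists phi1 r, 0 < r /\ (forall t, Rabs t < r -> is_derive phi t (phi1 t)) /\
    phi1 0 = d1 /\ is_derive phi1 0 d2.

Lemma twice_deriv_not_max (phi : R -> R) (d1 d2 r : R) :
  twice_deriv phi d1 d2 -> 0 < d2 -> 0 < r -> exists t, Rabs t < r /\ phi 0 < phi t.
Proof.
  intros [phi1 [r1 [hr1 [H [_ H2]]]]] hd hr. apply NNPP. intros hn.
  assert (hle : forall t, Rabs t < r -> phi t <= phi 0).
  { intros t ht. apply Rnot_lt_le. intros hlt. apply hn. now exists t. }
  apply is_derive_Reals in H2. destruct (H2 (d2 / 2) ltac:(lra)) as [dl Hdl].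
  set (e := Rmin (dl / 2) (Rmin (r / 2) (r1 / 2))).
  assert (he : 0 < e /\ e < dl /\ e < r /\ e < r1).
  { assert (h := cond_pos dl). assert (k1 := Rmin_l (dl / 2) (Rmin (r / 2) (r1 / 2))).
    assert (k2 := Rmin_r (dl / 2) (Rmin (r / 2) (r1 / 2))).
    assert (k3 := Rmin_l (r / 2) (r1 / 2)). assert (k4 := Rmin_r (r / 2) (r1 / 2)).
    fold e in k1, k2. repeat split; try lra. unfold e. repeat apply Rmin_pos; lra. }
  assert (hpos : forall t, 0 < t <= e -> 0 < phi1 t - phi1 (- t)).
  { intros t ht.
    assert (A1 := Hdl t ltac:(lra) ltac:(rewrite Rabs_right; lra)).
    assert (A2 := Hdl (- t) ltac:(lra) ltac:(rewrite Rabs_Ropp, Rabs_right; lra)).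
    rewrite Rplus_0_l in A1, A2.
    apply Rabs_def2 in A1. apply Rabs_def2 in A2.
    assert (B1 : d2 / 2 < (phi1 t - phi1 0) / t) by lra.
    assert (B2 : d2 / 2 < (phi1 (- t) - phi1 0) / - t) by lra.
    replace ((phi1 (- t) - phi1 0) / - t) with ((phi1 0 - phi1 (- t)) / t) in B2 by (field; lra).
    apply Rlt_div_r in B1; [|lra]. apply Rlt_div_r in B2; [|lra]. nra. }
  (* The mean value theorem is applied to [phi t + phi (- t)], in which the first-order terms cancel
     whatever [phi1 0] is. *)
  destruct (MVT_cor2 (fun t => phi t + phi (- t)) (fun t => phi1 t - phi1 (- t)) 0 e)
    as [c [Hc1 Hc2]].
  - lra.
  - intros c hc. apply is_derive_Reals.
    assert (X1 := H c ltac:(rewrite Rabs_right; lra)).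
    assert (X2 := H (- c) ltac:(rewrite Rabs_Ropp, Rabs_right; lra)).
    assert (N := @is_derive_opp R_AbsRing R_NormedModule _ c _ (@is_derive_id R_AbsRing c)).
    assert (Y := @is_derive_comp R_AbsRing R_NormedModule phi _ c _ _ X2 N).
    assert (Z := @is_derive_plus R_AbsRing R_NormedModule _ _ c _ _ X1 Y).
    replace (phi1 c - phi1 (- c)) with (phi1 c + (- 1) * phi1 (- c)) by ring.
    exact Z.
  - rewrite Ropp_0 in Hc1.
    assert (L1 := hle e ltac:(rewrite Rabs_right; lra)).
    assert (L2 := hle (- e) ltac:(rewrite Rabs_Ropp, Rabs_right; lra)).
    assert (h := hpos c ltac:(lra)). nra.
Qed.

Lemma twice_deriv_plus (f g : R -> R) (a1 a2 b1 b2 : R) :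
  twice_deriv f a1 a2 -> twice_deriv g b1 b2 ->
  twice_deriv (fun t => f t + g t) (a1 + b1) (a2 + b2).
Proof.
  intros [f1 [r [hr [F1 [F2 F3]]]]] [g1 [s [hs [G1 [G2 G3]]]]].
  exists (fun t => f1 t + g1 t), (Rmin r s). split. now apply Rmin_pos. split; [|split].
  - intros t ht. apply (@is_derive_plus R_AbsRing R_NormedModule).
    + apply F1. eapply Rlt_le_trans; [exact ht | apply Rmin_l].
    + apply G1. eapply Rlt_le_trans; [exact ht | apply Rmin_r].
  - now rewrite F2, G2.
  - now apply (@is_derive_plus R_AbsRing R_NormedModule).
Qed.

Lemma twice_deriv_comp (psi psi1 phi : R -> R) (a1 a2 p2 r : R) : 0 < r ->
  (forall y, Rabs (y - phi 0) < r -> is_derive psi y (psi1 y)) ->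
  is_derive psi1 (phi 0) p2 ->
  twice_deriv phi a1 a2 ->
  twice_deriv (fun t => psi (phi t)) (psi1 (phi 0) * a1) (p2 * (a1 * a1) + psi1 (phi 0) * a2).
Proof.
  intros hr P1 P2 [f1 [s [hs [F1 [F2 F3]]]]].
  assert (F0 := F1 0 ltac:(rewrite Rabs_R0; lra)).
  assert (C0 : continuity_pt phi 0).
  { apply continuity_pt_filterlim, (@ex_derive_continuous R_AbsRing R_NormedModule). now exists (f1 0). }
  destruct (C0 r hr) as [d [hd Hd]].
  assert (Hloc : forall t, Rabs t < d -> Rabs (phi t - phi 0) < r).
  { intros t ht. destruct (Req_dec 0 t) as [<-|hne].
    - now rewrite Rminus_diag, Rabs_R0.
    - apply Hd. split. now split. simpl. unfold Rdist. now rewrite Rminus_0_r. }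
  exists (fun t => psi1 (phi t) * f1 t), (Rmin s d). split. now apply Rmin_pos. split; [|split].
  - intros t ht.
    assert (t1 := Rlt_le_trans _ _ _ ht (Rmin_l _ _)).
    assert (t2 := Rlt_le_trans _ _ _ ht (Rmin_r _ _)).
    rewrite Rmult_comm.
    exact (@is_derive_comp R_AbsRing R_NormedModule psi phi t _ _ (P1 _ (Hloc t t2)) (F1 t t1)).
  - now rewrite F2.
  - assert (X := @is_derive_comp R_AbsRing R_NormedModule psi1 phi 0 _ _ P2 F0).
    assert (Y := @is_derive_mult R_AbsRing _ _ _ _ _ X F3 Rmult_comm).
    rewrite F2 in Y.
    replace (p2 * (a1 * a1) + psi1 (phi 0) * a2) with ((a1 * p2) * a1 + psi1 (phi 0) * a2) by ring.
    exact Y.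
Qed.

(** Second-order data of [u] at [z]: gradient [(ax, ay)] and Laplacian [L]. *)
Definition jet (u : C -> R) (z : C) (ax ay L : R) : Prop :=
  exists dxx dyy, twice_deriv (fun t => u (fst z + t, snd z)) ax dxx /\
    twice_deriv (fun t => u (fst z, snd z + t)) ay dyy /\ dxx + dyy = L.

Lemma jet_plus (u v : C -> R) (z : C) (ax ay L bx bw M : R) :
  jet u z ax ay L -> jet v z bx bw M ->
  jet (fun w => u w + v w) z (ax + bx) (ay + bw) (L + M).
Proof.
  intros [x1 [y1 [h1 [h2 h3]]]] [x2 [y2 [k1 [k2 k3]]]].
  exists (x1 + x2), (y1 + y2). split; [|split].
  - exact (twice_deriv_plus _ _ _ _ _ _ h1 k1).
  - exact (twice_deriv_plus _ _ _ _ _ _ h2 k2).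
  - lra.
Qed.

Lemma jet_comp (psi psi1 : R -> R) (u : C -> R) (z : C) (ax ay L p2 r : R) : 0 < r ->
  (forall y, Rabs (y - u z) < r -> is_derive psi y (psi1 y)) ->
  is_derive psi1 (u z) p2 -> jet u z ax ay L ->
  jet (fun w => psi (u w)) z (psi1 (u z) * ax) (psi1 (u z) * ay)
    (p2 * (ax * ax + ay * ay) + psi1 (u z) * L).
Proof.
  intros hr P1 P2 [x1 [y1 [h1 [h2 h3]]]]. destruct z as [x y]. simpl in *.
  exists (p2 * (ax * ax) + psi1 (u (x, y)) * x1), (p2 * (ay * ay) + psi1 (u (x, y)) * y1).
  split; [|split].
  - assert (X := twice_deriv_comp psi psi1 (fun t => u (x + t, y)) ax x1 p2 r hr).
    simpl in X. rewrite Rplus_0_r in X. now apply X.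
  - assert (X := twice_deriv_comp psi psi1 (fun t => u (x, y + t)) ay y1 p2 r hr).
    simpl in X. rewrite Rplus_0_r in X. now apply X.
  - rewrite <- h3. ring.
Qed.

Lemma jet_scal (c : R) (u : C -> R) (z : C) (ax ay L : R) :
  jet u z ax ay L -> jet (fun w => c * u w) z (c * ax) (c * ay) (c * L).
Proof.
  intros H. assert (X := jet_comp (fun y => c * y) (fun _ => c) u z ax ay L 0 1 Rlt_0_1).
  replace (c * L) with (0 * (ax * ax + ay * ay) + c * L) by ring. apply X; auto.
  - intros y _. auto_derive; [easy | ring].
  - apply (@is_derive_const R_AbsRing R_NormedModule).
Qed.

Lemma jet_ext (u v : C -> R) (z : C) (ax ay L : R) :
  (forall w, u w = v w) -> jet u z ax ay L -> jet v z ax ay L.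
Proof.
  intros E [x1 [y1 [h1 [h2 h3]]]].
  assert (X : forall phi chi a b, (forall t : R, phi t = chi t) ->
    twice_deriv phi a b -> twice_deriv chi a b).
  { intros phi chi a b Ht [p1 [r [hr [P1 P2]]]]. exists p1, r. split; [easy|]. split; [|easy].
    intros t ht. exact (is_derive_ext phi chi t _ Ht (P1 t ht)). }
  exists x1, y1. split; [|split; [|easy]].
  - revert h1. apply X. intros t. apply E.
  - revert h2. apply X. intros t. apply E.
Qed.

(** If the two second derivatives have a positive sum, one of them is positive, and [u] increases
    somewhere along that axis. *)
Lemma jet_not_max (u : C -> R) (z : C) (ax ay L r : R) :
  jet u z ax ay L -> 0 < L -> 0 < r -> exists w, Cmod (w - z)%C < r /\ u z < u w.
Proof.
  intros [x1 [y1 [h1 [h2 h3]]]] hL hr. destruct z as [x y]. simpl in *.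
  destruct (Rlt_le_dec 0 x1) as [hx|hx].
  - destruct (twice_deriv_not_max _ _ _ r h1 hx hr) as [t [ht hu]].
    rewrite Rplus_0_r in hu. exists ((x + t)%R, y). split; [|easy].
    eapply Rle_lt_trans. apply (Cmod_le_abs (x + t - x) (y - y)).
    replace (x + t - x) with t by ring. rewrite Rminus_diag, Rabs_R0. lra.
  - destruct (twice_deriv_not_max _ _ _ r h2 ltac:(lra) hr) as [t [ht hu]].
    rewrite Rplus_0_r in hu. exists (x, (y + t)%R). split; [|easy].
    eapply Rle_lt_trans. apply (Cmod_le_abs (x - x) (y + t - y)).
    replace (y + t - y) with t by ring. rewrite Rminus_diag, Rabs_R0. lra.
Qed.

(** * Second-order data of [|g|^2] and [ln |g|] for holomorphic [g] *)

Definition normsq (z : C) : R := fst z * fst z + snd z * snd z.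

Lemma Cmod_normsq (z : C) : Cmod z = sqrt (normsq z).
Proof. unfold Cmod, normsq. f_equal. simpl. ring. Qed.

Lemma normsq_Cmod (z : C) : normsq z = Cmod z * Cmod z.
Proof.
  rewrite Cmod_normsq, sqrt_sqrt. easy. unfold normsq. nra.
Qed.

(** By the Cauchy-Riemann equations, differentiation in [y] multiplies the complex derivative by
    [i]; the terms with [g2] change sign between the two directions and cancel in the Laplacian. *)
Lemma jet_normsq (g g1 g2 : C -> C) (z : C) :
  (forall w, cderiv g w (g1 w)) -> (forall w, cderiv g1 w (g2 w)) ->
  jet (fun w => normsq (g w)) z
    (2 * (fst (g z) * fst (g1 z) + snd (g z) * snd (g1 z)))
    (2 * (snd (g z) * fst (g1 z) - fst (g z) * snd (g1 z)))
    (4 * normsq (g1 z)).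
Proof.
  intros H1 H2. destruct z as [x y]. unfold normsq; simpl.
  assert (Lx : forall t, rderiv (fun t => ((x + t)%R, y)) t (RtoC 1)).
  { intros t. apply rderiv_of_components; simpl; auto_derive; auto; ring. }
  assert (Ly : forall t, rderiv (fun t => (x, (y + t)%R)) t Ci).
  { intros t. apply rderiv_of_components; simpl; auto_derive; auto; ring. }
  assert (hx : forall (f f1 : C -> C), (forall w, cderiv f w (f1 w)) -> forall t,
    is_derive (fun t => fst (f ((x + t)%R, y))) t (fst (f1 ((x + t)%R, y))) /\
    is_derive (fun t => snd (f ((x + t)%R, y))) t (snd (f1 ((x + t)%R, y)))).
  { intros f f1 Hf t. assert (X := rderiv_comp f _ t _ _ (Hf _) (Lx t)).
    rewrite Cmult_1_r in X. split. apply (rderiv_fst _ _ _ X). apply (rderiv_snd _ _ _ X). }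
  assert (hy : forall (f f1 : C -> C), (forall w, cderiv f w (f1 w)) -> forall t,
    is_derive (fun t => fst (f (x, (y + t)%R))) t (- snd (f1 (x, (y + t)%R))) /\
    is_derive (fun t => snd (f (x, (y + t)%R))) t (fst (f1 (x, (y + t)%R)))).
  { intros f f1 Hf t. assert (X := rderiv_comp f _ t _ _ (Hf _) (Ly t)). simpl in X.
    split.
    - replace (- snd (f1 (x, (y + t)%R))) with (fst (f1 (x, (y + t)%R) * Ci)%C) by (simpl; ring).
      apply (rderiv_fst _ _ _ X).
    - replace (fst (f1 (x, (y + t)%R))) with (snd (f1 (x, (y + t)%R) * Ci)%C) by (simpl; ring).
      apply (rderiv_snd _ _ _ X). }
  assert (Sq : forall (a b a1 b1 a2 b2 : R -> R),
    (forall t, is_derive a t (a1 t)) -> (forall t, is_derive b t (b1 t)) ->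
    (forall t, is_derive a1 t (a2 t)) -> (forall t, is_derive b1 t (b2 t)) ->
    twice_deriv (fun t => a t * a t + b t * b t) (2 * (a 0 * a1 0 + b 0 * b1 0))
      (2 * (a1 0 * a1 0 + b1 0 * b1 0 + a 0 * a2 0 + b 0 * b2 0))).
  { intros a b a1 b1 a2 b2 A1 B1 A2 B2.
    exists (fun t => 2 * (a t * a1 t + b t * b1 t)), 1. split. lra. split; [|split; [easy|]].
    - intros t _.
      replace (2 * (a t * a1 t + b t * b1 t))
        with ((a1 t * a t + a t * a1 t) + (b1 t * b t + b t * b1 t)) by ring.
      apply (@is_derive_plus R_AbsRing R_NormedModule (fun t => a t * a t) (fun t => b t * b t));
      apply (fun f g x df dg X Y => @is_derive_mult R_AbsRing f g x df dg X Y Rmult_comm); auto.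
    - replace (2 * (a1 0 * a1 0 + b1 0 * b1 0 + a 0 * a2 0 + b 0 * b2 0))
        with (2 * ((a1 0 * a1 0 + a 0 * a2 0) + (b1 0 * b1 0 + b 0 * b2 0))) by ring.
      apply (is_derive_scal (fun t => a t * a1 t + b t * b1 t)).
      apply (@is_derive_plus R_AbsRing R_NormedModule (fun t => a t * a1 t) (fun t => b t * b1 t));
      apply (fun f g x df dg X Y => @is_derive_mult R_AbsRing f g x df dg X Y Rmult_comm); auto. }
  assert (X := Sq _ _ _ _ _ _ (fun t => proj1 (hx _ _ H1 t)) (fun t => proj2 (hx _ _ H1 t))
     (fun t => proj1 (hx _ _ H2 t)) (fun t => proj2 (hx _ _ H2 t))).
  assert (Neg : forall (a d : R -> R), (forall t, is_derive a t (d t)) ->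
     forall t, is_derive (fun t => - a t) t (- d t)).
  { intros a d Ha t. apply (@is_derive_opp R_AbsRing R_NormedModule). apply Ha. }
  assert (Y := Sq _ _ _ _ _ _ (fun t => proj1 (hy _ _ H1 t)) (fun t => proj2 (hy _ _ H1 t))
     (Neg _ _ (fun t => proj2 (hy _ _ H2 t))) (fun t => proj1 (hy _ _ H2 t))).
  cbv beta in X, Y. rewrite !Rplus_0_r in X. rewrite !Rplus_0_r in Y.
  do 2 eexists. split; [exact X|]. split.
  - replace (2 * (snd (g (x, y)) * fst (g1 (x, y)) - fst (g (x, y)) * snd (g1 (x, y))))
     with (2 * (fst (g (x, y)) * - snd (g1 (x, y)) + snd (g (x, y)) * fst (g1 (x, y)))) by ring.
    exact Y.
  - simpl. ring.
Qed.

(** [ln |g|] is harmonic. Of its gradient only the squared length is recorded, because that is what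
    [jet_comp] uses in the Laplacian of a function of [ln |g|]. *)
Lemma jet_ln_Cmod (g g1 g2 : C -> C) (z : C) :
  (forall w, cderiv g w (g1 w)) -> (forall w, cderiv g1 w (g2 w)) -> g z <> 0 ->
  exists ax ay, jet (fun w => ln (Cmod (g w))) z ax ay 0 /\
    ax * ax + ay * ay = normsq (g1 z) / normsq (g z).
Proof.
  intros H1 H2 hz.
  assert (hn : 0 < normsq (g z)).
  { rewrite normsq_Cmod. apply Cmod_gt_0 in hz. nra. }
  assert (J := jet_normsq g g1 g2 z H1 H2).
  apply (jet_comp (fun y => ln (sqrt y)) (fun y => / 2 * / y) _ _ _ _ _
    (- / (2 * (normsq (g z) * normsq (g z)))) (normsq (g z)) hn) in J.
  - set (ax := / 2 * / normsq (g z) * _) in J.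
    set (ay := / 2 * / normsq (g z) * (2 * (snd (g z) * fst (g1 z) - fst (g z) * snd (g1 z)))) in J.
    exists ax, ay. split.
    + set (L := _ + _) in J. replace 0 with L.
      * revert J. apply jet_ext. intros w. now rewrite Cmod_normsq.
      * unfold L, normsq. unfold normsq in hn. field. lra.
    + unfold ax, ay, normsq. unfold normsq in hn. field. lra.
  - intros y hy. apply Rabs_def2 in hy.
    assert (hs : 0 < sqrt y) by (apply sqrt_lt_R0; lra).
    auto_derive. split; [lra | split; [easy|easy]].
    rewrite Rmult_1_l, Rinv_mult. replace (/ y) with (/ (sqrt y * sqrt y)) by (rewrite sqrt_sqrt; lra).
    field. lra.
  - auto_derive. lra. field. lra.
Qed.

(** * An Ahlfors-Schwarz argument *)

(** Set to minus infinity outside [D], the function [v] is upper semicontinuous on a closed square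
    and so has a maximum. Quadrisection keeps a square in which the points of [D] match or exceed
    every value of [v]; the limit point lies in [D] and is a maximum. *)
Lemma usc_attains_max (v : C -> R) (D : C -> Prop) (R0 : R) (z0 : C) : D z0 ->
  (forall z, D z -> Cmod z < R0) ->
  (forall z, D z -> forall eps, 0 < eps -> exists r, 0 < r /\
     forall w, Cmod (w - z)%C < r -> D w -> v w <= v z + eps) ->
  (forall z, ~ D z -> forall K, exists r, 0 < r /\
     forall w, Cmod (w - z)%C < r -> D w -> v w <= K) ->
  exists z1, D z1 /\ forall z, D z -> v z <= v z1.
Proof.
  intros h0 hb hc hn.
  assert (hR : 0 < R0). { specialize (hb z0 h0). assert (h := Cmod_ge_0 z0). lra. }
  set (X := fun s => - R0 + s * (2 * R0)).
  set (P := fun s t r : R => forall z, D z -> exists w, D w /\ v z <= v w /\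
     X s <= fst w <= X (s + r) /\ X t <= snd w <= X (t + r)).
  assert (HX : forall a b, a <= b -> X a <= X b) by (intros a b hab; unfold X; nra).
  destruct (quadrisection P) as [s [t [_ [_ Hp]]]].
  - intros s t r hr HP. apply NNPP. intros HN.
    apply not_or_and in HN; destruct HN as [n1 HN].
    apply not_or_and in HN; destruct HN as [n2 HN].
    apply not_or_and in HN; destruct HN as [n3 n4].
    (* A quarter that fails has a witness whose value exceeds all values in that quarter. The
       largest of the four witnesses would exceed all values in the whole square, against [HP]. *)
    assert (W : forall s t r, ~ P s t r -> exists z, D z /\ forall w, D w ->
      X s <= fst w <= X (s + r) -> X t <= snd w <= X (t + r) -> v w < v z).
    { intros s' t' r' Hn. apply not_all_ex_not in Hn. destruct Hn as [z Hz].
      apply imply_to_and in Hz. destruct Hz as [Dz Hz]. exists z. split; [easy|].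
      intros w Dw h1 h2. apply Rnot_le_lt. intros hle. apply Hz. now exists w. }
    destruct (W _ _ _ n1) as [z1 [D1 W1]]. destruct (W _ _ _ n2) as [z2 [D2 W2]].
    destruct (W _ _ _ n3) as [z3 [D3 W3]]. destruct (W _ _ _ n4) as [z4 [D4 W4]].
    assert (Hmax : exists z, D z /\ v z1 <= v z /\ v z2 <= v z /\ v z3 <= v z /\ v z4 <= v z).
    { destruct (Rle_dec (v z1) (v z2)), (Rle_dec (v z3) (v z4)).
      - destruct (Rle_dec (v z2) (v z4)); [exists z4 | exists z2]; repeat split; auto; lra.
      - destruct (Rle_dec (v z2) (v z3)); [exists z3 | exists z2]; repeat split; auto; lra.
      - destruct (Rle_dec (v z1) (v z4)); [exists z4 | exists z1]; repeat split; auto; lra.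
      - destruct (Rle_dec (v z1) (v z3)); [exists z3 | exists z1]; repeat split; auto; lra. }
    destruct Hmax as [z [Dz Hz]]. destruct (HP z Dz) as [w [Dw [hw [hx hy]]]].
    replace (s + r / 2 + r / 2) with (s + r) in * by lra.
    replace (t + r / 2 + r / 2) with (t + r) in * by lra.
    destruct (Rle_dec (fst w) (X (s + r / 2))), (Rle_dec (snd w) (X (t + r / 2))).
    + specialize (W1 w Dw). lra.
    + specialize (W3 w Dw). lra.
    + specialize (W2 w Dw). lra.
    + specialize (W4 w Dw). lra.
  - intros z Dz. exists z. split; [easy|]. split; [lra|].
    specialize (hb z Dz).
    assert (k1 := Rabs_fst_le z). assert (k2 := Rabs_snd_le z).
    apply Rabs_le_between in k1. apply Rabs_le_between in k2. unfold X. lra.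
  - set (p := (X s, X t) : C).
    assert (near : forall r, 0 < r -> forall z, D z ->
      exists w, D w /\ Cmod (w - p)%C < r /\ v z <= v w).
    { intros r hr z Dz. destruct (Hp (r / (4 * R0))) as [s' [t' [e [he [HP [hs ht]]]]]].
      apply Rdiv_lt_0_compat; lra.
      destruct (HP z Dz) as [w [Dw [hw [hx hy]]]]. exists w. split; [easy|]. split; [|easy].
      rewrite (surjective_pairing w).
      eapply Rle_lt_trans. apply (Cmod_le_abs (fst w - X s) (snd w - X t)).
      destruct he as [he1 he2]. apply Rlt_div_r in he2; [|lra].
      assert (A1 : Rabs (fst w - X s) <= e * (2 * R0)).
      { apply Rabs_le. unfold X in *. nra. }
      assert (A2 : Rabs (snd w - X t) <= e * (2 * R0)).
      { apply Rabs_le. unfold X in *. nra. }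
      lra. }
    exists p.
    assert (Dp : D p).
    { apply NNPP. intros hD. destruct (hn p hD (v z0 - 1)) as [r [hr H]].
      destruct (near r hr z0 h0) as [w [Dw [h1 h2]]]. specialize (H w h1 Dw). lra. }
    split; [easy|]. intros z Dz. apply le_epsilon. intros eps he.
    destruct (hc p Dp eps he) as [r [hr H]].
    destruct (near r hr z Dz) as [w [Dw [h1 h2]]]. specialize (H w h1 Dw). lra.
Qed.

Lemma exp_le_compat (x y : R) : x <= y -> exp x <= exp y.
Proof. intros [h| ->]; [left; now apply exp_increasing | lra]. Qed.

(** The minimum covers two regimes, [|f'| > |f|] and [|f'| <= |f|], in which the density has
    different degrees in [f']; [kappa] will be [1 + g]. *)
Definition liouville_ineq (c kappa x L : R) : Prop :=
  c * Rmin (exp (2 * x)) (exp (2 * kappa * x)) <= L.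

(** Comparison with a multiple of [R^2 / (R^2 - |z|^2)] on the disc of radius [R], as [R] grows.
    The minimum of two exponentials costs nothing because this function is at least [1]. *)
Lemma ahlfors_no_solution (u : C -> R) (good : C -> Prop) (c kappa : R) :
  0 < c -> 1 <= kappa ->
  (forall z, good z -> exists r, 0 < r /\ forall w, Cmod (w - z)%C < r -> good w) ->
  (forall z, good z -> forall eps, 0 < eps -> exists r, 0 < r /\
     forall w, Cmod (w - z)%C < r -> Rabs (u w - u z) < eps) ->
  (forall z, ~ good z -> forall K, exists r, 0 < r /\
     forall w, Cmod (w - z)%C < r -> good w -> u w <= K) ->
  (forall z, good z -> exists ax ay L, jet u z ax ay L /\ liouville_ineq c kappa (u z) L) ->
  forall z, ~ good z.
Proof.
  intros hc hk Hopen Hcont Hsing Hjet z0 hz0.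
  set (m := Rmin (exp (2 * (u z0 - ln 2))) (exp (2 * kappa * (u z0 - ln 2)))).
  assert (hm : 0 < m) by (apply Rmin_pos; apply exp_pos).
  assert (hN := Cmod_ge_0 z0). set (N := Cmod z0) in *.
  (* [R0 > 1] and [R0 > 4 / (c m)] give [4 / R0^2 < c m], which the conclusion contradicts.
     [R0 > 2 N] makes [R0^2 - |z0|^2] at least [R0^2 / 2], whence the [ln 2] in [m]. *)
  set (R0 := 1 + 2 * N + 4 / (c * m)).
  assert (hcm : 0 < 4 / (c * m)) by (apply Rdiv_lt_0_compat; nra).
  assert (hR : 1 < R0 /\ 2 * N < R0 /\ 4 / (c * m) < R0) by (unfold R0; lra).
  assert (hRR : 4 / (R0 * R0) < c * m).
  { destruct hR as [r1 [_ r2]]. apply Rlt_div_l in r2; [|nra]. apply Rlt_div_l; [nra|].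
    assert (0 < c * m) by nra. nra. }
  set (b := fun w => ln (R0 * R0 - normsq w)).
  set (v := fun w => u w + b w).
  assert (hin : forall w, Cmod w < R0 -> 0 < R0 * R0 - normsq w).
  { intros w hw. rewrite normsq_Cmod. assert (h := Cmod_ge_0 w). nra. }
  assert (hlip : forall w z, Cmod w < R0 -> Cmod z <= R0 ->
     normsq z - normsq w <= 2 * R0 * Cmod (w - z)%C).
  { intros w z hw hz. rewrite !normsq_Cmod.
    assert (h := Cmod_sub_ge z w). rewrite Cmod_minus_sym in h.
    assert (h1 := Cmod_ge_0 w). assert (h2 := Cmod_ge_0 z). assert (h3 := Cmod_ge_0 (w - z)%C).
    replace (Cmod z * Cmod z - Cmod w * Cmod w) with ((Cmod z + Cmod w) * (Cmod z - Cmod w)) by ring.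
    apply Rle_trans with ((Cmod z + Cmod w) * Cmod (w - z)%C).
    apply Rmult_le_compat_l; lra. apply Rmult_le_compat_r; lra. }
  destruct (usc_attains_max v (fun w => good w /\ Cmod w < R0) R0 z0) as [z1 [[g1 d1] Hmax]].
  - split. easy. fold N. lra.
  - now intros z [_ h].
  - intros z [gz dz] eps he.
    destruct (Hcont z gz (eps / 2) ltac:(lra)) as [r1 [hr1 H1]].
    assert (hz := hin z dz).
    assert (hx : 0 < exp (eps / 2) - 1).
    { assert (h := exp_ineq1 (eps / 2) ltac:(lra)). lra. }
    exists (Rmin r1 ((R0 * R0 - normsq z) * (exp (eps / 2) - 1) / (2 * R0))). split.
    { apply Rmin_pos. easy. apply Rdiv_lt_0_compat; [nra | lra]. }
    intros w hw [_ dw].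
    assert (w1 := Rlt_le_trans _ _ _ hw (Rmin_l _ _)).
    assert (w2 := Rlt_le_trans _ _ _ hw (Rmin_r _ _)).
    specialize (H1 w w1). apply Rabs_def2 in H1.
    apply Rlt_div_r in w2; [|lra].
    assert (hl := hlip w z dw ltac:(lra)).
    assert (hb : b w <= b z + eps / 2).
    { unfold b. rewrite <- (ln_exp (eps / 2)) at 1. rewrite <- ln_mult; [|easy|apply exp_pos].
      apply ln_le. now apply hin. nra. }
    unfold v. lra.
  - intros z hz K.
    (* Beyond the closed disc there are no points of the domain nearby; at a good point of the
       circle [b] tends to minus infinity while [u] is bounded above; at the remaining points [u]
       tends to minus infinity while [b <= 2 ln R0]. *)
    destruct (Rlt_le_dec R0 (Cmod z)) as [hout|hle].
    { exists (Cmod z - R0). split. lra. intros w hw [_ dw].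
      assert (h := Cmod_sub_ge z w). rewrite Cmod_minus_sym in h. lra. }
    assert (hub : forall K', (~ good z \/ u z + 1 <= K') -> exists r, 0 < r /\
       forall w, Cmod (w - z)%C < r -> good w -> u w <= K').
    { intros K' [hg|hK].
      - apply Hsing. easy.
      - destruct (classic (good z)) as [hg|hg]; [|now apply Hsing].
        destruct (Hcont z hg 1 Rlt_0_1) as [r [hr H]]. exists r. split; [easy|].
        intros w hw _. specialize (H w hw). apply Rabs_def2 in H. lra. }
    assert (hbR : forall w, Cmod w < R0 -> b w <= 2 * ln R0).
    { intros w hw. unfold b. replace (2 * ln R0) with (ln (R0 * R0)) by (rewrite ln_mult; lra).
      apply ln_le. now apply hin. assert (h : 0 <= normsq w) by (unfold normsq; nra). lra. }
    destruct (classic (good z)) as [hg|hg].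
    + destruct (hub (u z + 1)) as [r [hr H]]. right; lra.
      assert (hez : Cmod z = R0).
      { apply NNPP. intros hne. apply hz. split; [easy|]. lra. }
      assert (hE := exp_pos (K - (u z + 1))).
      exists (Rmin r (exp (K - (u z + 1)) / (2 * R0))). split.
      { apply Rmin_pos. easy. apply Rdiv_lt_0_compat; lra. }
      intros w hw [gw dw].
      assert (w1 := Rlt_le_trans _ _ _ hw (Rmin_l _ _)).
      assert (w2 := Rlt_le_trans _ _ _ hw (Rmin_r _ _)).
      apply Rlt_div_r in w2; [|lra]. specialize (H w w1 gw).
      assert (hl := hlip w z dw hle). rewrite (normsq_Cmod z), hez in hl.
      assert (hb : b w <= K - (u z + 1)).
      { unfold b. rewrite <- (ln_exp (K - (u z + 1))). apply ln_le. now apply hin. lra. }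
      unfold v. lra.
    + destruct (hub (K - 2 * ln R0)) as [r [hr H]]. now left.
      exists r. split; [easy|]. intros w hw [gw dw]. specialize (H w hw gw).
      specialize (hbR w dw). unfold v. lra.
  - destruct (Hjet z1 g1) as [ax [ay [L [HJ HL]]]]. unfold liouville_ineq in HL.
    set (q := R0 * R0 - normsq z1).
    assert (hq : 0 < q) by now apply hin.
    assert (Jid := jet_normsq (fun w => w) (fun _ => RtoC 1) (fun _ => RtoC 0) z1
      cderiv_id (cderiv_const _)).
    cbv beta in Jid. unfold RtoC in Jid; cbn [fst snd] in Jid.
    apply (jet_comp (fun y => ln (R0 * R0 - y)) (fun y => - / (R0 * R0 - y)) _ _ _ _ _
      (- / (q * q)) q hq) in Jid.
    + assert (JS := jet_plus _ _ _ _ _ _ _ _ _ HJ Jid).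
      (* The Laplacian of [b] at [z1] is [- 4 R0^2 / q^2], and the Laplacian of [v] cannot be
         positive at a maximum. *)
      assert (HLE : L <= 4 * (R0 * R0) / (q * q)).
      { apply Rnot_lt_le. intros hlt.
        destruct (Hopen z1 g1) as [r1 [hr1 H1]].
        destruct (jet_not_max _ _ _ _ _ (Rmin r1 (R0 - Cmod z1)) JS) as [w [hw hgt]].
        - unfold normsq. cbn [fst snd].
          set (x := fst z1) in *. set (y := snd z1) in *.
          assert (Eq : x * x + y * y = R0 * R0 - q) by (unfold q, normsq, x, y; ring).
          rewrite Eq. replace (R0 * R0 - (R0 * R0 - q)) with q by ring.
          match goal with |- 0 < L + ?T => replace T with (- (4 * (R0 * R0) / (q * q))) end. lra.
          replace (R0 * R0) with (x * x + y * y + q) by lra. field. lra.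
        - apply Rmin_pos; lra.
        - assert (w1 := Rlt_le_trans _ _ _ hw (Rmin_l _ _)).
          assert (w2 := Rlt_le_trans _ _ _ hw (Rmin_r _ _)).
          assert (hcw : Cmod w < R0).
          { assert (h := Cmod_sub_ge w z1). lra. }
          specialize (Hmax w (conj (H1 w w1) hcw)).
          unfold v, b in Hmax. lra. }
      (* The logarithm of the comparison function at [z1]. Since [tau >= 0] and [kappa >= 1], adding
         [tau] to the argument multiplies both exponentials by at least [exp (2 tau)]. *)
      set (tau := ln (R0 * R0 / q)).
      assert (hq1 : q <= R0 * R0) by (unfold q; assert (0 <= normsq z1) by (unfold normsq; nra); lra).
      assert (htau : 0 <= tau).
      { unfold tau. rewrite <- ln_1. apply ln_le. lra. apply Rle_div_r; lra. }
      assert (hexp : exp (2 * tau) = (R0 * R0) * (R0 * R0) / (q * q)).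
      { replace (2 * tau) with (tau + tau) by ring. rewrite exp_plus. unfold tau.
        rewrite exp_ln. field. lra. apply Rdiv_lt_0_compat; nra. }
      set (g := u z0 - ln 2) in *.
      assert (hg : g + tau <= u z1).
      { assert (hz0R : Cmod z0 < R0) by (fold N; lra).
        assert (H0 := Hmax z0 (conj hz0 hz0R)). unfold v, b in H0.
        fold q in H0. unfold g, tau. rewrite ln_div by nra.
        assert (Hh : ln (R0 * R0) - ln 2 <= ln (R0 * R0 - normsq z0)).
        { rewrite <- ln_div by nra. apply ln_le. nra. rewrite normsq_Cmod. fold N. nra. }
        lra. }
      assert (hmin : exp (2 * tau) * m <= Rmin (exp (2 * u z1)) (exp (2 * kappa * u z1))).
      { assert (ht := exp_pos (2 * tau)). apply Rmin_glb.
        - apply Rle_trans with (exp (2 * tau) * exp (2 * g)).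
          apply Rmult_le_compat_l. lra. apply Rmin_l.
          rewrite <- exp_plus. apply exp_le_compat. lra.
        - apply Rle_trans with (exp (2 * tau) * exp (2 * kappa * g)).
          apply Rmult_le_compat_l. lra. apply Rmin_r.
          rewrite <- exp_plus. apply exp_le_compat.
          apply Rle_trans with (2 * kappa * (g + tau)); [|apply Rmult_le_compat_l; lra].
          assert (tau <= kappa * tau) by nra. lra. }
      assert (F1 : c * (exp (2 * tau) * m) <= 4 * (R0 * R0) / (q * q)).
      { eapply Rle_trans; [|exact HLE]. eapply Rle_trans; [|exact HL].
        apply Rmult_le_compat_l; lra. }
      rewrite hexp in F1.
      replace (c * (R0 * R0 * (R0 * R0) / (q * q) * m)) with ((c * m) * ((R0 * R0) * (R0 * R0) / (q * q))) in F1
        by (unfold Rdiv; ring).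
      replace (4 * (R0 * R0) / (q * q)) with ((4 / (R0 * R0)) * ((R0 * R0) * (R0 * R0) / (q * q))) in F1
        by (field; lra).
      apply Rmult_le_reg_r in F1. lra. apply Rdiv_lt_0_compat; repeat apply Rmult_lt_0_compat; lra.
    + intros y hy. apply Rabs_def2 in hy. fold (normsq z1) in hy.
      assert (0 < R0 * R0 - y) by (unfold q in hy; lra).
      auto_derive. easy. field. lra.
    + unfold q. auto_derive.
      * unfold q in hq. unfold normsq in *. lra.
      * unfold q in hq. unfold normsq in *. field. lra.
Qed.

(** * The density *)

(** At [l = ln |f|] this is [ln (1 + |f|^p)] with [p = 1/25]. The two such terms, with weight [1/4],
    grow like [ln |f| / 50] for large [|f|], which stays below the margin [A + B - 1 = 7/100]. *)
Definition softplus (l : R) : R := ln (1 + exp (l / 25)).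

Definition softplus1 (l : R) : R := / 25 * (exp (l / 25) / (1 + exp (l / 25))).

Definition softplus2 (l : R) : R := / 625 * (exp (l / 25) / (1 + exp (l / 25)) ^ 2).

Lemma is_derive_softplus (l : R) : is_derive softplus l (softplus1 l).
Proof.
  unfold softplus, softplus1. assert (h := exp_pos (l / 25)).
  auto_derive. lra. unfold Rdiv. field. unfold Rdiv in h. lra.
Qed.

Lemma is_derive_softplus1 (l : R) : is_derive softplus1 l (softplus2 l).
Proof.
  unfold softplus1, softplus2. assert (h := exp_pos (l / 25)).
  auto_derive. lra. unfold Rdiv. field. unfold Rdiv in h. lra.
Qed.

Lemma exp_1_ge_2 : 2 <= exp 1.
Proof. assert (h := exp_ineq1_le 1). lra. Qed.

Lemma softplus_le (l : R) : softplus l <= 1 + Rmax 0 l / 25.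
Proof.
  unfold softplus. rewrite <- (ln_exp (1 + Rmax 0 l / 25)). apply ln_le.
  assert (h := exp_pos (l / 25)). lra.
  rewrite exp_plus. assert (h1 := exp_1_ge_2).
  assert (h2 : 1 <= exp (Rmax 0 l / 25)).
  { rewrite <- exp_0. apply exp_le_compat. assert (h := Rmax_l 0 l). lra. }
  assert (h3 : exp (l / 25) <= exp (Rmax 0 l / 25)).
  { apply exp_le_compat. assert (h := Rmax_r 0 l). lra. }
  nra.
Qed.

(** With [e = exp (l / 25)], the quotient [e / (1 + e)^2] is even in [l], and [1 + e] is at most
    twice the larger of [1] and [e]. *)
Lemma softplus2_ge (l : R) : / 2500 * exp (- (Rabs l / 25)) <= softplus2 l.
Proof.
  unfold softplus2. assert (h := exp_pos (l / 25)). set (e := exp (l / 25)) in *.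
  replace (/ 2500 * exp (- (Rabs l / 25))) with (/ 625 * (exp (- (Rabs l / 25)) / 4)) by field.
  apply Rmult_le_compat_l. lra.
  unfold Rabs. destruct (Rcase_abs l) as [hl|hl].
  - replace (- (- l / 25)) with (l / 25) by field. fold e.
    assert (e <= 1). { unfold e. rewrite <- exp_0. apply exp_le_compat. lra. }
    assert ((1 + e) ^ 2 <= 4) by nra.
    apply Rmult_le_compat_l. lra. apply Rinv_le_contravar; [nra | easy].
  - rewrite exp_Ropp. fold e.
    assert (1 <= e). { unfold e. rewrite <- exp_0. apply exp_le_compat. lra. }
    assert (0 < (1 + e) ^ 2) by nra.
    apply Rmult_le_reg_r with (4 * e * (1 + e) ^ 2). nra.
    replace (/ e / 4 * (4 * e * (1 + e) ^ 2)) with ((1 + e) ^ 2) by (field; lra).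
    replace (e / (1 + e) ^ 2 * (4 * e * (1 + e) ^ 2)) with (4 * e * e) by (field; lra). nra.
Qed.

(** Here [d = ln |f'|], [s = ln |f' - f|], [l = ln |f|], [k = ln |f - 1|]. With
    [A = 44/100], [B = 63/100], [g = 13/20], the coefficients are [1], [g], [-(A + g)], [-B].
    They satisfy [3 (1 - A) > 1 + g], [B < 2/3] and [B < g], which makes the density vanish at zeros,
    multiple [1]-points and simple [1]-points, and [A + B > 1], which bounds it by the curvature
    as [|f|] tends to infinity. *)
Definition potential (d s l k : R) : R :=
  d + 13 / 20 * s - 109 / 100 * l - 63 / 100 * k + / 4 * (softplus l + softplus k).

(** The Laplacian of [20/33 * potential]: the logarithms are harmonic, [5/33 = 20/33 * 1/4], and
    [exp (2 * (d - l))] is [|f' / f|^2], the squared gradient of [ln |f|]. *)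
Definition curvature (d l k : R) : R :=
  5 / 33 * (softplus2 l * exp (2 * (d - l)) + softplus2 k * exp (2 * (d - k))).

(** The bound on [s] reflects [|f' - f| <= |f'| + |f|]. Where [|f'| > |f|] it gives the potential
    degree [1 + g = 33/20] in [f'], normalized by [20/33]; elsewhere the degree is [1]. The three
    regions are a neighbourhood of the zeros of [f], one of the [1]-points, and the rest, where
    [|f|] and [|f - 1|] are comparable. The gain [|l| / 50], doubled in the exponent, pays for the
    decay [exp (- |l| / 25)] of [softplus2]. *)
Lemma potential_cases (d s l k : R) :
  s <= l + 1 + Rmax 0 (d - l) ->
  (l <= 0 /\ -1 <= k <= 1) \/ (k <= 0 /\ -1 <= l <= 1) \/
    (-1 <= l /\ -1 <= k /\ l - 2 <= k <= l + 2) ->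
  (20 / 33 * potential d s l k <= 10 + (d - l) - Rabs l / 50 \/
   20 / 33 * potential d s l k <= 10 + (d - k) - Rabs k / 50) \/
  (potential d s l k <= 10 + (d - l) - Rabs l / 50 \/
   potential d s l k <= 10 + (d - k) - Rabs k / 50).
Proof.
  intros hs H. unfold potential.
  assert (h1 := softplus_le l). assert (h2 := softplus_le k).
  destruct (Rle_lt_dec (d - l) 0) as [hd|hd];
    [rewrite (Rmax_left 0 (d - l)) in hs by lra; right
    |rewrite (Rmax_right 0 (d - l)) in hs by lra; left];
  (destruct H as [H|[H|H]];
    [left; rewrite (Rmax_left 0 l) in h1 by lra
    |right; rewrite (Rmax_left 0 k) in h2 by lra
    |left]);
  unfold Rmax in h1, h2; repeat destruct (Rle_dec _ _);
  unfold Rabs; destruct (Rcase_abs _); lra.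
Qed.

(** In the constant, [5/33] is the weight in [curvature], [/ 2500] comes from [softplus2_ge], and
    [20] is twice the slack [10] of [potential_cases]. *)
Lemma liouville_curvature (d s l k : R) :
  s <= l + 1 + Rmax 0 (d - l) ->
  (l <= 0 /\ -1 <= k <= 1) \/ (k <= 0 /\ -1 <= l <= 1) \/
    (-1 <= l /\ -1 <= k /\ l - 2 <= k <= l + 2) ->
  liouville_ineq (5 / 33 * / 2500 * exp (- 20)) (33 / 20) (20 / 33 * potential d s l k)
    (curvature d l k).
Proof.
  intros hs H. unfold liouville_ineq.
  assert (P := potential_cases d s l k hs H). set (U := potential d s l k) in *.
  assert (Hle : forall x e, 2 * x <= 20 + 2 * (d - e) - Rabs e / 25 ->
     / 2500 * exp (- 20) * exp (2 * x) <= softplus2 e * exp (2 * (d - e))).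
  { intros x e hx. apply Rle_trans with (/ 2500 * exp (- (Rabs e / 25)) * exp (2 * (d - e))).
    - rewrite !Rmult_assoc, <- !exp_plus. apply Rmult_le_compat_l. lra.
      apply exp_le_compat. lra.
    - apply Rmult_le_compat_r. apply Rlt_le, exp_pos. apply softplus2_ge. }
  assert (Hpos : forall e, 0 <= softplus2 e * exp (2 * (d - e))).
  { intros e. apply Rmult_le_pos; [|apply Rlt_le, exp_pos].
    eapply Rle_trans; [|apply softplus2_ge]. apply Rmult_le_pos. lra. apply Rlt_le, exp_pos. }
  assert (hl := Hpos l). assert (hk := Hpos k). unfold curvature.
  assert (hc : 0 < / 2500 * exp (- 20)) by (apply Rmult_lt_0_compat; [lra | apply exp_pos]).
  rewrite !Rmult_assoc. apply Rmult_le_compat_l. lra. rewrite <- Rmult_assoc.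
  replace (2 * (33 / 20 * (20 / 33 * U))) with (2 * U) by field.
  destruct P as [[P|P]|[P|P]].
  - apply Rle_trans with (/ 2500 * exp (- 20) * exp (2 * (20 / 33 * U))).
    apply Rmult_le_compat_l. lra. apply Rmin_l. specialize (Hle (20 / 33 * U) l ltac:(lra)). lra.
  - apply Rle_trans with (/ 2500 * exp (- 20) * exp (2 * (20 / 33 * U))).
    apply Rmult_le_compat_l. lra. apply Rmin_l. specialize (Hle (20 / 33 * U) k ltac:(lra)). lra.
  - apply Rle_trans with (/ 2500 * exp (- 20) * exp (2 * U)).
    apply Rmult_le_compat_l. lra. apply Rmin_r. specialize (Hle U l ltac:(lra)). lra.
  - apply Rle_trans with (/ 2500 * exp (- 20) * exp (2 * U)).
    apply Rmult_le_compat_l. lra. apply Rmin_r. specialize (Hle U k ltac:(lra)). lra.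
Qed.

Lemma ln_le_of_le_exp (x y : R) : 0 < x -> x <= exp y -> ln x <= y.
Proof. intros hx h. rewrite <- (ln_exp y). now apply ln_le. Qed.

Lemma ln_ge_of_exp_le (x y : R) : exp y <= x -> y <= ln x.
Proof. intros h. rewrite <- (ln_exp y). apply ln_le. apply exp_pos. easy. Qed.

(** Meant for [x = |f|] and [y = |f - 1|]. If one of them is at most [1/2], the other lies between
    [1/2] and [3/2]; if both exceed [1/2], their ratio is at most [3], which is below [exp 2]. *)
Lemma ln_pair_regions (x y : R) : 0 < x -> 0 < y -> x <= y + 1 -> y <= x + 1 -> 1 <= x + y ->
  (ln x <= 0 /\ -1 <= ln y <= 1) \/ (ln y <= 0 /\ -1 <= ln x <= 1) \/
    (-1 <= ln x /\ -1 <= ln y /\ ln x - 2 <= ln y <= ln x + 2).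
Proof.
  intros hx hy h1 h2 h3.
  assert (he := exp_1_ge_2).
  assert (hei : exp (-1) <= / 2).
  { replace (-1) with (- (1)) by ring. rewrite exp_Ropp. apply Rinv_le_contravar; lra. }
  assert (he2 : 3 <= exp 2).
  { replace 2 with (1 + 1) by ring. rewrite exp_plus. nra. }
  assert (Hsh : forall a b, 0 < a -> 0 < b -> b <= 3 * a -> ln b <= ln a + 2).
  { intros a b ha hb hab. rewrite <- (ln_exp 2), <- ln_mult by (easy || apply exp_pos).
    apply ln_le. easy. nra. }
  destruct (Rle_lt_dec x (/ 2)) as [hx2|hx2]; [left|right; destruct (Rle_lt_dec y (/ 2)) as [hy2|hy2]; [left|right]].
  - split. rewrite <- ln_1. apply ln_le; lra.
    split. apply ln_ge_of_exp_le; lra. apply ln_le_of_le_exp; lra.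
  - split. rewrite <- ln_1. apply ln_le; lra.
    split. apply ln_ge_of_exp_le; lra. apply ln_le_of_le_exp; lra.
  - split. apply ln_ge_of_exp_le; lra. split. apply ln_ge_of_exp_le; lra.
    split. assert (h := Hsh y x hy hx ltac:(lra)). lra. apply Hsh; lra.
Qed.

Definition good (f f1 : C -> C) (z : C) : Prop :=
  f z <> 0 /\ f z <> 1 /\ f1 z <> 0 /\ f1 z <> f z.

(** The factor [20/33 = 1 / (1 + g)] gives the density degree one in [f'] where [f'] dominates
    [f]. *)
Definition log_density (f f1 : C -> C) (z : C) : R :=
  20 / 33 * potential (ln (Cmod (f1 z))) (ln (Cmod (f1 z - f z)%C))
    (ln (Cmod (f z))) (ln (Cmod (f z - 1)%C)).

Lemma exp_2_ln_ratio (x y : R) : 0 < x -> 0 < y -> exp (2 * (ln x - ln y)) = (x * x) / (y * y).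
Proof.
  intros hx hy. replace (2 * (ln x - ln y)) with (ln x + ln x - (ln y + ln y)) by ring.
  unfold Rminus. rewrite exp_plus, exp_Ropp, !exp_plus, !exp_ln by easy. field. lra.
Qed.

(** The third derivative enters because the jets of [ln |f1|] and [ln |f1 - f|] ask for two
    derivatives of [f1]. *)
Lemma jet_log_density (f f1 f2 f3 : C -> C) (z : C) :
  (forall w, cderiv f w (f1 w)) -> (forall w, cderiv f1 w (f2 w)) ->
  (forall w, cderiv f2 w (f3 w)) -> good f f1 z ->
  exists ax ay, jet (log_density f f1) z ax ay
    (curvature (ln (Cmod (f1 z))) (ln (Cmod (f z))) (ln (Cmod (f z - 1)%C))).
Proof.
  intros H1 H2 H3 [g0 [g1 [g2 g3]]].
  assert (H1' : forall w, cderiv (fun w => f w - 1)%C w (f1 w)).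
  { intros w. replace (f1 w) with (f1 w - 0)%C by ring. apply cderiv_minus. apply H1. apply cderiv_const. }
  destruct (jet_ln_Cmod f f1 f2 z H1 H2 g0) as [lx [ly [Jl El]]].
  destruct (jet_ln_Cmod _ f1 f2 z H1' H2) as [kx [ky [Jk Ek]]]. { now apply Cminus_eq_contra. }
  destruct (jet_ln_Cmod f1 f2 f3 z H2 H3 g2) as [dx [dy [Jd _]]].
  destruct (jet_ln_Cmod (fun w => f1 w - f w)%C (fun w => f2 w - f1 w)%C (fun w => f3 w - f2 w)%C z)
    as [sx [sy [Js _]]].
  { intros w. apply (cderiv_minus f1 f); auto. }
  { intros w. apply (cderiv_minus f2 f1); auto. }
  { now apply Cminus_eq_contra. }
  assert (Pl := jet_comp softplus softplus1 _ _ _ _ _ _ 1 Rlt_0_1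
    (fun y _ => is_derive_softplus y) (is_derive_softplus1 _) Jl).
  assert (Pk := jet_comp softplus softplus1 _ _ _ _ _ _ 1 Rlt_0_1
    (fun y _ => is_derive_softplus y) (is_derive_softplus1 _) Jk).
  assert (J := jet_scal (20 / 33) _ _ _ _ _
    (jet_plus _ _ _ _ _ _ _ _ _ (jet_plus _ _ _ _ _ _ _ _ _ (jet_plus _ _ _ _ _ _ _ _ _
     (jet_plus _ _ _ _ _ _ _ _ _ Jd (jet_scal (13 / 20) _ _ _ _ _ Js))
      (jet_scal (- (109 / 100)) _ _ _ _ _ Jl)) (jet_scal (- (63 / 100)) _ _ _ _ _ Jk))
      (jet_scal (/ 4) _ _ _ _ _ (jet_plus _ _ _ _ _ _ _ _ _ Pl Pk)))).
  rewrite El, Ek in J.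
  match type of J with jet _ _ ?a ?b ?l => exists a, b; assert (EL : l =
    curvature (ln (Cmod (f1 z))) (ln (Cmod (f z))) (ln (Cmod (f z - 1)%C))) end.
  - unfold curvature. rewrite !exp_2_ln_ratio, !normsq_Cmod
      by (apply Cmod_gt_0; try apply Cminus_eq_contra; easy). lra.
  - rewrite EL in J. revert J. apply jet_ext.
    intros w. unfold log_density, potential. lra.
Qed.

Lemma log_density_liouville (f f1 : C -> C) (z : C) : good f f1 z ->
  liouville_ineq (5 / 33 * / 2500 * exp (- 20)) (33 / 20) (log_density f f1 z)
    (curvature (ln (Cmod (f1 z))) (ln (Cmod (f z))) (ln (Cmod (f z - 1)%C))).
Proof.
  intros [g0 [g1 [g2 g3]]]. apply Cmod_gt_0 in g0. apply Cmod_minus_gt_0 in g1.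
  apply Cmod_gt_0 in g2. apply Cmod_minus_gt_0 in g3.
  apply liouville_curvature.
  - set (x := Cmod (f z)) in *. set (e := Cmod (f1 z)) in *.
    assert (h := Cmod_sub_le (f1 z) (f z)). fold x e in h.
    (* [|f' - f|] is at most twice the larger of [|f|] and [|f'|]; enlarging [2] to [exp 1] makes
       the logarithm [1] plus a maximum. *)
    apply Rle_trans with (ln (exp 1 * exp (Rmax (ln x) (ln e)))).
    + apply ln_le. easy.
      assert (h1 : x <= exp (Rmax (ln x) (ln e))).
      { rewrite <- (exp_ln x) at 1 by easy. apply exp_le_compat, Rmax_l. }
      assert (h2 : e <= exp (Rmax (ln x) (ln e))).
      { rewrite <- (exp_ln e) at 1 by easy. apply exp_le_compat, Rmax_r. }
      assert (h3 := exp_1_ge_2). nra.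
    + rewrite ln_mult, !ln_exp by apply exp_pos.
      unfold Rmax. repeat destruct (Rle_dec _ _); lra.
  - assert (h1 := Cmod_triangle (f z - 1) 1). replace (f z - 1 + 1)%C with (f z) in h1 by ring.
    assert (h2 := Cmod_sub_le (f z) 1).
    assert (h3 := Cmod_sub_le (f z) (f z - 1)). replace (f z - (f z - 1))%C with (RtoC 1) in h3 by ring.
    rewrite Cmod_1 in *. apply ln_pair_regions; lra.
Qed.

(** * Singularities of the density *)

Definition nearby (p : C) (P : C -> Prop) : Prop :=
  exists r, 0 < r /\ forall w, Cmod (w - p)%C < r -> P w.

Lemma nearby_and (p : C) (P Q : C -> Prop) :
  nearby p P -> nearby p Q -> nearby p (fun w => P w /\ Q w).
Proof.
  intros [r [hr H]] [s [hs K]]. exists (Rmin r s). split. now apply Rmin_pos.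
  intros w hw. split.
  - apply H. eapply Rlt_le_trans; [exact hw | apply Rmin_l].
  - apply K. eapply Rlt_le_trans; [exact hw | apply Rmin_r].
Qed.

Lemma nearby_imp (p : C) (P Q : C -> Prop) :
  (forall w, P w -> Q w) -> nearby p P -> nearby p Q.
Proof. intros h [r [hr H]]. exists r. split; auto. Qed.

Lemma nearby_ball (p : C) (r : R) : 0 < r -> nearby p (fun w => Cmod (w - p)%C < r).
Proof. intros hr. now exists r. Qed.

Lemma nearby_ln_bounded (g : C -> C) (p : C) : ccont_at g p -> g p <> 0 ->
  exists M, 0 <= M /\ nearby p (fun w => g w <> 0 /\ - M <= ln (Cmod (g w)) <= M).
Proof.
  intros hc hp. apply Cmod_gt_0 in hp. set (x := Cmod (g p)) in *.
  exists (Rabs (ln (x / 2)) + Rabs (ln (2 * x))).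
  assert (h1 := Rabs_pos (ln (x / 2))). assert (h2 := Rabs_pos (ln (2 * x))). split. lra.
  destruct (hc (x / 2) ltac:(lra)) as [r [hr H]]. exists r. split; [easy|].
  intros w hw. specialize (H w hw).
  assert (k1 := Cmod_sub_ge (g w) (g p)). assert (k2 := Cmod_sub_ge (g p) (g w)).
  rewrite Cmod_minus_sym in k2. fold x in k1, k2.
  split. apply Cmod_gt_0. lra.
  assert (b1 : ln (x / 2) <= ln (Cmod (g w))) by (apply ln_le; lra).
  assert (b2 : ln (Cmod (g w)) <= ln (2 * x)) by (apply ln_le; lra).
  assert (a1 := Rle_abs (- ln (x / 2))). rewrite Rabs_Ropp in a1.
  assert (a2 := Rle_abs (ln (2 * x))). lra.
Qed.

Lemma nearby_nonzero (g : C -> C) (p : C) : ccont_at g p -> g p <> 0 -> nearby p (fun w => g w <> 0).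
Proof.
  intros hc hp. destruct (nearby_ln_bounded g p hc hp) as [M [_ H]].
  revert H. apply nearby_imp. tauto.
Qed.

Lemma ln_le_self (x : R) : 0 < x -> ln x <= x.
Proof.
  intros hx. apply ln_le_of_le_exp; [easy|]. assert (h := exp_ineq1_le x). lra.
Qed.

Lemma nearby_ln_upper (g : C -> C) (p : C) : ccont_at g p ->
  exists M, 0 <= M /\ nearby p (fun w => g w <> 0 -> ln (Cmod (g w)) <= M).
Proof.
  intros hc. exists (Cmod (g p) + 1). assert (h := Cmod_ge_0 (g p)). split. lra.
  destruct (hc 1 Rlt_0_1) as [r [hr H]]. exists r. split; [easy|].
  intros w hw hg. specialize (H w hw). apply Cmod_gt_0 in hg.
  assert (k := Cmod_sub_ge (g w) (g p)). assert (k2 := ln_le_self _ hg). lra.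
Qed.

Lemma nearby_ln_zero (g : C -> C) (p d : C) : cderiv g p d -> g p = 0 ->
  exists M, 0 <= M /\ nearby p (fun w => g w <> 0 -> ln (Cmod (g w)) <= ln (Cmod (w - p)%C) + M).
Proof.
  intros hd h0. assert (hd0 := Cmod_ge_0 d).
  exists (ln (1 + Cmod d)). split. { rewrite <- ln_1. apply ln_le; lra. }
  destruct (hd 1 Rlt_0_1) as [r [hr H]]. exists r. split; [easy|].
  intros w hw hg. specialize (H _ hw).
  replace (p + (w - p))%C with w in H by ring. rewrite h0 in H.
  assert (hwp : 0 < Cmod (w - p)%C).
  { apply Cmod_minus_gt_0. intros ->. now apply hg. }
  rewrite <- ln_mult by lra. apply ln_le. now apply Cmod_gt_0.
  replace (g w) with ((g w - 0 - d * (w - p)) + d * (w - p))%C by ring.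
  eapply Rle_trans. apply Cmod_triangle. rewrite Cmod_mult. lra.
Qed.

Lemma softplus_bound (l M : R) : l <= M -> 0 <= M -> softplus l <= 1 + M.
Proof.
  intros h1 h2. eapply Rle_trans. apply softplus_le. unfold Rmax. destruct (Rle_dec 0 l); lra.
Qed.

Lemma ln_Cmod_pow_mult (z g : C) (n : nat) : z <> 0 -> g <> 0 ->
  ln (Cmod (z ^ n * g)%C) = INR n * ln (Cmod z) + ln (Cmod g).
Proof.
  intros hz hg. apply Cmod_gt_0 in hz. apply Cmod_gt_0 in hg.
  rewrite Cmod_mult, Cmod_pow, ln_mult, ln_pow by (try apply pow_lt; easy). easy.
Qed.

(** [m = 0] would give [f1 p = k p] and [m = 1] would give [d = k p], but [k p] is not zero. *)
Lemma order_ge_2 (f1 k : C -> C) (p d : C) (m : nat) :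
  nearby p (fun w => f1 w = ((w - p) ^ m * k w)%C) -> ccont_at k p -> k p <> 0 ->
  cderiv f1 p d -> f1 p = 0 -> d = 0 -> (2 <= m)%nat.
Proof.
  intros [r [hr H]] hk hkp hd h0 hd0.
  destruct m as [|[|m]]; [exfalso|exfalso|lia].
  - apply hkp. rewrite <- h0, H. simpl. ring.
    replace (p - p)%C with (RtoC 0) by ring. now rewrite Cmod_0.
  - apply hkp. rewrite <- hd0. apply (cderiv_unique f1 p); [|easy].
    intros eps he. destruct (hk eps he) as [r2 [hr2 H2]].
    exists (Rmin r r2). split. now apply Rmin_pos. intros h hh.
    rewrite h0, H.
    + replace (p + h - p)%C with h by ring.
      replace (h ^ 1 * k (p + h) - 0 - k p * h)%C with ((k (p + h) - k p) * h)%C by (simpl; ring).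
      rewrite Cmod_mult. apply Rmult_le_compat_r. apply Cmod_ge_0. apply Rlt_le, H2.
      replace (p + h - p)%C with h by ring.
      eapply Rlt_le_trans; [exact hh | apply Rmin_r].
    + replace (p + h - p)%C with h by ring.
      eapply Rlt_le_trans; [exact hh | apply Rmin_l].
Qed.

(** The potential without its [softplus] terms, which are bounded above near every point. The
    coefficient [1/50] in the bounds below is [g - B], the least order of vanishing guaranteed among
    all cases; it comes from the simple [1]-points. *)
Definition log_weight (f f1 : C -> C) (w : C) : R :=
  ln (Cmod (f1 w)) + 13 / 20 * ln (Cmod (f1 w - f w)%C)
  - 109 / 100 * ln (Cmod (f w)) - 63 / 100 * ln (Cmod (f w - 1)%C).

Lemma good_nonzero (f f1 : C -> C) (w : C) : good f f1 w ->
  f w <> 0 /\ (f w - 1)%C <> 0 /\ f1 w <> 0 /\ (f1 w - f w)%C <> 0.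
Proof.
  intros [x0 [x1 [x2 x3]]]. repeat split; auto; now apply Cminus_eq_contra.
Qed.

Lemma nearby_ln_neg (f f1 : C -> C) (p : C) : ~ good f f1 p ->
  nearby p (fun w => good f f1 w -> (w - p)%C <> 0 /\ ln (Cmod (w - p)%C) <= 0).
Proof.
  intros hbad. exists 1. split. lra. intros w hw hg.
  assert (hne : w <> p) by (intros ->; now apply hbad).
  split. now apply Cminus_eq_contra. rewrite <- ln_1. apply ln_le; [|lra].
  now apply Cmod_minus_gt_0.
Qed.

Lemma Cminus_1_nonzero : (0 - 1)%C <> 0.
Proof. apply Cminus_eq_contra. intros E. symmetry in E. now apply C1_nz. Qed.

(** Here [f], [f'] and [f' - f] vanish to orders [m + 1], [m] and at least [m], so the density
    before normalization has order at least [m (1 - A) - (A + g) = 56/100 m - 109/100]. This is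
    [3/100] at [m = 2] and increases with [m]. *)
Lemma log_weight_at_zero (f f1 g k : C -> C) (p : C) (m : nat) : ~ good f f1 p ->
  (2 <= m)%nat -> f p = 0 -> ccont_at f p ->
  ccont_at g p -> g p <> 0 -> ccont_at k p -> k p <> 0 ->
  nearby p (fun w => f w = (f p + (w - p) ^ S m * g w)%C) ->
  nearby p (fun w => f1 w = ((w - p) ^ m * k w)%C) ->
  exists M, nearby p (fun w => good f f1 w -> log_weight f f1 w <= / 50 * ln (Cmod (w - p)%C) + M).
Proof.
  intros hbad hm e0 cf cg g0 ck k0 Ef E1.
  assert (hm2 : 2 <= INR m). { replace 2 with (INR 2) by (simpl; ring). now apply le_INR. }
  destruct (nearby_ln_bounded g p cg g0) as [Mg [hMg Bg]].
  destruct (nearby_ln_bounded k p ck k0) as [Mc [hMc Bc]].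
  destruct (nearby_ln_bounded (fun w => f w - 1)%C p) as [Mk [hMk Bk]].
  { apply ccont_at_minus; [easy | apply ccont_at_const]. }
  { rewrite e0. apply Cminus_1_nonzero. }
  assert (cq : ccont_at (fun w => k w - (w - p) * g w)%C p).
  { apply ccont_at_minus; [easy|]. apply ccont_at_mult; [|easy].
    apply (ccont_at_minus (fun w => w)); [|apply ccont_at_const].
    apply (cderiv_ccont_at _ _ 1), cderiv_id. }
  destruct (nearby_ln_upper _ p cq) as [Mq [hMq Bq]].
  exists (Mc + Mq + 2 * Mg + Mk).
  generalize (nearby_and _ _ _ (nearby_ln_neg f f1 p hbad) (nearby_and _ _ _ (nearby_and _ _ _ Bg Bc)
    (nearby_and _ _ _ (nearby_and _ _ _ Ef E1) (nearby_and _ _ _ Bk Bq)))).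
  apply nearby_imp.
  intros w [A0 [[[xg A1] [xc A2]] [[A3 A4] [[_ A5] A6]]]] hg.
  destruct (A0 hg) as [hwp hL]. destruct (good_nonzero f f1 w hg) as [x0 [x1 [x2 x3]]].
  assert (Es : (f1 w - f w)%C = ((w - p) ^ m * (k w - (w - p) * g w))%C).
  { rewrite A3, A4, e0, Cpow_S. ring. }
  assert (xq : (k w - (w - p) * g w)%C <> 0).
  { intros E. apply x3. rewrite Es, E. ring. }
  specialize (A6 xq).
  assert (Ll : ln (Cmod (f w)) = INR (S m) * ln (Cmod (w - p)%C) + ln (Cmod (g w))).
  { rewrite A3, e0, <- ln_Cmod_pow_mult by easy. f_equal. f_equal. ring. }
  unfold log_weight. rewrite Ll, Es, A4, !ln_Cmod_pow_mult, S_INR by easy.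
  set (L := ln (Cmod (w - p)%C)) in *.
  (* Reduces to [m = 2]: the order increases with [m], and [L <= 0]. *)
  assert (hmL : (INR m - 2) * L <= 0) by nra. lra.
Qed.

(** The order is at least [m - 63/100 (m + 1)], which is [11/100] at [m = 2] but negative at
    [m = 1]: double [1]-points have to be excluded by the absence of simple zeros of [f']. *)
Lemma log_weight_at_multiple_one (f f1 g k : C -> C) (p : C) (m : nat) : ~ good f f1 p ->
  (2 <= m)%nat -> f p = 1 -> ccont_at f p -> ccont_at f1 p ->
  ccont_at g p -> g p <> 0 -> ccont_at k p -> k p <> 0 ->
  nearby p (fun w => f w = (f p + (w - p) ^ S m * g w)%C) ->
  nearby p (fun w => f1 w = ((w - p) ^ m * k w)%C) ->
  exists M, nearby p (fun w => good f f1 w -> log_weight f f1 w <= / 50 * ln (Cmod (w - p)%C) + M).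
Proof.
  intros hbad hm e1 cf cf1 cg g0 ck k0 Ef E1.
  assert (hm2 : 2 <= INR m). { replace 2 with (INR 2) by (simpl; ring). now apply le_INR. }
  destruct (nearby_ln_bounded g p cg g0) as [Mg [hMg Bg]].
  destruct (nearby_ln_bounded k p ck k0) as [Mc [hMc Bc]].
  destruct (nearby_ln_bounded f p cf) as [Mf [hMf Bf]]. { rewrite e1. apply C1_nz. }
  destruct (nearby_ln_upper (fun w => f1 w - f w)%C p) as [Ms [hMs Bs]].
  { now apply ccont_at_minus. }
  exists (Mc + Ms + 2 * Mf + Mg).
  generalize (nearby_and _ _ _ (nearby_ln_neg f f1 p hbad) (nearby_and _ _ _ (nearby_and _ _ _ Bg Bc)
    (nearby_and _ _ _ (nearby_and _ _ _ Ef E1) (nearby_and _ _ _ Bf Bs)))).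
  apply nearby_imp.
  intros w [A0 [[[xg A1] [xc A2]] [[A3 A4] [[_ A5] A6]]]] hg.
  destruct (A0 hg) as [hwp hL]. destruct (good_nonzero f f1 w hg) as [x0 [x1 [x2 x3]]].
  specialize (A6 x3).
  assert (Lk : ln (Cmod (f w - 1)%C) = INR (S m) * ln (Cmod (w - p)%C) + ln (Cmod (g w))).
  { rewrite A3, e1, <- ln_Cmod_pow_mult by easy. f_equal. f_equal. ring. }
  assert (Ld : ln (Cmod (f1 w)) = INR m * ln (Cmod (w - p)%C) + ln (Cmod (k w))).
  { rewrite A4. now apply ln_Cmod_pow_mult. }
  unfold log_weight. rewrite Lk, Ld, S_INR.
  set (L := ln (Cmod (w - p)%C)) in *.
  assert (hmL : (INR m - 2) * L <= 0) by nra. lra.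
Qed.

(** The zero of [f' - f], where both functions take the value [1], outweighs the pole from [f - 1]:
    the exponents give [13/20 - 63/100 = 1/50]. *)
Lemma log_weight_at_simple_one (f f1 g : C -> C) (p d e : C) : ~ good f f1 p ->
  f p = 1 -> f1 p = 1 -> cderiv f p d -> cderiv f1 p e -> ccont_at g p -> g p <> 0 ->
  nearby p (fun w => f w = (f p + (w - p) ^ 1 * g w)%C) ->
  exists M, nearby p (fun w => good f f1 w -> log_weight f f1 w <= / 50 * ln (Cmod (w - p)%C) + M).
Proof.
  intros hbad e1 d1 hf hf1 cg g0 Ef.
  assert (cf := cderiv_ccont_at _ _ _ hf). assert (cf1 := cderiv_ccont_at _ _ _ hf1).
  destruct (nearby_ln_bounded g p cg g0) as [Mg [hMg Bg]].
  destruct (nearby_ln_bounded f p cf) as [Mf [hMf Bf]]. { rewrite e1. apply C1_nz. }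
  destruct (nearby_ln_upper f1 p cf1) as [Md [hMd Bd]].
  destruct (nearby_ln_zero (fun w => f1 w - f w)%C p _ (cderiv_minus _ _ _ _ _ hf1 hf)) as [Ms [hMs Bs]].
  { rewrite e1, d1. ring. }
  exists (Md + Ms + 2 * Mf + Mg).
  generalize (nearby_and _ _ _ (nearby_ln_neg f f1 p hbad) (nearby_and _ _ _ (nearby_and _ _ _ Bg Bd)
    (nearby_and _ _ _ Ef (nearby_and _ _ _ Bf Bs)))).
  apply nearby_imp.
  intros w [A0 [[[xg A1] A2] [A3 [[_ A5] A6]]]] hg.
  destruct (A0 hg) as [hwp hL]. destruct (good_nonzero f f1 w hg) as [x0 [x1 [x2 x3]]].
  specialize (A6 x3). specialize (A2 x2).
  assert (Lk : ln (Cmod (f w - 1)%C) = INR 1 * ln (Cmod (w - p)%C) + ln (Cmod (g w))).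
  { rewrite A3, e1, <- ln_Cmod_pow_mult by easy. f_equal. f_equal. ring. }
  unfold log_weight. rewrite Lk. simpl INR. lra.
Qed.

(** Only numerators vanish here: [f'], with exponent [1], or [f' - f], with exponent [13/20]. *)
Lemma log_weight_elsewhere (f f1 : C -> C) (p d e : C) : ~ good f f1 p ->
  f p <> 0 -> f p <> 1 -> cderiv f p d -> cderiv f1 p e ->
  exists M, nearby p (fun w => good f f1 w -> log_weight f f1 w <= / 50 * ln (Cmod (w - p)%C) + M).
Proof.
  intros hbad n0 n1 hf hf1.
  assert (cf := cderiv_ccont_at _ _ _ hf). assert (cf1 := cderiv_ccont_at _ _ _ hf1).
  destruct (nearby_ln_bounded f p cf n0) as [Mf [hMf Bf]].
  destruct (nearby_ln_bounded (fun w => f w - 1)%C p) as [Mk [hMk Bk]].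
  { apply ccont_at_minus; [easy | apply ccont_at_const]. }
  { now apply Cminus_eq_contra. }
  assert (hs := cderiv_minus _ _ _ _ _ hf1 hf).
  assert (B := nearby_and _ _ _ (nearby_ln_neg f f1 p hbad) (nearby_and _ _ _ Bf Bk)).
  destruct (Ceq_dec (f1 p) 0) as [d0|nd].
  - destruct (nearby_ln_zero f1 p e hf1 d0) as [Md [hMd Bd]].
    destruct (nearby_ln_upper _ p (cderiv_ccont_at _ _ _ hs)) as [Ms [hMs Bs]].
    exists (Md + Ms + 2 * Mf + Mk).
    generalize (nearby_and _ _ _ B (nearby_and _ _ _ Bd Bs)). apply nearby_imp.
    intros w [[A0 [[_ A1] [_ A2]]] [A3 A4]] hg.
    destruct (A0 hg) as [hwp hL]. destruct (good_nonzero f f1 w hg) as [x0 [x1 [x2 x3]]].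
    specialize (A3 x2). specialize (A4 x3). unfold log_weight. lra.
  - assert (es : f1 p = f p).
    { apply NNPP. intros hne. apply hbad. now repeat split. }
    destruct (nearby_ln_zero _ p _ hs) as [Ms [hMs Bs]]. { rewrite es. ring. }
    destruct (nearby_ln_upper f1 p cf1) as [Md [hMd Bd]].
    exists (Md + Ms + 2 * Mf + Mk).
    generalize (nearby_and _ _ _ B (nearby_and _ _ _ Bd Bs)). apply nearby_imp.
    intros w [[A0 [[_ A1] [_ A2]]] [A3 A4]] hg.
    destruct (A0 hg) as [hwp hL]. destruct (good_nonzero f f1 w hg) as [x0 [x1 [x2 x3]]].
    specialize (A3 x2). specialize (A4 x3). unfold log_weight. lra.
Qed.

Lemma log_density_singular (f f1 f2 g k : C -> C) (p : C) (m : nat) (K : R) :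
  (forall w, cderiv f w (f1 w)) -> (forall w, cderiv f1 w (f2 w)) ->
  (f p = 0 -> f1 p = 0) -> (f1 p = 0 -> f2 p = 0) -> (f p = 1 -> f1 p <> 0 -> f1 p = 1) ->
  ccont_at g p -> g p <> 0 -> ccont_at k p -> k p <> 0 ->
  nearby p (fun w => f w = (f p + (w - p) ^ S m * g w)%C) ->
  nearby p (fun w => f1 w = ((w - p) ^ m * k w)%C) ->
  ~ good f f1 p ->
  nearby p (fun w => good f f1 w -> log_density f f1 w <= K).
Proof.
  intros H1 H2 hz hc hs cg g0 ck k0 Ef E1 hbad.
  assert (cf : ccont_at f p) by (eapply cderiv_ccont_at, H1).
  assert (cf1 : ccont_at f1 p) by (eapply cderiv_ccont_at, H2).
  assert (B2 : f1 p = 0 -> (2 <= m)%nat).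
  { intros h. apply (order_ge_2 f1 k p (f2 p) m); auto. }
  assert (HW : exists M, nearby p (fun w => good f f1 w ->
     log_weight f f1 w <= / 50 * ln (Cmod (w - p)%C) + M)).
  { destruct (Ceq_dec (f p) 0) as [e0|n0]; [|destruct (Ceq_dec (f p) 1) as [e1|n1]].
    - apply (log_weight_at_zero f f1 g k p m); auto.
    - destruct (Ceq_dec (f1 p) 0) as [d0|nd].
      + apply (log_weight_at_multiple_one f f1 g k p m); auto.
      + apply (log_weight_at_simple_one f f1 g p (f1 p) (f2 p)); auto.
        destruct m as [|m]; [exact Ef|]. exfalso. apply nd.
        destruct E1 as [r [hr E1]]. rewrite E1, Cpow_S.
        replace (p - p)%C with (RtoC 0) by ring. ring.
        replace (p - p)%C with (RtoC 0) by ring. now rewrite Cmod_0.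
    - apply (log_weight_elsewhere f f1 p (f1 p) (f2 p)); auto. }
  destruct HW as [M HW].
  destruct (nearby_ln_upper f p cf) as [Mf [hMf Bf]].
  destruct (nearby_ln_upper (fun w => f w - 1)%C p) as [Mk [hMk Bk]].
  { apply ccont_at_minus; [easy | apply ccont_at_const]. }
  (* Chosen so that [T / 50 + M + 1 + Mf + Mk = 33/20 * K]; in the ball of radius [exp T] the
     logarithm of the distance to [p] is at most [T]. *)
  set (T := 50 * (33 / 20 * K - (M + 1 + Mf + Mk))).
  generalize (nearby_and _ _ _ (nearby_and _ _ _ HW (nearby_ln_neg f f1 p hbad))
    (nearby_and _ _ _ (nearby_and _ _ _ Bf Bk) (nearby_ball p (exp T) (exp_pos T)))).
  apply nearby_imp. intros w [[A1 A0] [[A2 A3] A4]] hg.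
  specialize (A1 hg). destruct (A0 hg) as [hwp _].
  destruct (good_nonzero f f1 w hg) as [x0 [x1 [x2 x3]]].
  assert (s1 := softplus_bound _ _ (A2 x0) hMf). assert (s2 := softplus_bound _ _ (A3 x1) hMk).
  assert (hL : ln (Cmod (w - p)%C) <= T).
  { apply ln_le_of_le_exp; [now apply Cmod_gt_0 | lra]. }
  unfold log_density, potential. unfold log_weight in A1. unfold T in hL. lra.
Qed.

(** * Continuity of the density and existence of good points *)

Definition rcont_at (u : C -> R) (z : C) : Prop :=
  forall eps, 0 < eps -> nearby z (fun w => Rabs (u w - u z) < eps).

Lemma rcont_at_plus (u v : C -> R) (z : C) :
  rcont_at u z -> rcont_at v z -> rcont_at (fun w => u w + v w) z.
Proof.
  intros Hu Hv eps he.
  generalize (nearby_and _ _ _ (Hu (eps / 2) ltac:(lra)) (Hv (eps / 2) ltac:(lra))).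
  apply nearby_imp. intros w [h1 h2].
  replace (u w + v w - (u z + v z)) with ((u w - u z) + (v w - v z)) by ring.
  eapply Rle_lt_trans. apply Rabs_triang. lra.
Qed.

Lemma rcont_at_comp (psi : R -> R) (u : C -> R) (z : C) :
  continuity_pt psi (u z) -> rcont_at u z -> rcont_at (fun w => psi (u w)) z.
Proof.
  intros Hp Hu eps he. destruct (Hp eps he) as [d [hd H]].
  generalize (Hu d hd). apply nearby_imp. intros w hw.
  destruct (Req_dec (u z) (u w)) as [E|hne].
  - now rewrite E, Rminus_diag, Rabs_R0.
  - apply H. split; [now split | exact hw].
Qed.

Lemma rcont_at_ln_Cmod (g : C -> C) (z : C) : ccont_at g z -> g z <> 0 ->
  rcont_at (fun w => ln (Cmod (g w))) z.
Proof.
  intros hc hz. apply rcont_at_comp.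
  - apply derivable_continuous_pt. exists (/ Cmod (g z)). apply derivable_pt_lim_ln. now apply Cmod_gt_0.
  - intros eps he. destruct (hc eps he) as [r [hr H]]. exists r. split; [easy|].
    intros w hw. specialize (H w hw).
    assert (k1 := Cmod_sub_ge (g w) (g z)). assert (k2 := Cmod_sub_ge (g z) (g w)).
    rewrite Cmod_minus_sym in k2. apply Rabs_def1; lra.
Qed.

Lemma continuity_pt_mult_const (c x : R) : continuity_pt (fun y => c * y) x.
Proof. apply continuity_pt_scal. apply derivable_continuous_pt, derivable_pt_id. Qed.

Lemma rcont_at_log_density (f f1 f2 : C -> C) (z : C) :
  (forall w, cderiv f w (f1 w)) -> (forall w, cderiv f1 w (f2 w)) -> good f f1 z ->
  rcont_at (log_density f f1) z.
Proof.
  intros H1 H2 hg. destruct (good_nonzero f f1 z hg) as [x0 [x1 [x2 x3]]].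
  assert (cf : ccont_at f z) by (eapply cderiv_ccont_at, H1).
  assert (cf1 : ccont_at f1 z) by (eapply cderiv_ccont_at, H2).
  assert (cl := rcont_at_ln_Cmod f z cf x0).
  assert (ck := rcont_at_ln_Cmod (fun w => f w - 1)%C z (ccont_at_minus _ _ _ cf (ccont_at_const 1 z)) x1).
  assert (cd := rcont_at_ln_Cmod f1 z cf1 x2).
  assert (cs := rcont_at_ln_Cmod (fun w => f1 w - f w)%C z (ccont_at_minus _ _ _ cf1 cf) x3).
  assert (Hsc : forall c u, rcont_at u z -> rcont_at (fun w => c * u w) z).
  { intros c u. apply (rcont_at_comp (fun y => c * y)). apply continuity_pt_mult_const. }
  assert (Hsp : forall u, rcont_at u z -> rcont_at (fun w => softplus (u w)) z).
  { intros u. apply (rcont_at_comp softplus). apply derivable_continuous_pt.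
    exists (softplus1 (u z)). apply is_derive_Reals, is_derive_softplus. }
  assert (X := Hsc (20 / 33) _ (rcont_at_plus _ _ _ (rcont_at_plus _ _ _ (rcont_at_plus _ _ _
    (rcont_at_plus _ _ _ cd (Hsc (13 / 20) _ cs)) (Hsc (- (109 / 100)) _ cl))
    (Hsc (- (63 / 100)) _ ck)) (Hsc (/ 4) _ (rcont_at_plus _ _ _ (Hsp _ cl) (Hsp _ ck))))).
  intros eps he. generalize (X eps he). apply nearby_imp. intros w hw.
  unfold log_density, potential.
  match type of hw with Rabs ?a < _ => match goal with |- Rabs ?b < _ => replace b with a by ring end end.
  exact hw.
Qed.

Lemma good_nearby (f f1 : C -> C) (z : C) : ccont_at f z -> ccont_at f1 z ->
  good f f1 z -> nearby z (good f f1).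
Proof.
  intros cf cf1 hg. destruct (good_nonzero f f1 z hg) as [x0 [x1 [x2 x3]]].
  generalize (nearby_and _ _ _ (nearby_and _ _ _ (nearby_nonzero f z cf x0)
     (nearby_nonzero (fun w => f w - 1)%C z (ccont_at_minus _ _ _ cf (ccont_at_const 1 z)) x1))
    (nearby_and _ _ _ (nearby_nonzero f1 z cf1 x2)
     (nearby_nonzero (fun w => f1 w - f w)%C z (ccont_at_minus _ _ _ cf1 cf) x3))).
  apply nearby_imp. intros w [[A1 A2] [A3 A4]]. repeat split; auto.
  - intros E. apply A2. rewrite E. ring.
  - intros E. apply A4. rewrite E. ring.
Qed.

(** By continuity [f1 - f] stays nonzero near [p], and the factorizations make [p] the only possible
    zero of [f], [f - 1] and [f1] in a small disc; any other point of that disc is good. *)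
Lemma good_exists (f f1 g k : C -> C) (p : C) (m : nat) :
  ccont_at f p -> ccont_at f1 p -> f1 p <> f p ->
  ccont_at g p -> g p <> 0 -> ccont_at k p -> k p <> 0 ->
  nearby p (fun w => f w = (f p + (w - p) ^ S m * g w)%C) ->
  nearby p (fun w => f1 w = ((w - p) ^ m * k w)%C) ->
  exists z, good f f1 z.
Proof.
  intros cf cf1 hne cg g0 ck k0 Ef E1.
  assert (Hv : forall v : C, nearby p (fun w => w <> p -> f w <> v)).
  { intros v. destruct (Ceq_dec (f p) v) as [<-|hv].
    - generalize (nearby_and _ _ _ Ef (nearby_nonzero g p cg g0)). apply nearby_imp.
      intros w [A1 A2] hw E. rewrite A1 in E.
      apply (Cmult_neq_0 ((w - p) ^ S m) (g w)); [apply Cpow_nz; now apply Cminus_eq_contra | easy |].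
      replace ((w - p) ^ S m * g w)%C with (f p + (w - p) ^ S m * g w - f p)%C by ring.
      rewrite E. ring.
    - generalize (nearby_nonzero (fun w => f w - v)%C p (ccont_at_minus _ _ _ cf (ccont_at_const v p))
        (Cminus_eq_contra _ _ hv)).
      apply nearby_imp. intros w h _ E. apply h. rewrite E. ring. }
  destruct (nearby_and _ _ _ (nearby_and _ _ _ (Hv 0) (Hv 1)) (nearby_and _ _ _
    (nearby_and _ _ _ E1 (nearby_nonzero k p ck k0))
    (nearby_nonzero (fun w => f1 w - f w)%C p (ccont_at_minus _ _ _ cf1 cf) (Cminus_eq_contra _ _ hne))))
    as [r [hr H]].
  exists (p + RtoC (r / 2))%C.
  assert (hw : (p + RtoC (r / 2))%C <> p).
  { intros E. assert (E' : RtoC (r / 2) = 0).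
    { replace (RtoC (r / 2)) with (p + RtoC (r / 2) - p)%C by ring. rewrite E. ring. }
    apply RtoC_inj in E'. lra. }
  destruct (H (p + RtoC (r / 2))%C) as [[A1 A2] [[A3 A4] A5]].
  { replace (p + RtoC (r / 2) - p)%C with (RtoC (r / 2)) by ring. rewrite Cmod_R, Rabs_right; lra. }
  repeat split; auto.
  - rewrite A3. apply Cmult_neq_0; [apply Cpow_nz; now apply Cminus_eq_contra | easy].
  - intros E. apply A5. rewrite E. ring.
Qed.

(** * The case [a = 1] and the reduction to it *)

Lemma share_value_one (f : C -> C) :
  entire f -> nonconstant f ->
  (forall z, f z = 0 -> C_derive f z = 0) ->
  (forall z, C_derive f z = 0 -> C_derive (C_derive f) z = 0) ->
  (forall z, f z = 1 -> C_derive f z <> 0 -> C_derive f z = 1) ->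
  forall z, f z = C_derive f z.
Proof.
  intros hf hnc hz hc hs z0. apply NNPP. intros hne.
  set (f1 := C_derive f) in *. set (f2 := C_derive f1) in *. set (f3 := C_derive f2).
  assert (e1 : entire f1) by now apply entire_derive.
  assert (e2 : entire f2) by now apply entire_derive.
  assert (H1 : forall w, cderiv f w (f1 w)) by (intros; now apply entire_cderiv).
  assert (H2 : forall w, cderiv f1 w (f2 w)) by (intros; now apply entire_cderiv).
  assert (H3 : forall w, cderiv f2 w (f3 w)) by (intros; now apply entire_cderiv).
  assert (cf : forall w, ccont_at f w) by (intros; eapply cderiv_ccont_at, H1).
  assert (cf1 : forall w, ccont_at f1 w) by (intros; eapply cderiv_ccont_at, H2).
  assert (Hord : forall p, exists m g k, ccont_at g p /\ g p <> 0 /\ ccont_at k p /\ k p <> 0 /\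
    nearby p (fun w => f w = (f p + (w - p) ^ S m * g w)%C) /\
    nearby p (fun w => f1 w = ((w - p) ^ m * k w)%C)).
  { intros p. destruct (entire_local_order f p hf hnc)
      as [m [r [g [k [hr [cg [g0 [ck [k0 [Ef E1]]]]]]]]]].
    exists m, g, k. repeat split; auto; exists r; auto. }
  (* A point where [f] and [f'] differ yields a good point, while the Ahlfors-Schwarz argument
     excludes all good points. *)
  destruct (Hord z0) as [m [g [k [cg [g0 [ck [k0 [Ef E1]]]]]]]].
  destruct (good_exists f f1 g k z0 m (cf z0) (cf1 z0) (not_eq_sym hne) cg g0 ck k0 Ef E1) as [z Hz].
  revert Hz.
  apply (ahlfors_no_solution (log_density f f1) (good f f1) (5 / 33 * / 2500 * exp (- 20)) (33 / 20)).
  - apply Rmult_lt_0_compat; [lra | apply exp_pos].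
  - lra.
  - intros p hg. apply good_nearby; auto.
  - intros p hg. exact (rcont_at_log_density f f1 f2 p H1 H2 hg).
  - intros p hbad K. destruct (Hord p) as [m' [g' [k' [cg' [g0' [ck' [k0' [Ef' E1']]]]]]]].
    apply (log_density_singular f f1 f2 g' k' p m' K); auto.
  - intros p hg. destruct (jet_log_density f f1 f2 f3 p H1 H2 H3 hg) as [ax [ay J]].
    exists ax, ay. eexists. split. exact J. now apply log_density_liouville.
Qed.

Theorem theorem1 (f : C -> C) (a : C)
    (hf : entire f) (hnc : nonconstant f) (ha : a <> RtoC 0%R)
    (hshare : share_simple_zeroes f (C_derive f))
    (hsimple : forall z : C, simple_c_point f a z -> c_point (C_derive f) a z) :
  forall z : C, f z = C_derive f z.
Proof.
  assert (H1 : forall w, cderiv f w (C_derive f w)) by (intros; now apply entire_cderiv).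
  assert (H2 : forall w, cderiv (C_derive f) w (C_derive (C_derive f) w)).
  { intros. apply entire_cderiv. now apply entire_derive. }
  (* Dividing by [a] sends the value [a] to [1] and preserves the zeros of all derivatives as well
     as the equation to be proved. *)
  set (h := fun z => (/ a * f z)%C).
  assert (D1 : forall z, C_derive h z = (/ a * C_derive f z)%C).
  { intros z. apply C_derive_cderiv, cderiv_scal, H1. }
  assert (D2 : forall z, C_derive (C_derive h) z = (/ a * C_derive (C_derive f) z)%C).
  { intros z. apply C_derive_cderiv.
    refine (cderiv_ext_loc _ _ _ _ 1 Rlt_0_1 _ (cderiv_scal (/ a) _ _ _ (H2 z))).
    intros w _. now rewrite D1. }
  assert (Hinj : forall x y : C, (/ a * x = / a * y)%C -> x = y).
  { intros x y E. apply (f_equal (fun t => a * t)%C) in E.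
    rewrite !Cmult_assoc, !Cinv_r, !Cmult_1_l in E by easy. exact E. }
  assert (Hzero : forall x : C, (/ a * x = 0)%C -> x = 0).
  { intros x E. apply Hinj. rewrite E. ring. }
  assert (Hone : forall x : C, (/ a * x = 1)%C -> x = a).
  { intros x E. apply Hinj. rewrite E. field. easy. }
  (* At a shared simple zero [f'] would be nonzero, as the zero of [f] is simple, and also zero. *)
  assert (Hnosimple : forall z, ~ simple_c_point f 0 z).
  { intros z Hz. assert (X := proj1 (hshare z) Hz). destruct Hz as [_ Hz], X as [X _]. now apply Hz. }
  assert (Hnosimple1 : forall z, ~ simple_c_point (C_derive f) 0 z).
  { intros z Hz. apply (Hnosimple z). now apply hshare. }
  intros z. apply Hinj. rewrite <- D1. change (/ a * f z)%C with (h z).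
  apply share_value_one; clear z.
  - intros z. exists (/ a * C_derive f z)%C. now apply cderiv_is_derive, cderiv_scal.
  - intros [c Hc]. apply hnc. exists (a * c)%C. intros z. rewrite <- (Hc z). unfold h. field. easy.
  - intros z Ez. rewrite D1. apply Hzero in Ez.
    replace (C_derive f z) with (RtoC 0). ring. symmetry. apply NNPP. intros hd.
    now apply (Hnosimple z).
  - intros z. rewrite D1, D2. intros Ez. apply Hzero in Ez.
    replace (C_derive (C_derive f) z) with (RtoC 0). ring. symmetry. apply NNPP. intros hd.
    now apply (Hnosimple1 z).
  - intros z Ez. rewrite D1. intros hd. apply Hone in Ez.
    assert (E := hsimple z). unfold c_point in E. rewrite E. field. easy.
    split. easy. intros E0. apply hd. rewrite E0. ring.
Qed.
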